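(* Assume that H1 and H2$^*$ hold and that $\mathcal{K}\subset\Omega\times W^{1,\infty}$ is a positively $\Pi$-invariant compact set projecting over the whole base and such that each one of its elements admits at least one backward extension in $\mathcal{K}$. Let $\lambda_{\mathcal{K}}$ be the upper Lyapunov exponent of $\mathcal{K}$. The following statements are equivalent: (1) $\lambda_{\mathcal{K}}<0$. (2) There exist $\beta>0$, $k_1\ge1$ and $\delta_1>0$ such that, if $(\omega,\bar x)\in\mathcal{K}$ and $(\omega,x)\in\Omega\times W^{1,\infty}$ satisfy $\|x-\bar x\|_C\le\delta_1$, then $y(t,\omega,x)$ is defined for $t\in[-r,\infty)$ and $$|y(t,\omega,x)-y(t,\omega,\bar x)|\le k_1e^{-\beta t}\|x-\bar x\|_C\quad\text{for all }t\ge-r,$$ so that $$\|u(t,\omega,x)-u(t,\omega,\bar x)\|_C\le k_1e^{\beta r}e^{-\beta t}\|x-\bar x\|_C\quad\text{for all }t\ge0.$$ (3) The set $\mathcal{K}$ is exponentially stable; i.e., there exist $\beta>0$, $k_2\ge1$ and $\delta_2>0$ such that, if $(\omega,\bar x)\in\mathcal{K}$ and $(\omega,x)\in\Omega\times W^{1,\infty}$ satisfy $\|x-\bar x\|_{W^{1,\infty}}<\delta_2$, then $u(t,\omega,x)$ is defined for $t\in[0,\infty)$ and $$\|u(t,\omega,x)-u(t,\omega,\bar x)\|_{W^{1,\infty}}\le k_2e^{-\beta t}\|x-\bar x\|_{W^{1,\infty}}\quad\text{for all }t\ge0.$$ In addition, if (1) holds, then any $\beta\in(0,-\lambda_{\mathcal{K}})$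 can be taken in (2) and (3) (changing the constants $\delta_1,k_1,\delta_2,k_2$ if required).
   Context: Fix $r>0$ and $n\ge1$. $C=C([-r,0],\mathbb{R}^n)$ with the supremum norm $\|\cdot\|_C$; $W^{1,\infty}$ is the Banach space of Lipschitz functions $\psi:[-r,0]\to\mathbb{R}^n$ with norm $\|\psi\|_{W^{1,\infty}}=\max\{\|\psi\|_C,\|\dot\psi\|_{L^\infty}\}$. For a continuous function $y$ on $[t-r,t]$, $y_t(s)=y(t+s)$, $s\in[-r,0]$. $(\Omega,\sigma,\mathbb{R})$ is a continuous flow on a compact metric space, and $\omega\cdot t=\sigma(t,\omega)$. $\mathrm{Lin}(X,Y)$ is the space of bounded linear maps with the operator norm. Consider the family of equations, for $\omega\in\Omega$, $$\dot y(t)=F(\omega\cdot t,\,y(t),\,y(t-\tau(\omega\cdot t,y_t))),\quad t\ge0,$$ with $F:\Omega\times\mathbb{R}^n\times\mathbb{R}^n\to\mathbb{R}^n$ and $\tau:\Omega\times C\to[0,r]$. Conditions: H1: $F$ is continuous and its partial derivatives with respect to the second and third arguments exist and are continuous on $\Omega\times\mathbb{R}^n\times\mathbb{R}^n$. H2$^*$: (1) $\tau$ is continuous and differentiable with respect to its second argument, with $D_2\tau:\Omega\times C\to\mathrm{Lin}(C,\mathbb{R})$ continuous. (2) For every bounded and closed $\mathcal{B}\subset C$ there is $L_1=L_1(\mathcal{B})>0$ with $|\tau(\omega,x_1)-\tau(\omega,x_2)|\le L_1\|x_1-x_2\|_C$ for all $\omega\in\Omega$, $x_1,x_2\in\mathcal{B}$.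 (3) For every bounded and closed $\mathcal{B}\subset C$ there is $L_2=L_2(\mathcal{B})>0$ with $\|D_2\tau(\omega,x_1)-D_2\tau(\omega,x_2)\|_{\mathrm{Lin}(C,\mathbb{R})}\le L_2\|x_1-x_2\|_C$ for all $\omega\in\Omega$, $x_1,x_2\in\mathcal{B}$. Under these conditions, for each $\omega\in\Omega$ and $x\in W^{1,\infty}$ there is a unique maximal solution $y(t,\omega,x)$ with $y(s,\omega,x)=x(s)$ for $s\in[-r,0]$, defined on $[-r,\beta_{\omega,x})$, $0<\beta_{\omega,x}\le\infty$. Put $u(t,\omega,x)(s)=y(t+s,\omega,x)$, which belongs to $W^{1,\infty}$, and $\Pi(t,\omega,x)=(\omega\cdot t,u(t,\omega,x))$ for $t\in[0,\beta_{\omega,x})$. A set $\mathcal{M}$ is positively $\Pi$-invariant if $\beta_{\omega,x}=\infty$ and $\Pi(t,\omega,x)\in\mathcal{M}$ for all $(\omega,x)\in\mathcal{M}$, $t\ge0$. It projects over the whole base if for every $\omega\in\Omega$ there is $x$ with $(\omega,x)\in\mathcal{M}$. A point $(\omega,x)\in\mathcal{M}$ admits a backward extension in $\mathcal{M}$ if there is a continuous $\theta:(-\infty,0]\to\mathcal{M}$ with $\theta(0)=(\omega,x)$ and $\Pi(t,\theta(s))=\theta(t+s)$ whenever $s\le-t\le0$. The existence of backward extensions implies that $\bar x$ is $C^1$ for all $(\omega,\bar x)\in\mathcal{K}$. For $(\omega,\bar x)\in\mathcal{K}$ and $\phi\in C$ define $$\begin{aligned}L(\omega,\bar x)\phi={}&D_2F(\omega,\bar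 x(0),\bar x(-\tau(\omega,\bar x)))\phi(0)+D_3F(\omega,\bar x(0),\bar x(-\tau(\omega,\bar x)))\phi(-\tau(\omega,\bar x))\\&-D_3F(\omega,\bar x(0),\bar x(-\tau(\omega,\bar x)))\,\dot{\bar x}(-\tau(\omega,\bar x))\cdot D_2\tau(\omega,\bar x)\phi .\end{aligned}$$ For $v\in C$ let $z(t,\omega,\bar x,v)$, $t\ge-r$, be the solution of $\dot z(t)=L(\Pi(t,\omega,\bar x))z_t$, $t\ge0$, with $z(s)=v(s)$ on $[-r,0]$, and let $w(t,\omega,\bar x,v)(s)=z(t+s,\omega,\bar x,v)$, $s\in[-r,0]$ (which lies in $W^{1,\infty}$ if $v$ does). The upper Lyapunov exponent of $\mathcal{K}$ is (with $\ln0=-\infty$) $$\lambda_{\mathcal{K}}=\sup_{(\omega,\bar x)\in\mathcal{K}}\ \sup_{0\ne v\in W^{1,\infty}}\limsup_{t\to\infty}\tfrac1t\ln\|w(t,\omega,\bar x,v)\|_{W^{1,\infty}},$$ which coincides with the analogous quantity $\sup_{(\omega,\bar x)\in\mathcal{K}}\sup_{0\ne v\in C}\limsup_{t\to\infty}\frac1t\ln\|w(t,\omega,\bar x,v)\|_C$. *)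

(* Defs.v *)
From HB Require Import structures.
From mathcomp Require Import all_boot all_order all_algebra.
From mathcomp Require Import all_classical all_reals all_analysis ess_sup_inf.
From mathcomp Require Import ring lra.

Set Implicit Arguments.
Unset Strict Implicit.
Unset Printing Implicit Defensive.

Import Order.TTheory GRing.Theory Num.Theory.
Import numFieldNormedType.Exports.

Local Open Scope classical_set_scope.
Local Open Scope ring_scope.

Section lipschitz_ae_derivable.
Context {R : realType}.
Local Notation mu := (@lebesgue_measure R).
Local Notation lsm := lebesgue_stieltjes_measure.

Lemma lsm_itv (h : cumulative R R) (a b : R) : a <= b ->
  lsm h `]a, b]%classic = (h b - h a)%:E.
Proof.
move=> ab; rewrite /lsm /measure_extension measurable_mu_extE/=; last exact: is_ocitv.
by rewrite wlength_itv_bnd// EFinB.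
Qed.

Lemma lsmD (h k : cumulative R R) : (forall s, h s + k s = s) ->
  forall A, measurable A -> mu A = (lsm h A + lsm k A)%E.
Proof.
move=> hk A mA; rewrite -measure_addE.
apply: (@lebesgue_measure_unique R (measure_add (lsm h) (lsm k))) => // X.
move=> [[x y] _ <-]; apply: etrans (esym (measure_addE (lsm h) (lsm k) _)).
have [xy|yx] := leP x y; last by rewrite set_itv_ge ?bnd_simp -?leNgt ?ltW// !measure0 adde0.
have E f := lsm_itv f xy; apply: etrans (E _) _.
apply: etrans (esym (congr2 _ (E h) (E k))); rewrite -EFinD; congr EFin.
rewrite /=; have := hk x; have := hk y; lra.
Qed.

Lemma cumulative_pair_ae_derivable (h k : cumulative R R) (a b : R) :
  (forall s, h s + k s = s) ->
  {ae mu, forall s, a < s < b -> derivable h s 1}.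
Proof.
move=> hk; have [ab|ba] := ltP a b; last first.
  by apply: nearW => s /andP[/lt_trans/[apply]]; rewrite ltNge ba.
pose D := `]a, b]%classic : set (measurableTypeR R).
have mD : measurable D by exact: measurable_itv.
have Doo : (lsm h D < +oo)%E by rewrite lsm_itv ?ltW// ltry.
pose nu := mfrestr mD Doo.
have numu : nu `<< mu.
  apply/null_content_dominatesP => A mA mu0.
  have /eqP := etrans (esym (lsmD hk mA)) mu0.
  rewrite padde_eq0// => /andP[/eqP hA _].
  apply/eqP; rewrite eq_le measure_ge0 andbT -hA /nu /= /mfrestr /mrestr.
  by apply: le_measure; rewrite ?inE//; exact: measurableI.
have [f [f0 ffin intf nuE]] := radon_nikodym_sigma_finite numu.
pose g : R -> R := fine \o f.
have gE : EFin \o g = f by apply/funext => x /=; rewrite /g/= fineK.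
have FTC := @FTC1 R g (BRight a).
have : forall y, mu.-integrable [set` Interval (BRight a) (BRight y)] (EFin \o g).
  by move=> y; rewrite gE; exact: integrableS intf.
move=> /FTC{}FTC.
have : locally_integrable [set: R] g.
  by apply: open_integrable_locally; [exact: openT|rewrite gE].
move=> /FTC{}FTC.
have hE x : a < x <= b -> h x = \int[mu]_(t in `]a, x]) g t + h a.
  move=> /andP[ax xb].
  have mx : measurable (`]a, x]%classic : set (measurableTypeR R)).
    exact: measurable_itv.
  rewrite /Rintegral -[X in fine X](_ : (h x - h a)%:E = _) ?subrK//.
  rewrite -(lsm_itv h (ltW ax)).
  have -> : (\int[mu]_(t in `]a, x]) (g t)%:E = \int[mu]_(t in `]a, x]) f t)%E.
    by apply: eq_integral => t _; rewrite -[in RHS]gE.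
  apply: etrans _ (nuE _ mx).
  rewrite /= /mfrestr /mrestr setIidl//.
  by apply: subset_itvl; rewrite bnd_simp.
have aef := ae_filter_ringOfSetsType mu.
apply: filterS FTC => s FTC /andP[aS sb].
have [Fs _] := FTC aS.
have : derivable ((fun x => \int[mu]_(t in `]a, x]) g t) + cst (h a)) s 1.
  by apply: derivableD.
apply: near_eq_derivable.
near=> x; rewrite fctE /= -hE//; apply/andP; split; last apply: ltW; near: x.
  exact: lt_nbhsr.
exact: lt_nbhsl.
Unshelve. all: by end_near. Qed.

Lemma lipschitz_ae_derivable (g : R -> R) (M a b : R) :
  (forall s t, `|g s - g t| <= M * `|s - t|) ->
  {ae mu, forall s, a < s < b -> derivable g s 1}.
Proof.
move=> gM; pose K := `|M| + 1.
have K0 : 0 < K by rewrite ltr_wpDl.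
have gK s t : s <= t -> `|g t - g s| <= K * (t - s).
  move=> st; rewrite (le_trans (gM _ _))// ger0_norm ?subr_ge0//.
  by rewrite ler_wpM2r ?subr_ge0// (le_trans (ler_norm M))// lerDl.
have cg : continuous g.
  move=> s; apply/cvgrPdist_le => e e0; near=> t.
  rewrite (@le_trans _ _ (K * `|s - t|))//.
    have [st|/ltW ts] := leP s t.
      by rewrite distrC (le_trans (gK _ _ st))// distrC ler_wpM2l ?ler_norm// ltW.
    by rewrite (le_trans (gK _ _ ts))// ler_wpM2l ?ler_norm// ltW.
  rewrite -ler_pdivlMl//; near: t.
  by apply: cvgr_dist_le; [exact: cvg_id|rewrite mulr_gt0// invr_gt0].
pose p (e : R) s := (s + e * (g s / K)) / 2.
have pnd e : `|e| = 1 -> {homo p e : x y / x <= y}.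
  move=> e1 x y xy; rewrite /p ler_wpM2r//.
  have : `|e * ((g x - g y) / K)| <= y - x.
    rewrite normrM e1 mul1r normrM distrC normfV (gtr0_norm K0).
    by rewrite ler_pdivrMr// mulrC gK.
  by rewrite mulrBl mulrBr ler_norml => /andP[_]; lra.
have prc e : right_continuous (p e).
  apply: right_continuousW => s; apply: cvgM; last exact: cvg_cst.
  apply: cvgD; first exact: cvg_id.
  by apply: cvgM; [exact: cvg_cst|apply: cvgM; [exact: cg|exact: cvg_cst]].
pose h : cumulative R R := HB.pack (p 1)
  (isCumulative.Build R _ R (p 1) (pnd 1 (normr1 _)) (prc 1)).
pose k : cumulative R R := HB.pack (p (- 1))
  (isCumulative.Build R _ R (p (- 1)) (pnd (- 1) (normrN1 _)) (prc (- 1))).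
have hk s : h s + k s = s by rewrite /h /k /= /p; lra.
have aef := ae_filter_ringOfSetsType mu.
apply: filterS (cumulative_pair_ae_derivable a b hk) => s hs asb.
have -> : g = K *: (2 *: (h : R -> R) - id).
  apply/funext => t; rewrite /h /= /p /GRing.scale /=.
  change (g t = K * (2 * ((t + 1 * (g t / K)) / 2) - t)).
  by field; rewrite gt_eqF.
by apply: derivableZ; apply: derivableB; [apply: derivableZ; exact: hs|exact: derivable_id].
Unshelve. all: by end_near. Qed.
End lipschitz_ae_derivable.

Section deriv_in.
Context {R : realType} {V : normedModType R}.
Implicit Types (A : set R) (f : R -> V) (s : R).

(* Derivative of the restriction of f to A: one-sided at an endpoint of an
   interval A, two-sided in its interior. *)
Definition is_deriv_in A f s (d : V) : Prop :=
  h^-1 *: (f (s + h) - f s) @[h --> within [set h | A (s + h)] 0^'] --> d.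

Definition deriv_in A f s : V :=
  lim (h^-1 *: (f (s + h) - f s) @[h --> within [set h | A (s + h)] 0^']).

End deriv_in.

Section opnorm.
Context {R : realType} {X Y : normedModType R}.

(* Meaningful for bounded linear maps only (sup of an unbounded set is 0). *)
Definition opnorm (A : X -> Y) : R :=
  sup [set `|A v| | v in [set v : X | `|v| <= 1]].

Definition opnorm_continuous {T : topologicalType} (D : T -> X -> Y) : Prop :=
  forall p, opnorm (D q \- D p) @[q --> p] --> (0 : R).

End opnorm.

Section CSpace.
Context {R : realType} (r : {posnum R}) (n : nat).
Local Notation V := 'rV[R]_n.
Local Notation J := (`[- r%:num, 0]%classic).

Definition clamp (s : R) : R := Num.max (- r%:num) (Num.min s 0).

Definition cseg : {pred R -> V} :=
  mem [set f : R -> V | continuous f /\ forall s, f (clamp s) = f s].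

(* C([-r,0], R^n), with the max norm of the library on R^n: a function on
   [-r,0] is represented by its extension to the line that is constant on each
   side of [-r,0]. *)
Record CSpace := MkC { cfun :> R -> V ; _ : cfun \in cseg }.

HB.instance Definition _ := [isSub for cfun].
HB.instance Definition _ := [Choice of CSpace by <:].

Lemma clamp_in s : clamp s \in `[- r%:num, 0].
Proof.
by rewrite in_itv/= /clamp le_max lexx/= ge_max oppr_le0 ge0//= ge_min lexx orbT.
Qed.

Lemma clamp_id s : s \in `[- r%:num, 0] -> clamp s = s.
Proof.
by rewrite in_itv/= => /andP[rs s0]; rewrite /clamp (min_idPl s0); apply/max_idPr.
Qed.

Lemma clamp_clamp s : clamp (clamp s) = clamp s.
Proof. exact/clamp_id/clamp_in. Qed.

Lemma clamp_continuous : continuous clamp.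
Proof.
have cmin : continuous ((@idfun R) \min (cst 0)).
  by move=> s; apply: continuous_min; [exact: cvg_id|exact: cst_continuous].
suff : continuous ((cst (- r%:num) : R -> R^o) \max ((@idfun R) \min (cst 0))) by [].
by move=> s; apply: continuous_max; [exact: cst_continuous|exact: cmin].
Qed.

Lemma cseg_submod_closed : submod_closed cseg.
Proof.
split.
  by rewrite inE; split => // x; exact: cst_continuous.
move=> a f g /[!inE] -[cf ef] [cg eg]; split => [x|x].
  by apply: cvgD; [apply: cvgZl_tmp; exact: cf|exact: cg].
by change (a *: f (clamp x) + g (clamp x) = a *: f x + g x); rewrite ef eg.
Qed.

HB.instance Definition _ := GRing.isSubmodClosed.Build R (R -> V) cseg
  cseg_submod_closed.
HB.instance Definition _ := [SubChoice_isSubLmodule of CSpace by <:].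

Definition cnorm (f : CSpace) : R := sup [set `|f s| | s in J].

Let cfun_has_sup (f : CSpace) : has_sup [set `|f s| | s in J].
Proof.
have /[!inE] -[cf _] := valP f.
apply: compact_has_sup.
  by exists `|f 0|, 0 => //=; rewrite in_itv/= oppr_le0 ge0 lexx.
apply: continuous_compact; last exact: segment_compact.
apply: continuous_subspaceT => s.
by apply: (@continuous_comp _ _ _ f Num.norm); [exact: cf|exact: norm_continuous].
Qed.

Lemma cnorm_ub (f : CSpace) s : `|f s| <= cnorm f.
Proof.
have /[!inE] -[_ <-] := valP f.
by apply: (ub_le_sup (cfun_has_sup f).2); exists (clamp s) => //; exact: clamp_in.
Qed.

Lemma cnorm_le (f : CSpace) M : (forall s, `|f s| <= M) -> cnorm f <= M.
Proof.
move=> fM; apply: ge_sup; first exact: (cfun_has_sup f).1.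
by move=> _ [s _ <-].
Qed.

Let cnormD f g : cnorm (f + g) <= cnorm f + cnorm g.
Proof.
by apply: cnorm_le => s; rewrite (le_trans (ler_normD _ _))// lerD// cnorm_ub.
Qed.

Let cnormZ (a : R) f : cnorm (a *: f) = `|a| * cnorm f.
Proof.
have le b g : cnorm (b *: g) <= `|b| * cnorm g.
  by apply: cnorm_le => s; rewrite normrZ ler_wpM2l// cnorm_ub.
apply/eqP; rewrite eq_le le/=; have [->|a0] := eqVneq a 0.
  by rewrite normr0 mul0r (le_trans _ (cnorm_ub _ 0)).
rewrite -ler_pdivlMl ?normr_gt0// -normfV.
by rewrite -[X in cnorm X <= _](scalerK a0) le.
Qed.

Let cnorm0_eq0 f : cnorm f = 0 -> f = 0.
Proof.
move=> f0; apply/val_inj/funext => s; apply/eqP.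
by rewrite -normr_le0 -f0 cnorm_ub.
Qed.

HB.instance Definition _ := Lmodule_isNormed.Build R CSpace
  cnormD cnormZ cnorm0_eq0.

End CSpace.

Section WSpace.
Context {R : realType} (r : {posnum R}) (n : nat).
Local Notation V := 'rV[R]_n.
Local Notation J := (`[- r%:num, 0]%classic).
Local Notation mu := (@lebesgue_measure R).

Let clamp_lip s t : `|clamp r s - clamp r t| <= `|s - t|.
Proof.
have r0 : 0 < r%:num by [].
rewrite /clamp /Num.max /Num.min.
case: (ltP s 0) => ?; case: (ltP t 0) => ?; rewrite ?oppr_lt0 ?r0;
  case: (ltP (- r%:num) s) => ?; case: (ltP (- r%:num) t) => ?;
  rewrite ler_norml; apply/andP;
  have := ler_norm (s - t); have := ler_norm (t - s); rewrite (distrC t s);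
  split; lra.
Qed.

Definition wseg : {pred CSpace r n} :=
  mem [set f : CSpace r n | [lipschitz (f : R -> V) s | s in J]].

(* W^{1,oo}([-r,0], R^n) *)
Record WSpace := MkW { wfun :> CSpace r n ; _ : wfun \in wseg }.

HB.instance Definition _ := [isSub for wfun].
HB.instance Definition _ := [Choice of WSpace by <:].

Lemma wsegP (f : CSpace r n) :
  f \in wseg <-> exists M : R, forall s t : R, `|f s - f t| <= M * `|s - t|.
Proof.
rewrite inE /wseg/=; split.
  move=> /pinfty_ex_gt0 [M M0 fM].
  exists M => s t; have /[!inE] -[_ ef] := valP f.
  rewrite -(ef s) -(ef t).
  have /= := fM (clamp r s, clamp r t) (conj (clamp_in r s) (clamp_in r t)).
  move=> /le_trans; apply; by rewrite ler_wpM2l ?clamp_lip// ltW.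
move=> [M fM]; exists M; split; first exact: num_real.
move=> N MN -[s t] _ /=; by rewrite (le_trans (fM _ _))// ler_wpM2r// ltW.
Qed.

Lemma wseg_submod_closed : submod_closed wseg.
Proof.
split; first by apply/wsegP; exists 0 => s t; rewrite subrr normr0 mul0r.
move=> a f g /wsegP [M fM] /wsegP [N gN]; apply/wsegP; exists (`|a| * M + N) => s t.
change (`|a *: f s + g s - (a *: f t + g t)| <= (`|a| * M + N) * `|s - t|).
rewrite opprD addrACA -scalerBr (le_trans (ler_normD _ _))// mulrDl lerD//.
by rewrite normrZ -mulrA ler_wpM2l.
Qed.

HB.instance Definition _ := GRing.isSubmodClosed.Build R (CSpace r n) wseg
  wseg_submod_closed.
HB.instance Definition _ := [SubChoice_isSubLmodule of WSpace by <:].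

(* Essential supremum over [-r,0] of the norm of the almost everywhere defined
   derivative. *)
Definition linfnorm (f : WSpace) : \bar R :=
  'N[mu]_+oo[(fun s => `|deriv_in J f s|%:E) \_ J].

Definition wnorm (f : WSpace) : R := Num.max `|wfun f| (fine (linfnorm f)).

Let derivWE (f : WSpace) s : s \in `]- r%:num, 0[ ->
  deriv_in J f s = 'D_1 (f : R -> V) s.
Proof.
move=> sJ; rewrite /deriv_in /derive.
have -> : within [set h | J (s + h)] 0^' = 0^' :> set_system R.
  apply/seteqP; split => A; last by apply: filterS => h.
  rewrite /within/= => wA; near=> h; apply: (near wA h) => //.
  apply: subset_itv_oo_cc; near: h; apply: cvg_within.
  have : s + h @[h --> 0] --> s.
    by rewrite -[X in _ --> X]addr0; apply: cvgD; [exact: cvg_cst|exact: cvg_id].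
  by move=> /(_ _ (near_in_itvoo sJ)).
have -> : (fun h => h^-1 *: (f (s + h) - f s)) =
    (fun h => h^-1 *: (((f : R -> V) \o shift s) (h *: 1) - f s)).
  apply/funext => h; congr (_ *: (f _ - _)); rewrite addrC.
  by congr (_ + _); exact: (esym (mulr1 h)).
by [].
Unshelve. all: by end_near. Qed.

Let derivable_ae (f : WSpace) :
  {ae mu, forall s, s \in `]- r%:num, 0[ -> derivable (f : R -> V) s 1}.
Proof.
have /wsegP [M fM] := valP f.
have aef := ae_filter_ringOfSetsType mu.
have : \forall s \ae mu, forall ij : 'I_1 * 'I_n, - r%:num < s < 0 ->
    derivable (fun x => (f : R -> V) x ij.1 ij.2) s 1.
  apply: filter_forall => -[i j]; apply: (@lipschitz_ae_derivable _ _ M) => s t.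
  apply: le_trans (fM s t) => /=.
  rewrite [leRHS]/Num.Def.normr/= mx_normrE.
  apply: le_trans (le_bigmax _ _ (i, j)).
  by rewrite !mxE.
apply: filterS => s fs /[!in_itv]/= sJ; apply/derivable_mxP => i j.
exact: fs (i, j) sJ.
Qed.

Let mseg_ae : {ae mu, forall s, J s -> s \in `]- r%:num, 0[}.
Proof.
exists [set - r%:num; 0]; split.
- exact: measurableU.
- by apply: countable_lebesgue_measure0; exact: finite_set_countable.
- move=> s /= /not_implyP[]; rewrite !in_itv/= => /andP[rs s0] /negP.
  rewrite negb_and -!leNgt => /orP[sr|s0']; [left|right]; apply/eqP;
  by rewrite eq_le ?rs ?sr ?s0 ?s0'.
Qed.

Let linfnormE f : linfnorm f =
  ess_sup mu ((fun s => `|deriv_in J f s|%:E) \_ J).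
Proof.
have mT : (0 < mu [set: R])%E.
  by rewrite -set_itvNyy lebesgue_measure_itv/= ltry.
rewrite /linfnorm unlock ifT; last exact: mT.
congr (ess_sup _ _); apply/funext => s /=; rewrite gee0_abs// /patch.
by case: ifP => // _; rewrite lee_fin.
Qed.

Let linfnorm_le (f : WSpace) (M : R) : 0 <= M ->
  {ae mu, forall s, s \in `]- r%:num, 0[ -> `|'D_1 (f : R -> V) s| <= M} ->
  (linfnorm f <= M%:E)%E.
Proof.
move=> M0 fM; have aef := ae_filter_ringOfSetsType mu.
rewrite linfnormE; apply/ess_supP; apply: filterS2 mseg_ae fM => s sJ fM.
rewrite /patch; case: ifPn => [/[!inE] /sJ {}sJ|_]; last by rewrite lee_fin.
by rewrite lee_fin derivWE//; exact: fM.
Qed.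

Let linfnorm_fin f : linfnorm f = (fine (linfnorm f))%:E.
Proof.
have aef := ae_filter_ringOfSetsType mu.
have /wsegP [M fM] := valP f; have /linfnorm_le le : 0 <= `|M| by [].
rewrite fineK// ge0_fin_numE ?Lnorm_ge0// (le_lt_trans (le f _)) ?ltry//.
apply: filterS (derivable_ae f) => s df /df{}df.
apply: (cvgr_to_le (cvg_norm df)).
near=> h; rewrite normrZ normfV ler_pdivrMl; last first.
  by rewrite normr_gt0; near: h; exact: nbhs_dnbhs_neq.
have -> : ((f : R -> V) \o shift s) (h *: 1) = f (h + s).
  by rewrite /= /shift; congr (f (_ + _)); exact: mulr1.
rewrite (le_trans (fM _ _))// addrK mulrC ler_wpM2l//; exact: ler_norm.
Unshelve. all: by end_near. Qed.

Let linfnorm_ge (f : WSpace) :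
  {ae mu, forall s, s \in `]- r%:num, 0[ ->
    `|'D_1 (f : R -> V) s| <= fine (linfnorm f)}.
Proof.
have aef := ae_filter_ringOfSetsType mu.
have := ess_sup_ge mu ((fun s => `|deriv_in J f s|%:E) \_ J).
rewrite -linfnormE linfnorm_fin; apply: filterS => s + sJ.
rewrite patchT ?lee_fin ?derivWE// inE; exact: subset_itv_oo_cc.
Qed.

Let wnorm_ub1 f : `|wfun f| <= wnorm f.
Proof. by rewrite /wnorm le_max lexx. Qed.

Let wnorm_ub2 f : fine (linfnorm f) <= wnorm f.
Proof. by rewrite /wnorm le_max lexx orbT. Qed.

Let wnormD f g : wnorm (f + g) <= wnorm f + wnorm g.
Proof.
have aef := ae_filter_ringOfSetsType mu.
rewrite {1}/wnorm ge_max; apply/andP; split.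
  by rewrite (le_trans (ler_normD _ _))// lerD.
rewrite -lee_fin -linfnorm_fin; apply: linfnorm_le.
  by rewrite addr_ge0// (le_trans _ (wnorm_ub1 _)).
apply: filterS2 (filterI (derivable_ae f) (derivable_ae g))
  (filterI (linfnorm_ge f) (linfnorm_ge g)) => s [df dg] [fs gs] sJ.
have -> : 'D_1 ((f + g : WSpace) : R -> V) s = 'D_1 (f : R -> V) s + 'D_1 (g : R -> V) s.
  by rewrite -deriveD//; [exact: df|exact: dg].
rewrite (le_trans (ler_normD _ _))// lerD//.
  exact: le_trans (fs sJ) _.
exact: le_trans (gs sJ) _.
Qed.

Let wnormZ (a : R) f : wnorm (a *: f) = `|a| * wnorm f.
Proof.
have aef := ae_filter_ringOfSetsType mu.
have le b g : wnorm (b *: g) <= `|b| * wnorm g.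
  rewrite {1}/wnorm ge_max; apply/andP; split.
    have -> : wfun (b *: g) = b *: wfun g by [].
    by rewrite normrZ ler_wpM2l.
  rewrite -lee_fin -linfnorm_fin; apply: linfnorm_le.
    by rewrite mulr_ge0// (le_trans _ (wnorm_ub1 _)).
  apply: filterS2 (derivable_ae g) (linfnorm_ge g) => s dg gs sJ.
  have -> : 'D_1 ((b *: g : WSpace) : R -> V) s = b *: 'D_1 (g : R -> V) s.
    by rewrite -deriveZ//; exact: dg.
  by rewrite normrZ ler_wpM2l// (le_trans (gs sJ)).
apply/eqP; rewrite eq_le le/=; have [->|a0] := eqVneq a 0.
  by rewrite normr0 mul0r (le_trans _ (wnorm_ub1 _)).
rewrite -ler_pdivlMl ?normr_gt0// -normfV.
by rewrite -[X in wnorm X <= _](scalerK a0) le.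
Qed.

Let wnorm0_eq0 f : wnorm f = 0 -> f = 0.
Proof.
move=> f0; apply/val_inj => /=; apply/eqP.
by rewrite -normr_le0 -f0 wnorm_ub1.
Qed.

HB.instance Definition _ := Lmodule_isNormed.Build R WSpace
  wnormD wnormZ wnorm0_eq0.

End WSpace.

Section segments.
Context {R : realType} (r : {posnum R}) (n : nat).
Local Notation V := 'rV[R]_n.

(* y_t(s) = y(t + s) for s in [-r,0], as an element of C([-r,0], R^n), resp. of
   W^{1,oo}([-r,0], R^n); the junk value is 0 if y is not continuous, resp. not
   Lipschitz, on [t-r,t]. *)
Definition segC (y : R -> V) (t : R) : CSpace r n :=
  insubd (0 : CSpace r n) (fun s => y (t + clamp r s)).

Definition segW (y : R -> V) (t : R) : WSpace r n :=
  insubd (0 : WSpace r n) (segC y t).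

End segments.

Definition is_flow {R : realType} {Om : metricType R} (sigma : R -> Om -> Om) :
    Prop :=
  [/\ continuous (fun p : R * Om => sigma p.1 p.2),
      forall w, sigma 0 w = w &
      forall s t w, sigma (s + t) w = sigma s (sigma t w)].

Section DDE.
Context {R : realType} {Om : metricType R} {r : {posnum R}} {n : nat}.
Local Notation V := 'rV[R]_n.
Local Notation C := (CSpace r n).
Local Notation W := (WSpace r n).
Variables (sigma : R -> Om -> Om) (F : Om -> V -> V -> V) (tau : Om -> C -> R).

(* 'd is the Frechet derivative, a continuous linear map where it exists. *)
Definition D2F (om : Om) (a b : V) : V -> V := 'd (fun u : V => F om u b) a.

Definition D3F (om : Om) (a b : V) : V -> V := 'd (fun u : V => F om a u) b.

Definition D2tau (om : Om) (x : C) : C -> R := 'd (tau om) x.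

Definition H1 : Prop :=
  [/\ continuous (fun p : Om * V * V => F p.1.1 p.1.2 p.2),
      forall om a b, differentiable (fun u : V => F om u b) a,
      forall om a b, differentiable (fun u : V => F om a u) b,
      opnorm_continuous (fun p : Om * V * V => D2F p.1.1 p.1.2 p.2) &
      opnorm_continuous (fun p : Om * V * V => D3F p.1.1 p.1.2 p.2)].

Definition H2star1 : Prop :=
  [/\ continuous (fun p : Om * C => tau p.1 p.2),
      forall om x, differentiable (tau om) x &
      opnorm_continuous (fun p : Om * C => D2tau p.1 p.2)].

Definition H2star2 : Prop :=
  forall B : set C, bounded_set B -> closed B ->
    exists2 L1 : R, 0 < L1 & forall om x1 x2, B x1 -> B x2 ->
      `|tau om x1 - tau om x2| <= L1 * `|x1 - x2|.

Definition H2star3 : Prop :=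
  forall B : set C, bounded_set B -> closed B ->
    exists2 L2 : R, 0 < L2 & forall om x1 x2, B x1 -> B x2 ->
      opnorm (D2tau om x1 \- D2tau om x2) <= L2 * `|x1 - x2|.

Definition H2star : Prop := [/\ H2star1, H2star2 & H2star3].

(* y solves the equation along the orbit of om on [-r,T), with y = x on [-r,0];
   at t = 0 the derivative is the right one. *)
Definition is_solution (om : Om) (x : W) (T : \bar R) (y : R -> V) : Prop :=
  [/\ (0 < T)%E,
      {within [set t | - r%:num <= t /\ (t%:E < T)%E], continuous y},
      forall s, - r%:num <= s <= 0 -> y s = x s &
      forall t, 0 <= t -> (t%:E < T)%E ->
        is_deriv_in [set s | 0 <= s /\ (s%:E < T)%E] y t
          (F (sigma t om) (y t) (y (t - tau (sigma t om) (segC r y t))))].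

Definition is_maximal_solution (om : Om) (x : W) (T : \bar R) (y : R -> V) :
    Prop :=
  is_solution om x T y /\
  forall T' y', (T <= T')%E -> is_solution om x T' y' ->
    (forall t, - r%:num <= t -> (t%:E < T)%E -> y' t = y t) -> T' = T.

(* Under H1 and H2star a maximal solution exists, and its interval of definition
   [-r,T) and its values there are unique; the values outside are arbitrary. *)
Definition maxsol (om : Om) (x : W) : \bar R * (R -> V) :=
  xget (0%E, cst 0) [set Ty | is_maximal_solution om x Ty.1 Ty.2].

Definition lifetime om x : \bar R := (maxsol om x).1.

Definition solution (t : R) om x : V := (maxsol om x).2 t.

Definition solution_seg (t : R) om x : W := segW r (fun s => solution s om x) t.

Definition skew_product (t : R) (p : Om * W) : Om * W :=
  (sigma t p.1, solution_seg t p.1 p.2).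

Definition positively_invariant (M : set (Om * W)) : Prop :=
  forall p, M p ->
    lifetime p.1 p.2 = +oo%E /\ forall t, 0 <= t -> M (skew_product t p).

Definition projects_over_base (M : set (Om * W)) : Prop :=
  forall om, exists x, M (om, x).

Definition admits_backward_extension (M : set (Om * W)) (p : Om * W) : Prop :=
  exists theta : R -> Om * W,
    [/\ {within [set s | s <= 0], continuous theta},
        forall s, s <= 0 -> M (theta s),
        theta 0 = p &
        forall t s, s <= - t -> - t <= 0 ->
          skew_product t (theta s) = theta (t + s)].

Definition linearization (p : Om * W) (phi : C) : V :=
  let: (om, x) := p in
  let d := tau om x in
  D2F om (x 0) (x (- d)) (phi 0) + D3F om (x 0) (x (- d)) (phi (- d))
  - D2tau om x phi *:
      D3F om (x 0) (x (- d)) (deriv_in `[- r%:num, 0]%classic x (- d)).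

Definition is_linear_solution (p : Om * W) (v : C) (z : R -> V) : Prop :=
  [/\ {within [set t | - r%:num <= t], continuous z},
      forall s, - r%:num <= s <= 0 -> z s = v s &
      forall t, 0 <= t ->
        is_deriv_in [set s | 0 <= s] z t
          (linearization (skew_product t p) (segC r z t))].

(* A solution exists and is unique on [-r,oo) if p lies in a positively invariant
   set whose elements admit backward extensions; before -r it is arbitrary. *)
Definition linear_solution (t : R) (p : Om * W) (v : C) : V :=
  xget (cst 0) [set z | is_linear_solution p v z] t.

Definition linear_seg (t : R) (p : Om * W) (v : W) : W :=
  segW r (fun s => linear_solution s p v) t.

Definition upper_lyapunov_exponent (K : set (Om * W)) : \bar R :=
  ereal_sup [set ereal_sup
    [set limf_esup (fun t : R => (t^-1)%:E * lne (`|linear_seg t p v|)%:E)%E +oo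
    | v in [set v : W | v != 0]] | p in K].

Definition stable_C (K : set (Om * W)) (b : R) : Prop :=
  exists k1 d1 : R, [/\ 1 <= k1, 0 < d1 &
    forall om (xb x : W), K (om, xb) -> `|wfun x - wfun xb| <= d1 ->
      [/\ lifetime om x = +oo%E,
          forall t, - r%:num <= t ->
            `|solution t om x - solution t om xb| <=
              k1 * expR (- b * t) * `|wfun x - wfun xb| &
          forall t, 0 <= t ->
            `|wfun (solution_seg t om x) - wfun (solution_seg t om xb)| <=
              k1 * expR (b * r%:num) * expR (- b * t) * `|wfun x - wfun xb|]].

Definition stable_W (K : set (Om * W)) (b : R) : Prop :=
  exists k2 d2 : R, [/\ 1 <= k2, 0 < d2 &
    forall om (xb x : W), K (om, xb) -> `|x - xb| < d2 ->
      lifetime om x = +oo%E /\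
      forall t, 0 <= t ->
        `|solution_seg t om x - solution_seg t om xb| <=
          k2 * expR (- b * t) * `|x - xb|].

End DDE.

(* Main.v *)
Require Import Defs.
From HB Require Import structures.
From mathcomp Require Import all_boot all_order all_algebra.
From mathcomp Require Import all_classical all_reals all_analysis.
From mathcomp Require Import measurable_realfun ess_sup_inf ring lra.

Set Implicit Arguments.
Unset Strict Implicit.
Unset Printing Implicit Defensive.

Import Order.TTheory GRing.Theory Num.Theory.
Import numFieldNormedType.Exports.

Local Open Scope classical_set_scope.
Local Open Scope ring_scope.

(* If lambda_K < 0, every solution of the linearized equation decays at some rate
   b' < -lambda_K; compactness of K times a ball of Lipschitz functions makes the
   time needed for a fixed decay uniform, and iterating it gives a uniform bound
   k e^{-b' t} |v|_C.  The variation of F(., x(0), x(-tau)) along K differs from its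
   linearization by o(m) only for increments of size m that are Lipschitz with
   constant O(m), because of the delay term; a difference of two solutions
   satisfies this after time r.  Hence over a long enough time T the difference
   contracts by e^{-bT} for b < b', which gives (2), and its derivative is bounded
   by its size on a window of length r, which gives (3).  Conversely, the solution
   through xb + eps v, minus the orbit of xb, divided by eps, converges to the
   linear solution, which therefore inherits the exponential bound from (2) or (3),
   so that lambda_K <= -b/2. *)

(** * Calculus with right derivatives *)

(** The obstacle is that the vector field is in general not locally Lipschitz on C: [x(-tau x)]
    varies with the delay at the speed of [x]. It is Lipschitz only when one of the two compared
    arguments is a Lipschitz function, so every nonlinear Gronwall estimate compares an arbitrary
    path with a Lipschitz one, such as an orbit in K. Backward extensions enter through one fact:
    each point of K is the time-[r] image of another point of K. Its segment is thus a piece of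
    orbit over [[0, r]], where the equation holds, and its derivative is the vector field along that
    orbit. This yields a common Lipschitz constant, uniform differentiability, and linearized
    coefficients that depend continuously on the earlier point. Continuity along orbits is measured
    in Omega x C, because translation of segments is in general not continuous in the Lipschitz
    norm. Global existence near K needs no continuation argument: the equation with truncated
    argument has global solutions, and the decay estimate keeps them where the truncation is
    inactive. The rate [-b/2] in the converse comes from absorbing the constant [k] into half of the
    exponent. *)

Section right_derivative.
Context {R : realType}.

Lemma near0rP (P : set R) :
  (\forall h \near 0^'+, P h) <-> exists2 d : R, 0 < d & forall h, 0 < h < d -> P h.
Proof.
split.
  move=> /nbhs_ballP[d /= d0 dP]; exists d => // h /andP[h0 hd].
  by apply: dP => //=; rewrite /ball /= sub0r normrN gtr0_norm.
move=> [d d0 dP]; apply/nbhs_ballP; exists d => //= h.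
by rewrite /ball /= sub0r normrN => hd h0; apply: dP; rewrite h0 (le_lt_trans (ler_norm _)).
Qed.

(** Supremum argument: if the set of times up to which [P] holds had supremum [c < b], the
    left-limit clause would put [c] in it and the right clause would pass beyond it. It replaces
    arguments by a first time of failure; a property with memory is handled by letting [P t] speak
    of all earlier times. *)
Lemma real_ind (P : R -> Prop) (a b : R) : a <= b -> P a ->
  (forall t, a <= t < b -> P t -> \forall h \near 0^'+, P (t + h)) ->
  (forall t, a < t <= b -> (forall s, a <= s < t -> P s) -> P t) ->
  forall t, a <= t <= b -> P t.
Proof.
move=> ab Pa Pr Pl.
pose S := [set t | a <= t <= b /\ forall s, a <= s <= t -> P s].
have Sa : S a.
  by split; [rewrite lexx|move=> s; rewrite -eq_le => /eqP <-].
have hS : has_sup S by split; [exists a|exists b => t [/andP[]]].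
have Sc s : a <= s < sup S -> P s.
  move=> /andP[as_ sc].
  have [e [_ eP] se] := sup_adherent (eqbRL (subr_gt0 _ _) sc) hS.
  by apply: eP; rewrite as_ ltW// (le_lt_trans _ se)// opprB addrC subrK.
have ac : a <= sup S by exact: ub_le_sup hS.2 _ Sa.
have cb : sup S <= b by apply: ge_sup; [exact: hS.1|move=> t [/andP[]]].
have Pc : P (sup S).
  have [<-//|ac'] := eqVneq a (sup S).
  by apply: Pl; [rewrite lt_neqAle ac' ac cb|exact: Sc].
have Pcs s : a <= s <= sup S -> P s.
  by move=> /andP[as_]; rewrite le_eqVlt => /orP[/eqP->//|sc]; apply: Sc; rewrite as_.
move: cb; rewrite le_eqVlt => /orP[/eqP cb t|cb]; first by rewrite -{1}cb => /Pcs.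
exfalso.
have /near0rP[d d0 dP] : \forall h \near 0^'+, P (sup S + h).
  by apply: Pr => //; rewrite ac cb.
pose e := Num.min (d / 2) (b - sup S).
have e0 : 0 < e by rewrite lt_min divr_gt0//= subr_gt0.
have ed : e < d by rewrite gt_min ltr_pdivrMr// ltr_pMr// ltr1n.
have eb : sup S + e <= b by rewrite -lerBrDl ge_min lexx orbT.
have : sup S + e <= sup S.
  apply: ub_le_sup; first exact: hS.2.
  split; first by rewrite eb andbT (le_trans ac)// lerDl ltW.
  move=> s /andP[as_ se]; have [sc|cs] := leP s (sup S).
    by apply: Pcs; rewrite as_ sc.
  have -> : s = sup S + (s - sup S) by rewrite addrC subrK.
  by apply: dP; rewrite subr_gt0 cs (le_lt_trans _ ed)// lerBlDl.
by rewrite gerDl leNgt e0.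
Qed.

Lemma le_left_limit (phi psi : R -> R) (a t : R) :
  continuous phi -> continuous psi -> a < t ->
  (forall s, a <= s < t -> phi s <= psi s) -> phi t <= psi t.
Proof.
move=> cphi cpsi at_ H.
apply: (@ler_cvg_to _ (t^'-) _ _ phi psi).
- by apply: cvg_at_left_filter; exact: cphi.
- by apply: cvg_at_left_filter; exact: cpsi.
- near=> s; apply: H; apply/andP; split; first by apply: ltW; near: s; exact: nbhs_left_gt.
  by near: s; exact: nbhs_left_lt.
Unshelve. all: by end_near. Qed.

(** A right slope at most [e] for every [e > 0] allows a growth of at most [e * (b - a)], by real
    induction, and [e] tends to 0. This one-sided form is needed because norms of paths are not
    differentiable. *)
Lemma dini_le (phi : R -> R) (a b : R) : continuous phi -> a <= b ->
  (forall t, a <= t < b -> forall e, 0 < e ->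
     \forall h \near 0^'+, phi (t + h) <= phi t + e * h) ->
  phi b <= phi a.
Proof.
move=> cphi ab H.
suff K e : 0 < e -> phi b <= phi a + e * (b - a).
  apply/ler_addgt0Pr => e e0; have ba : 0 < b - a + 1 by rewrite ltr_wpDl// subr_ge0.
  apply: (le_trans (K (e / (b - a + 1)) _)); first by rewrite divr_gt0.
  rewrite lerD2l mulrAC ler_pdivrMr//; apply: ler_wpM2l; first exact: ltW.
  by rewrite lerDl.
move=> e0; apply: (@real_ind (fun t => phi t <= phi a + e * (t - a)) a b) => //.
- by rewrite subrr mulr0 addr0.
- move=> t tab Pt; apply: filterS (H t tab e e0) => h /le_trans; apply.
  by have := Pt; lra.
- move=> t /andP[at_ tb] Ps; apply: (@le_left_limit phi (fun t => phi a + e * (t - a)) a) => //.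
  move=> x; apply: cvgD; first exact: cvg_cst.
  by apply: cvgM; [exact: cvg_cst|apply: cvgB; [exact: cvg_id|exact: cvg_cst]].
- by rewrite ab lexx.
Qed.

End right_derivative.

Section rder.
Context {R : realType} {V : normedModType R}.
Implicit Types (f g : R -> V) (t a : R).

(** Right derivative in little-o form. Only the right side is asked for, which covers the initial
    time, and without a quotient sums and comparisons reduce to triangle inequalities. *)
Definition rder f t (d : V) := forall e : R, 0 < e ->
  \forall h \near 0^'+, `|f (t + h) - f t - h *: d| <= e * h.

Lemma rder_quotient f t d :
  h^-1 *: (f (t + h) - f t) @[h --> 0^'+] --> d -> rder f t d.
Proof.
move=> /cvgrPdist_le fd e e0; have := fd _ e0.
apply: filter_app; near=> h => H.
have h0 : 0 < h by near: h; exact: nbhs_right_gt.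
have -> : f (t + h) - f t - h *: d = h *: (h^-1 *: (f (t + h) - f t) - d).
  by rewrite scalerBr scalerA mulfV ?scale1r// gt_eqF.
by rewrite normrZ (gtr0_norm h0) mulrC ler_wpM2r ?(ltW h0)// distrC.
Unshelve. all: by end_near. Qed.

Lemma rder_deriv_in (A : set R) f t d :
  (\forall h \near 0^'+, A (t + h)) -> is_deriv_in A f t d -> rder f t d.
Proof.
move=> At fd; apply: rder_quotient; apply: cvg_trans fd; apply: cvg_app.
move=> P [e /= e0 Pe]; move/near0rP : At => [d0 d00 dA].
apply/near0rP; exists (Num.min e d0) => /=; first by rewrite lt_min e0 d00.
move=> h; rewrite lt_min => /andP[h0 /andP[he hd]].
apply: Pe => //=; first by rewrite sub0r normrN gtr0_norm.
  by rewrite gt_eqF.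
by apply: dA; rewrite h0.
Qed.

Lemma rder_is_derive f t d : is_derive t 1 f d -> rder f t d.
Proof.
move=> [/= /cvg_ex[l fl] fd]; apply: rder_quotient.
have <- : l = d by rewrite -fd; apply/esym/cvg_lim => //; exact: norm_hausdorff.
have -> : (fun h : R => h^-1 *: (f (t + h) - f t)) =
   (fun h : R => h^-1 *: ((f \o shift t) (h *: 1) - f t)).
  apply/funext => h; congr (_ *: (f _ - _)); rewrite addrC.
  by congr (_ + _); exact: (esym (mulr1 h)).
apply: cvg_trans fl; apply: cvg_app => P [e e0 Pe]; exists e => // h /= he h0.
by apply: Pe => //; rewrite gt_eqF.
Qed.

Lemma rder_shift f a t d : rder (fun s => f (a + s)) t d <-> rder f (a + t) d.
Proof.
by split=> H e e0; apply: filterS (H e e0) => h; rewrite addrA.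
Qed.

Lemma rderD f g t d d' : rder f t d -> rder g t d' -> rder (fun s => f s + g s) t (d + d').
Proof.
move=> Hf Hg e e0; have e2 : 0 < e / 2 by rewrite divr_gt0.
apply: filterS (filterI (Hf _ e2) (Hg _ e2)) => h [Hfh Hgh].
rewrite scalerDr (opprD (f t)) (addrACA (f (t + h))) (opprD (h *: d)).
rewrite (addrACA (f (t + h) - f t)).
by apply: (le_trans (ler_normD _ _)); rewrite [e in leRHS](splitr e) mulrDl lerD.
Qed.

Lemma rderN f t d : rder f t d -> rder (fun s => - f s) t (- d).
Proof.
move=> H e e0; apply: filterS (H e e0) => h.
by rewrite -[in X in X -> _]normrN scalerN !opprD.
Qed.

Lemma rderB f g t d d' : rder f t d -> rder g t d' -> rder (fun s => f s - g s) t (d - d').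
Proof. by move=> Hf Hg; apply: rderD => //; exact: rderN. Qed.

End rder.

Section mean_value.
Context {R : realType} {V : normedModType R}.

(** The function [|f t - f a| - g t] has upper right slope at most [|d| - e <= 0], so [dini_le]
    applies. *)
Lemma mean_value_ineq (f : R -> V) (g : R -> R) (a b : R) :
  continuous f -> continuous g -> a <= b ->
  (forall t, a <= t < b -> exists d e, [/\ rder f t d, rder g t e & `|d| <= e]) ->
  `|f b - f a| <= g b - g a.
Proof.
move=> cf cg ab H.
suff : `|f b - f a| - g b <= `|f a - f a| - g a.
  by rewrite subrr normr0; lra.
apply: (@dini_le _ (fun t => `|f t - f a| - g t)) => //.
  move=> x; apply: cvgB; last exact: cg.
  apply: (@continuous_comp _ _ _ (fun t => f t - f a) Num.norm); last exact: norm_continuous.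
  by apply: cvgB; [exact: cf|exact: cvg_cst].
move=> t tab e e0; have [d [k [fd gk dk]]] := H t tab.
have e2 : 0 < e / 2 by rewrite divr_gt0.
apply: filterS (filterI (nbhs_right_gt 0) (filterI (fd _ e2) (gk _ e2))).
move=> h [h0 [Hf Hg]].
have : `|f (t + h) - f a| <= `|f t - f a| + (`|d| * h + e / 2 * h).
  have -> : f (t + h) - f a = (f t - f a) + (h *: d + (f (t + h) - f t - h *: d)).
    by rewrite (addrC (h *: d)) subrK [RHS]addrC addrA subrK.
  apply: (le_trans (ler_normD _ _)); rewrite lerD2l.
  by apply: (le_trans (ler_normD _ _)); rewrite lerD// normrZ gtr0_norm// mulrC.
have : g (t + h) >= g t + h * k - e / 2 * h.
  by move: Hg; rewrite ler_norml => /andP[+ _]; rewrite /GRing.scale/=; lra.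
have : `|d| * h <= h * k by rewrite mulrC ler_wpM2l// ltW.
by lra.
Qed.

Lemma mean_value_const (f : R -> V) (N a b : R) : continuous f -> a <= b ->
  (forall t, a <= t < b -> exists2 d, rder f t d & `|d| <= N) ->
  `|f b - f a| <= N * (b - a).
Proof.
move=> cf ab H; rewrite mulrBr.
apply: (@mean_value_ineq f (fun t => N * t)) => //.
  by move=> x; apply: cvgM; [exact: cvg_cst|exact: cvg_id].
move=> t /H[d fd dN]; exists d, N; split => // e e0.
apply: filterS (nbhs_right_gt 0) => h h0.
have -> : N * (t + h) - N * t - h *: (N : R^o) = 0 by rewrite /GRing.scale/=; ring.
by rewrite normr0 mulr_ge0// ltW.
Qed.

(* Comparison of |h| with the exact solution (A + e) exp(c (t - a)) - e of
   B' = c (B + e). *)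
Lemma delay_gronwall (h : R -> V) (r a b A c e : R) :
  0 <= r -> continuous h -> 0 <= A -> 0 <= e -> 1 <= c ->
  (forall s, a - r <= s <= a -> `|h s| <= A) ->
  (forall t, a <= t < b -> exists2 d, rder h t d &
     forall m, (forall s, t - r <= s <= t -> `|h s| <= m) -> `|d| <= c * m + e) ->
  forall t, a <= t <= b -> `|h t| <= (A + e) * expR (c * (t - a)).
Proof.
move=> r0 ch A0 e0 c1 hA hd t /andP[at_ tb].
have c0 : 0 < c by exact: lt_le_trans c1.
apply/ler_addgt0Pr => z z0.
(* The initial bound is raised by [eta] so that [h] starts strictly below [B]; this size makes the
   excess exactly [z] at the target time [t]. *)
pose eta := z / expR (c * (t - a)).
have eta0 : 0 < eta by rewrite divr_gt0// expR_gt0.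
pose B s := (A + eta + e) * expR (c * (s - a)) - e.
have K0 : 0 < A + eta + e by rewrite ltr_wpDr// ltr_wpDl.
have Bd (s : R) : is_derive s (1 : R) (B : R -> R) (c * (B s + e)).
    have -> : B = ((A + eta + e) *: (expR \o (c *: (id - cst a)))) - cst e by [].
  by apply: is_derive_eq; rewrite !fctE /GRing.scale/=; ring.
have cB : continuous B.
  move=> s; apply: differentiable_continuous; apply/derivable1_diffP.
  exact: ex_derive.
have BM s1 s2 : s1 <= s2 -> B s1 <= B s2.
  by move=> s12; rewrite lerD2r ler_wpM2l ?(ltW K0)// ler_expR ler_wpM2l ?(ltW c0)// lerD2r.
have Ba : B a = A + eta by rewrite /B subrr mulr0 expR0 mulr1 addrK.
have -> : (A + e) * expR (c * (t - a)) + z = B t + e.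
  by rewrite /B subrK (addrAC A) [RHS]mulrDl; congr (_ + _); rewrite /eta divfK// gt_eqF// expR_gt0.
(* The bound is carried on all of [[a, u]], since the derivative at a time sees the whole window
   before it. *)
suff /(_ t) : forall u, a <= u <= b -> forall s, a <= s <= u -> `|h s| <= B s.
  move=> /(_ _ t); rewrite at_ tb lexx => /(_ isT isT) /le_trans; apply.
  by rewrite lerDl.
apply: real_ind; first exact: le_trans tb.
- move=> s; rewrite -eq_le => /eqP <-; rewrite Ba.
  by rewrite (le_trans (hA a _))// ?lexx ?andbT ?gerBl// lerDl ltW.
- move=> u /andP[au ub] Pu.
  have hm s v : a <= v -> s <= v -> v <= u -> a - r <= s -> `|h s| <= B v.
    move=> av sv vu ars; have [sa|as_] := ltP s a; last first.
      by apply: (le_trans (Pu s _)); [rewrite as_ (le_trans sv)|exact: BM].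
    rewrite (le_trans (hA s _)) ?ars ?(ltW sa)//.
    by rewrite (le_trans _ (BM _ _ av))// Ba lerDl ltW.
  have hu : `|h u - h a| <= B u - B a.
    apply: mean_value_ineq => // s /andP[as_ su].
    have [|d hsd dle] := hd s; first by rewrite as_ (lt_trans su).
    exists d, (c * (B s + e)); split => //; first exact: rder_is_derive.
    rewrite mulrDr; apply: (le_trans (dle (B s) _)).
      move=> x /andP[sx xs]; apply: hm => //; first exact: ltW.
      by rewrite (le_trans _ sx)// lerD2r.
    (* Here [1 <= c] turns [c * B + e] into [c * (B + e)], the derivative of [B]. *)
    by rewrite lerD2l ler_peMl.
  (* Strict because [h] starts at most at [A] while [B a = A + eta]; continuity then extends the
     inequality to the right. *)
  have : `|h u| < B u.
    have := ler_normD (h u - h a) (h a); rewrite subrK.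
    have := hA a; rewrite lexx gerBl r0 => /(_ isT).
    by rewrite Ba in hu; lra.
  move=> huB.
  have cBh : continuous (fun s => B s - `|h s|).
    move=> s; apply: cvgB; first exact: cB.
    by apply: (@continuous_comp _ _ _ h Num.norm); [exact: ch|exact: norm_continuous].
  have /(cvgr_gt (B u - `|h u|)) /(_ 0) := cBh u.
  rewrite subr_gt0 => /(_ huB) /nbhs_ballP[d /= d0 dP].
  apply/near0rP; exists d => // k /andP[k0 kd] s /andP[as_ sk].
  have [su|us] := leP s u; first by apply: Pu; rewrite as_ su.
  rewrite -subr_ge0 ltW//; apply: dP; rewrite /ball/= distrC gtr0_norm ?subr_gt0//.
  by rewrite (le_lt_trans _ kd)// lerBlDl.
- move=> u /andP[au ub] Pu s /andP[as_ su].
  have [->|sneu] := eqVneq s u; last first.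
    by apply: (Pu s) => //; rewrite as_ ?lexx//= lt_neqAle sneu.
  apply: (@le_left_limit R (fun x => `|h x|) B a) => //.
    by move=> x; apply: (@continuous_comp _ _ _ h Num.norm); [exact: ch|exact: norm_continuous].
  by move=> x xau; apply: (Pu x) => //; case/andP: xau => -> _; rewrite lexx.
Qed.

End mean_value.

Section deriv_in_theory.
Context {R : realType} {V : normedModType R}.
Implicit Types (A B : set R) (f : R -> V).

Lemma is_deriv_inP A f s d :
  is_deriv_in A f s d <-> forall e, 0 < e -> exists2 k, 0 < k &
    forall h, `|h| < k -> A (s + h) -> `|f (s + h) - f s - h *: d| <= e * `|h|.
Proof.
have E h : h != 0 ->
    `|d - h^-1 *: (f (s + h) - f s)| = `|h|^-1 * `|f (s + h) - f s - h *: d|.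
  move=> h0; by rewrite distrC -normfV -normrZ [in RHS]scalerBr scalerA mulVf// scale1r.
split.
  move=> /cvgrPdist_le fd e e0; have [k /= k0 kP] := fd _ e0.
  exists k => // h hk Ash; have [->|h0] := eqVneq h 0.
    by rewrite addr0 subrr scale0r subrr !normr0 mulr0.
  have := kP h; rewrite /= sub0r normrN => /(_ hk h0 Ash).
  by rewrite E// ler_pdivrMl ?normr_gt0// mulrC.
move=> H; apply/cvgrPdist_le => e e0; have [k k0 kP] := H _ e0.
exists k => //= h; rewrite /= sub0r normrN => hk h0 Ash.
by rewrite E// ler_pdivrMl ?normr_gt0// mulrC kP.
Qed.

Lemma is_deriv_in_sub A B f s d : B `<=` A -> is_deriv_in A f s d -> is_deriv_in B f s d.
Proof.
move=> BA /is_deriv_inP H; apply/is_deriv_inP => e e0; have [k k0 kP] := H _ e0.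
by exists k => // h hk /BA; exact: kP.
Qed.

Lemma is_deriv_in_eq A f g s d : (forall t, A t -> f t = g t) -> A s ->
  is_deriv_in A f s d -> is_deriv_in A g s d.
Proof.
move=> fg As /is_deriv_inP H; apply/is_deriv_inP => e e0; have [k k0 kP] := H _ e0.
by exists k => // h hk Ah; rewrite -!fg//; exact: kP.
Qed.

Lemma is_deriv_in_shift A f a s d :
  is_deriv_in A f (a + s) d -> is_deriv_in [set t | A (a + t)] (fun t => f (a + t)) s d.
Proof.
move=> /is_deriv_inP H; apply/is_deriv_inP => e e0; have [k k0 kP] := H _ e0.
by exists k => // h hk /= Ah; rewrite addrA; apply: kP; rewrite // -addrA.
Qed.

Lemma is_deriv_in_derive A f s : derivable f s 1 -> is_deriv_in A f s ('D_1 f s).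
Proof.
move=> df; apply: cvg_within_filter.
have -> : (fun h : R => h^-1 *: (f (s + h) - f s)) =
   (fun h : R => h^-1 *: ((f \o shift s) (h *: 1) - f s)).
  apply/funext => h; congr (_ *: (f _ - _)); rewrite addrC.
  by congr (_ + _); exact: (esym (mulr1 h)).
exact: df.
Qed.

Lemma deriv_inE A f s d : ProperFilter (within [set h | A (s + h)] 0^') ->
  is_deriv_in A f s d -> deriv_in A f s = d.
Proof. by move=> PF fd; apply: (cvg_lim _ fd) => //; exact: norm_hausdorff. Qed.

End deriv_in_theory.

(** * Antiderivatives and global Picard iteration *)

Section antiderivative.
Context {R : realType}.
Local Notation half := ([set s : R | 0 <= s]).

Lemma real_antiderivative (g : R -> R) : continuous g ->
  exists F : R -> R, forall t, 0 <= t -> derivable F t 1 /\ 'D_1 F t = g t.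
Proof.
move=> cg.
(* Integration starts at -1 so that 0 is an interior point and the fundamental theorem gives a
   two-sided derivative there. *)
pose F x : R := \int[@lebesgue_measure R]_(t in [set` Interval (BLeft (-1)) (BRight x)]) g t.
exists F => t t0.
have [||||] := @continuous_FTC1_closed R g (-1) t (t + 1).
- by rewrite ltrDl.
- apply: continuous_compact_integrable; first exact: segment_compact.
  exact: continuous_subspaceT.
- by rewrite (lt_le_trans _ t0)// oppr_lt0.
- exact: cg.
by move=> dF <-; rewrite derive1E.
Qed.

(** Coordinatewise antiderivative, frozen at its value in 0 for negative times, so that adding it to
    an initial function leaves the past unchanged; at 0 only the derivative relative to [half]
    survives the freezing. *)
Lemma antiderivative (n : nat) (g : R -> 'rV[R]_n) : continuous g ->
  exists G : R -> 'rV[R]_n, [/\ continuous G, forall t, t <= 0 -> G t = 0 &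
    forall t, 0 <= t -> is_deriv_in half G t (g t)].
Proof.
move=> cg.
have /choice[F HF] : forall j : 'I_n, exists Fj : R -> R, forall t, 0 <= t ->
    derivable Fj t 1 /\ 'D_1 Fj t = g t ord0 j.
  move=> j; apply: real_antiderivative => x.
  by apply: (@continuous_comp _ _ _ g (fun M => M ord0 j)); [exact: cg|exact: coord_continuous].
pose Fv t : 'rV[R]_n := \row_j F j t.
have dF t : 0 <= t -> derivable Fv t 1.
  move=> t0; apply/derivable_mxP => i j.
  rewrite (_ : (fun _ => _) = F j); first exact: (HF j t t0).1.
  by apply/funext => x; rewrite mxE.
have DF t : 0 <= t -> 'D_1 Fv t = g t.
  move=> t0; rewrite derive_mx; last exact: dF.
  apply/matrixP => i j; rewrite mxE (_ : (fun _ => _) = F j).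
    by rewrite (HF j t t0).2 (ord1 i).
  by apply/funext => x; rewrite mxE.
have cF t : 0 <= t -> {for t, continuous Fv}.
  by move=> t0; apply: differentiable_continuous; apply/derivable1_diffP; exact: dF.
exists (fun t : R => Fv (Num.max t 0) - Fv 0); split.
- move=> t; apply: cvgB; last exact: cvg_cst.
  apply: (@continuous_comp _ _ _ (fun t : R => Num.max t 0) Fv); last first.
    by apply: cF; rewrite le_max lexx orbT.
  by apply: (@continuous_max R R idfun (cst 0)); [exact: cvg_id|exact: cvg_cst].
- by move=> t t0; rewrite (max_idPr t0) subrr.
move=> t t0; apply: (@is_deriv_in_eq _ _ _ (fun t => Fv t - Fv 0)) => //.
  by move=> s /= s0; rewrite (max_idPl s0).
have dF' : derivable (fun t => Fv t - Fv 0) t 1.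
  by apply: derivableB; [exact: dF|exact: derivable_cst].
have <- : 'D_1 (fun t => Fv t - Fv 0) t = g t.
  rewrite deriveB; [|exact: dF|exact: derivable_cst].
  by rewrite DF// (derive_cst (Fv 0)) subr0.
exact: is_deriv_in_derive.
Qed.

End antiderivative.

Section geometric_cvg.
Context {R : realType} {n : nat}.
Local Notation V := 'rV[R]_n.

Lemma geometric_cvg (u : nat -> V) (C : R) :
  (forall k, `|u k.+1 - u k| <= C / 2 ^+ k) ->
  exists2 l : V, u k @[k --> \oo] --> l & forall k, `|l - u k| <= 2 * C / 2 ^+ k.
Proof.
move=> uC.
have C0 : 0 <= C by have := uC 0%N; rewrite expr0 divr1; exact: le_trans.
(* The factor [1 - 2^-j] is the partial geometric sum; carrying it lets the induction on [j]
   close. *)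
have uj k j : `|u (k + j)%N - u k| <= 2 * C / 2 ^+ k * (1 - (2 ^+ j)^-1).
  elim: j => [|j IH]; first by rewrite addn0 subrr normr0 expr0 invr1 subrr mulr0.
  rewrite addnS -(subrKA (u (k + j)%N)); apply: (le_trans (ler_normD _ _)).
  apply: (le_trans (lerD (uC _) IH)).
  rewrite exprD exprS !invfM.
  set a := (2 ^+ k)^-1; set b := (2 ^+ j)^-1.
  rewrite [leRHS](_ : _ = C * (a * b) + 2 * C * a * (1 - b)); [exact: lexx|by field].
have ujk k j : (k <= j)%N -> `|u j - u k| <= 2 * C / 2 ^+ k.
  move=> kj; have := uj k (j - k)%N; rewrite subnKC// => /le_trans; apply.
  rewrite -[leRHS]mulr1 ler_wpM2l ?divr_ge0 ?mulr_ge0 ?exprn_ge0//.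
have small e : 0 < e -> exists k, 2 * C / 2 ^+ k < e.
  move=> e0.
  have : (2 * C) * (2^-1) ^+ k @[k --> \oo] --> (2 * C) * 0.
    by apply: cvgM; [exact: cvg_cst|apply: cvg_expr; rewrite ger0_norm ?invr_ge0// invf_lt1// ltr1n].
  rewrite mulr0 => /cvgr_lt /(_ _ e0) [k0 _ kP]; exists k0.
  by have := kP k0 (leqnn k0); rewrite exprVn.
have cu : cvg (u k @[k --> \oo]).
  apply: cauchy_cvg; apply: cauchy_exP => e /small[k ke]; exists (u k).
  exists k => // j kj; rewrite /= -ball_normE /=; apply: (le_lt_trans _ ke).
  by rewrite distrC; exact: ujk.
exists (lim (u k @[k --> \oo])) => // k.
apply: (@cvgr_to_le nat \oo _ _ (fun j => `|u j - u k|)); last first.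
  by apply: filterS (nbhs_infty_ge k) => j; exact: ujk.
by apply: cvg_norm; apply: cvgB => //; exact: cvg_cst.
Qed.

End geometric_cvg.

Section picard.
Context {R : realType} (n : nat).
Local Notation V := 'rV[R]_n.
Local Notation half := ([set s : R | 0 <= s]).
Variables (r Lam D : R) (x : R -> V) (G : R -> (R -> V) -> V) (X : (R -> V) -> Prop).
Hypotheses (Lam1 : 1 <= Lam) (D0 : 0 <= D).
Hypothesis x_min : forall t, 0 <= t -> x t = x 0.
Hypothesis Xx : X x.
Hypothesis X_continuous : forall y, X y -> continuous y.
Hypothesis G_continuous : forall y, X y -> continuous (fun t : R => G (Num.max t 0) y).
Hypothesis X_step : forall (y Y : R -> V), X y -> continuous Y -> (forall t, t <= 0 -> Y t = x t) ->
  (forall t, 0 <= t -> is_deriv_in half Y t (G t y)) -> X Y.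
Hypothesis X_lim : forall (u : nat -> R -> V) (y : R -> V), (forall k, X (u k)) ->
  (forall t, u k t @[k --> \oo] --> y t) -> continuous y -> X y.
Hypothesis G_lip : forall y1 y2 t m, X y1 -> X y2 -> 0 <= t ->
  (forall s, t - r <= s <= t -> `|y1 s - y2 s| <= m) -> `|G t y1 - G t y2| <= Lam * m.
Hypothesis G_bound : forall t, 0 <= t -> `|G t x| <= D.

Let step (y Y : R -> V) := [/\ continuous Y, forall t, t <= 0 -> Y t = x t &
  forall t, 0 <= t -> is_deriv_in half Y t (G t y)].

Let ex_step y : X y -> exists Y, step y Y.
Proof.
move=> Xy; have [Y [cY Y0 dY]] := antiderivative (G_continuous Xy).
exists (fun t => x t + Y t); split.
- by move=> t; apply: cvgD; [exact: X_continuous|exact: cY].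
- by move=> t t0; rewrite Y0// addr0.
move=> t t0; apply: (@is_deriv_in_eq _ _ _ (fun t => x 0 + Y t)) => //.
  by move=> s /= s0; rewrite x_min.
have /is_deriv_inP H := dY t t0; apply/is_deriv_inP => e e0.
have [k k0 kP] := H _ e0; exists k => // h hk th; have := kP _ hk th.
by rewrite (max_idPl t0) opprD addrACA subrr add0r.
Qed.

Let step_rder y Y t : step y Y -> 0 <= t -> rder Y t (G t y).
Proof.
move=> [_ _ dY] t0; apply: (@rder_deriv_in _ _ half); last exact: dY.
by apply: filterS (nbhs_right_gt 0) => h h0 /=; rewrite addr_ge0// ltW.
Qed.

(** Exponential weight: with rate [2 * Lam], integrating [Lam * E] gives at most [E / 2], so the
    Picard step contracts by 1/2 on the whole half-line and local solutions need not be
    continued. *)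
Let E (t : R) := expR (2 * Lam * Num.max t 0).

Let E_ge1 t : 1 <= E t.
Proof. by rewrite /E -expR0 ler_expR mulr_ge0 ?le_max ?lexx ?orbT// mulr_ge0// (le_trans ler01). Qed.

Let E_mono s t : s <= t -> E s <= E t.
Proof.
move=> st; rewrite ler_expR ler_wpM2l ?mulr_ge0// ?(le_trans ler01)//.
by rewrite ge_max !le_max st lexx !orbT.
Qed.

Let step_contraction y1 y2 Y1 Y2 K : X y1 -> X y2 -> step y1 Y1 -> step y2 Y2 -> 0 <= K ->
  (forall t, `|y1 t - y2 t| <= K * E t) -> forall t, `|Y1 t - Y2 t| <= K / 2 * E t.
Proof.
move=> Xy1 Xy2 S1 S2 K0 H t.
have [c1 e1 _] := S1; have [c2 e2 _] := S2.
have KE s : 0 <= K / 2 * E s by rewrite !mulr_ge0// (le_trans ler01).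
have [t0|/ltW t0] := leP t 0; first by rewrite e1// e2// subrr normr0.
have : `|(Y1 t - Y2 t) - (Y1 0 - Y2 0)| <=
    K / 2 * expR (2 * Lam * t) - K / 2 * expR (2 * Lam * 0).
  apply: (@mean_value_ineq _ _ (fun t => Y1 t - Y2 t) (fun t => K / 2 * expR (2 * Lam * t))) => //.
  - by move=> s; apply: cvgB; [exact: c1|exact: c2].
  - move=> s; apply: cvgM; first exact: cvg_cst.
    apply: (@continuous_comp _ _ _ (fun s => 2 * Lam * s) expR); last exact: continuous_expR.
    by apply: cvgM; [exact: cvg_cst|exact: cvg_id].
  move=> s /andP[s0 _]; exists (G s y1 - G s y2), (Lam * (K * expR (2 * Lam * s))); split.
  - by apply: rderB; apply: step_rder.
  - apply: rder_is_derive.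
    rewrite (_ : (fun t => _) = (K / 2) *: (expR \o ((2 * Lam) *: id)))//.
    by apply: is_derive_eq; rewrite !fctE /GRing.scale/=; field.
  - apply: G_lip => // v /andP[_ vs]; apply: (le_trans (H v)).
    rewrite ler_wpM2l// -[s in leRHS](max_idPl s0); exact: E_mono.
rewrite (e1 0)// (e2 0)// subrr subr0 => /le_trans; apply.
by rewrite /E (max_idPl t0) gerBl mulr_ge0 ?divr_ge0 ?expR_ge0.
Qed.

(** [X] is a class stable under the step and under limits, on which [G] is Lipschitz: functions with
    a fixed Lipschitz constant for the nonlinear equation, all continuous functions for the
    linearized one. The iterates converge geometrically in the weight [E], and the limit is a fixed
    point because its image is approached by the same iterates. *)
Lemma picard : exists y, [/\ X y, forall t, t <= 0 -> y t = x t &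
  forall t, 0 <= t -> is_deriv_in half y t (G t y)].
Proof.
have /choice[P HP] : forall y, exists Y, X y -> step y Y.
  by move=> y; have [Xy|nXy] := pselect (X y); [have [Y] := ex_step Xy; exists Y|exists y].
pose u k := iter k P x.
have Xu k : X (u k).
  elim: k => [//|k IH]; have [? ? ?] := HP _ IH; exact: X_step IH _ _ _.
have su k : step (u k) (u k.+1) by exact: HP.
have ux k t : t <= 0 -> u k t = x t.
  by case: k => [//|k] t0; have [_ + _] := su k; apply.
have du k t : `|u k.+1 t - u k t| <= D / 2 ^+ k * E t.
  elim: k t => [t|k IH t]; last first.
    rewrite exprSr invfM mulrA; apply: step_contraction IH t; [exact: Xu|exact: Xu|exact: su|exact: su|].
    by rewrite divr_ge0// exprn_ge0.
  rewrite expr0 divr1.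
  have [t0|/ltW t0] := leP t 0.
    by rewrite !ux// subrr normr0 mulr_ge0// (le_trans ler01).
  have : `|u 1%N t - u 1%N 0| <= D * (t - 0).
    apply: mean_value_const => //; first by have [+ _ _] := su 0%N.
    move=> s /andP[s0 _]; exists (G s x); last exact: G_bound.
    exact: step_rder (su 0%N) s0.
  (* The first increment is at most [D * t], and [t <= 1 + 2 * Lam * t <= E t]. *)
  rewrite (ux 1%N 0)// -(x_min t0) subr0 => /le_trans; apply; apply: ler_wpM2l => //.
  rewrite /E (max_idPl t0) (le_trans _ (expR_ge1Dx _))//.
  by have := ler_wpM2r t0 Lam1; lra.
have /choice[y Hy] : forall t : R, exists l : V, u k t @[k --> \oo] --> l /\
    forall k, `|l - u k t| <= 2 * (D * E t) / 2 ^+ k.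
  move=> t; have [|l ul lu] := @geometric_cvg R n (fun k => u k t) (D * E t).
    by move=> k; rewrite mulrAC; exact: du.
  by exists l.
have yu k t : `|y t - u k t| <= 2 * D / 2 ^+ k * E t.
  by rewrite (le_trans ((Hy t).2 k))// mulrA mulrAC.
have small e : 0 < e -> exists k, 2 * D / 2 ^+ k < e.
  move=> e0.
  have : (2 * D) * (2^-1) ^+ k @[k --> \oo] --> (2 * D) * 0.
    by apply: cvgM; [exact: cvg_cst|apply: cvg_expr; rewrite ger0_norm ?invr_ge0// invf_lt1// ltr1n].
  rewrite mulr0 => /cvgr_lt /(_ _ e0) [k0 _ kP]; exists k0.
  by have := kP k0 (leqnn k0); rewrite exprVn.
have cy : continuous y.
  move=> t; apply/cvgrPdist_le => e e0.
  have e3 : 0 < e / 3 by rewrite divr_gt0.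
  have [k kP] := small (e / 3 / E (t + 1)) (divr_gt0 e3 (lt_le_trans ltr01 (E_ge1 _))).
  have yk s : s <= t + 1 -> `|y s - u k s| <= e / 3.
    move=> st; apply: (le_trans (yu k s)).
    apply: (@le_trans _ _ (2 * D / 2 ^+ k * E (t + 1))).
      by rewrite ler_wpM2l ?E_mono// divr_ge0 ?mulr_ge0 ?exprn_ge0.
    by rewrite -ler_pdivlMr ?ltW// (lt_le_trans ltr01).
  have cuk : continuous (u k) by exact: X_continuous.
  have /cvgrPdist_le /(_ _ e3) := cuk t.
  apply: filterS2 (cvgr_le (t : R) (@cvg_id _ _) (t + 1) _) => [s st uts|]; last first.
    by rewrite ltrDl.
  rewrite -(subrKA (u k t)) -(subrKA (u k s) (u k t) (- y s)).
  have := ler_normD (y t - u k t) ((u k t - u k s) + (u k s - y s)).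
  have := ler_normD (u k t - u k s) (u k s - y s).
  have := yk t; rewrite lerDl ler01 => /(_ isT); have := yk s st.
  by rewrite (distrC (y s)); lra.
have Xy : X y by apply: X_lim Xu _ cy => t; exact: (Hy t).1.
have [Y SY] := ex_step Xy.
have [cY Y0 dY] := SY.
suff yY : y = Y.
  exists y; split => // [|t t0]; first by rewrite yY.
  by have := dY t t0; rewrite -yY.
apply/funext => t; apply/eqP; rewrite -subr_eq0 -normr_le0; apply/ler_addgt0Pr => e e0.
rewrite add0r.
have [k kP] := small (e / 2 / E t) (divr_gt0 (divr_gt0 e0 (ltr0Sn _ 1)) (lt_le_trans ltr01 (E_ge1 _))).
have K0 : 0 <= 2 * D / 2 ^+ k by rewrite divr_ge0 ?mulr_ge0 ?exprn_ge0.
have := step_contraction Xy (Xu k) SY (su k) K0 (yu k) t.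
have := yu k.+1 t; rewrite -(subrKA (u k.+1 t)).
have -> : 2 * D / 2 ^+ k.+1 = 2 * D / 2 ^+ k / 2 by rewrite exprSr invfM mulrA.
have : 2 * D / 2 ^+ k * E t <= e / 2 by rewrite -ler_pdivlMr ?ltW// (lt_le_trans ltr01).
have := ler_normD (y t - u k.+1 t) (u k.+1 t - Y t); rewrite (distrC (u k.+1 t)).
have : 0 <= 2 * D / 2 ^+ k * E t by rewrite mulr_ge0// (le_trans ler01).
by lra.
Qed.

End picard.

(** * Segments and bounded linear maps *)

Section compactness.
Context {R : realType}.

Lemma compact_locally_bounded {T : topologicalType} (K : set T) (f : T -> R) :
  compact K -> (forall p, K p -> exists M, \forall q \near p, f q <= M) ->
  exists2 M, 0 <= M & forall p, K p -> f p <= M.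
Proof.
move=> /compact_near_coveringP cK H.
have : \forall M \near +oo, K `<=` [set p | f p <= M].
  apply: cK => p Kp; have [M pM] := H p Kp.
  exists ([set q | f q <= M], [set N | M <= N]) => /=.
    by split=> //; apply: nbhs_pinfty_ge; exact: num_real.
  by move=> [q N] /= [qM MN]; exact: le_trans MN.
move=> H'; have [M [M0 MP]] := pinfty_ex_gt0 H'.
by exists M => //; exact: ltW.
Qed.

(** Lebesgue number argument for a pseudo-distance that is continuous on the diagonal over [K]. Only
    [p] lies in [K]; [q] may leave it, as perturbations of points of a compact set do. *)
Lemma compact_uniform {T : pseudoMetricType R} (K : set T) (d : T -> T -> R) :
  compact K -> (forall p q s, d p s <= d p q + d q s) -> (forall p q, d p q = d q p) ->
  (forall p, K p -> d p q @[q --> p] --> 0) ->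
  forall e, 0 < e -> exists2 k, 0 < k & forall p q, K p -> ball p k q -> d p q <= e.
Proof.
move=> /compact_near_coveringP cK dtri dsym d0 e e0.
have : \forall k \near 0^'+, K `<=` [set p | forall q, ball p k q -> d p q <= e].
  apply: cK => p Kp; have e2 : 0 < e / 2 by rewrite divr_gt0.
  have /cvgr_le /(_ _ e2) /nbhs_ballP[/= m m0 mP] := d0 p Kp.
  have m2 : 0 < m / 2 by rewrite divr_gt0.
  exists (ball p (m / 2), [set k | k < m / 2]) => /=.
    split; first exact: nbhsx_ballx.
    by apply: nbhs_right_lt.
  move=> [q k] /= [pq km] s qs.
  have ps : ball p m s.
    rewrite (splitr m); apply: ball_triangle pq _.
    by apply: le_ball qs; exact: ltW.
  apply: (le_trans (dtri q p s)); rewrite (splitr e) lerD//; last exact: mP.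
  by rewrite dsym; apply: mP; apply: le_ball pq; rewrite ler_pdivrMr// ler_peMr ?ltW// ltr1n.
move=> /near0rP[k k0 kP]; exists (k / 2); first by rewrite divr_gt0.
move=> p q Kp; apply: kP => //.
by rewrite divr_gt0//= ltr_pdivrMr// ltr_pMr// ltr1n.
Qed.

End compactness.

Lemma ultra_cvg {T : Type} {U : topologicalType} (F : set_system T) (f : T -> U) (A : set U) :
  UltraFilter F -> compact A -> F (f @^-1` A) -> exists a, A a /\ f x @[x --> F] --> a.
Proof.
move=> UF cA FA; have PF : ProperFilter F by case: UF.
have [a [Aa aF]] := cA (f @ F) _ FA.
exists a; split=> // B Ba; have [//|FB] := in_ultra_setVsetC (f @^-1` B) UF.
by have [b []] := aF (~` B) B FB Ba.
Qed.

Section CSpace_theory.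
Context {R : realType} {r : {posnum R}} {n : nat}.
Local Notation V := 'rV[R]_n.
Local Notation C := (CSpace r n).
Local Notation W := (WSpace r n).
Implicit Types (f g : C) (y : R -> V).

Lemma CSpace_continuous f : continuous f.
Proof. by have /[!inE] -[] := valP f. Qed.

Lemma CSpace_clamp f s : f (clamp r s) = f s.
Proof. by have /[!inE] -[_ ->] := valP f. Qed.

Lemma CSpace_ext f g : (forall s, - r%:num <= s <= 0 -> f s = g s) -> f = g.
Proof.
move=> fg; apply/val_inj/funext => s /=.
rewrite -(CSpace_clamp f) -(CSpace_clamp g); apply: fg.
by have := clamp_in r s; rewrite in_itv.
Qed.

Lemma CSpace_normP f (M : R) :
  (`|f| <= M) <-> (forall s, - r%:num <= s <= 0 -> `|f s| <= M).
Proof.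
split=> [fM s _|fM]; first exact: le_trans (cnorm_ub f s) fM.
apply: (@cnorm_le _ _ _ f) => s.
rewrite -CSpace_clamp; apply: fM.
by have := clamp_in r s; rewrite in_itv.
Qed.

Lemma CSpace_le_norm f s : `|f s| <= `|f|.
Proof. exact: cnorm_ub. Qed.

Lemma segCE y t s : continuous y -> segC r y t s = y (t + clamp r s).
Proof.
move=> cy; rewrite /segC insubdK// inE; split.
  move=> x; apply: (@continuous_comp _ _ _ (fun s => t + clamp r s) y); last exact: cy.
  by apply: cvgD; [exact: cvg_cst|exact: clamp_continuous].
by move=> x; rewrite clamp_clamp.
Qed.

Lemma segC_val y t s : continuous y -> - r%:num <= s <= 0 -> segC r y t s = y (t + s).
Proof. by move=> cy sr; rewrite segCE// clamp_id// in_itv. Qed.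

Lemma segC_eq y1 y2 t : (forall s, t - r%:num <= s <= t -> y1 s = y2 s) ->
  segC r y1 t = segC r y2 t.
Proof.
move=> E; congr (insubd _ _); apply/funext => s; apply: E.
have := clamp_in r s; rewrite in_itv/= => /andP[rs s0].
by rewrite lerD2l rs gerDl s0.
Qed.

Lemma segC_shift y a t : segC r (fun s => y (a + s)) t = segC r y (a + t).
Proof. by congr (insubd _ _); apply/funext => s; rewrite addrA. Qed.

Lemma segC_le y1 y2 t m : continuous y1 -> continuous y2 ->
  (forall s, t - r%:num <= s <= t -> `|y1 s - y2 s| <= m) ->
  `|segC r y1 t - segC r y2 t| <= m.
Proof.
move=> c1 c2 H; apply/CSpace_normP => s sr.
change (`|segC r y1 t s - segC r y2 t s| <= m).
rewrite !segC_val//; apply: H; case/andP: sr => rs s0.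
by rewrite lerD2l rs gerDl.
Qed.

Lemma segC_norm_le y t m : continuous y ->
  (forall s, t - r%:num <= s <= t -> `|y s| <= m) -> `|segC r y t| <= m.
Proof.
move=> c1 H; apply/CSpace_normP => s sr.
rewrite !segC_val//; apply: H; case/andP: sr => rs s0.
by rewrite lerD2l rs gerDl.
Qed.

Lemma segC_segC y f t : continuous y -> segC r y 0 = f -> - r%:num <= t <= 0 -> y t = f t.
Proof. by move=> cy <- tr; rewrite segC_val// add0r. Qed.

(** Evaluation is jointly continuous, by uniform convergence and continuity of the limit; this makes
    state-dependent delay terms continuous on C. *)
Lemma CSpace_eval_cvg {I : Type} {F : set_system I} {FF : Filter F} (u : I -> C)
    (s : I -> R) f a : u i @[i --> F] --> f -> s i @[i --> F] --> a ->
  u i (s i) @[i --> F] --> f a.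
Proof.
move=> uf sa; apply/cvgrPdist_le => e e0; have e2 : 0 < e / 2 by rewrite divr_gt0.
have fs : f (s i) @[i --> F] --> f a.
  by apply: (@cvg_comp _ _ _ s f _ _ _ sa); exact: CSpace_continuous.
move/cvgrPdist_le : fs => /(_ _ e2); move/cvgrPdist_le : uf => /(_ _ e2).
apply: filterS2 => i ui fi; rewrite -(subrKA (f (s i))) (le_trans (ler_normD _ _))//.
rewrite (splitr e) lerD// (le_trans _ ui)//.
exact: (CSpace_le_norm (f - u i)).
Qed.

Lemma segC_continuous y : continuous y -> continuous (segC r y).
Proof.
move=> cy t; apply/cvgrPdist_le => e e0.
have /compact_near_coveringP := @segment_compact R (- r%:num) 0.
move=> /(_ _ (nbhs t) (fun t' s => `|y (t + s) - y (t' + s)| <= e)) H.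
have : \forall t' \near t, `[- r%:num, 0]%classic `<=` (fun s => `|y (t + s) - y (t' + s)| <= e).
  apply: H => s _; have e2 : 0 < e / 2 by rewrite divr_gt0.
  have H : `|y (t + s) - y ((p.2 : R) + (p.1 : R))| @[p --> (s, t)] --> `|y (t + s) - y (t + s)|.
    apply: cvg_norm; apply: cvgB; first exact: cvg_cst.
    apply: (@cvg_comp _ _ _ (fun p : R * R => p.2 + p.1) y); last exact: cy.
    by apply: cvgD; [exact: cvg_snd|exact: cvg_fst].
  have H1 : `|y (t + (p.1 : R)) - y (t + s)| @[p --> (s, t)] --> `|y (t + s) - y (t + s)|.
    apply: cvg_norm; apply: cvgB; last exact: cvg_cst.
    apply: (@cvg_comp _ _ _ (fun p : R * R => t + p.1) y); last exact: cy.
    by apply: cvgD; [exact: cvg_cst|exact: cvg_fst].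
  move: H H1; rewrite subrr normr0 => /cvgr_le/(_ _ e2) + /cvgr_le/(_ _ e2).
  apply: filterS2 => -[s' t'] /= A B.
  by rewrite (le_trans (ler_distD (y (t + s)) _ _))// (splitr e) lerD.
apply: filterS => t' Ht'; apply/CSpace_normP => s sr.
change (`|segC r y t s - segC r y t' s| <= e).
by rewrite !segC_val//; apply: Ht'; rewrite /= in_itv.
Qed.

Lemma WSpace_lip (x : W) : exists2 M : R, 0 <= M &
  forall s t : R, `|x s - x t| <= M * `|s - t|.
Proof.
have /wsegP [M xM] := valP x; exists `|M| => // s t.
by rewrite (le_trans (xM s t))// ler_wpM2r// ler_norm.
Qed.

Lemma segC_lip y t M : continuous y -> 0 <= M ->
  (forall u v, t - r%:num <= u -> u <= v -> v <= t -> `|y v - y u| <= M * (v - u)) ->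
  forall s u : R, `|segC r y t s - segC r y t u| <= M * `|s - u|.
Proof.
move=> cy M0 yM.
have clip s u : s <= u -> clamp r s <= clamp r u /\ clamp r u - clamp r s <= u - s.
  have r0 : 0 < r%:num by [].
  rewrite /clamp /Num.max /Num.min.
  by case: (ltP s 0) => ?; case: (ltP u 0) => ?; rewrite ?oppr_lt0 ?r0;
    case: (ltP (- r%:num) s) => ?; case: (ltP (- r%:num) u) => ?; split; lra.
have main s u : s <= u -> `|segC r y t u - segC r y t s| <= M * (u - s).
  move=> su; have [c1 c2] := clip s u su; rewrite !segCE//.
  have := clamp_in r s; have := clamp_in r u; rewrite !in_itv/= => /andP[u1 u2] /andP[s1 s2].
  apply: (le_trans (yM _ _ _ _ _)); rewrite ?lerD2l// ?gerDl//.
  by rewrite ler_wpM2l// opprD addrACA subrr add0r.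
move=> s u; have [su|/ltW us] := leP s u.
  by rewrite distrC (le_trans (main _ _ su))// ler_wpM2l// distrC ler_norm.
by rewrite (le_trans (main _ _ us))// ler_wpM2l// ler_norm.
Qed.

(** [segW] returns 0 on segments that are not Lipschitz; a slope bound on the window excludes this
    default. *)
Lemma segWE y t M : continuous y -> 0 <= M ->
  (forall u v, t - r%:num <= u -> u <= v -> v <= t -> `|y v - y u| <= M * (v - u)) ->
  wfun (segW r y t) = segC r y t.
Proof.
move=> cy M0 yM; rewrite /segW insubdK//.
by apply/wsegP; exists M; exact: segC_lip.
Qed.

Lemma WSpace_le_norm (x : W) : `|wfun x| <= `|x|.
Proof. by rewrite [leRHS]/Num.Def.normr/= /wnorm le_max lexx. Qed.

Lemma wfun_continuous : continuous (@wfun R r n).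
Proof.
move=> x; have Fx : Filter (nbhs x) by exact: nbhs_filter.
apply/cvgrPdist_le => e e0.
have /cvgrPdist_le /(_ _ e0) : y @[y --> x] --> x by exact: cvg_id.
by apply: filterS => y; apply: le_trans; exact: (WSpace_le_norm (x - y)).
Qed.

Definition lip_ball (c : R) : set C :=
  [set v : C | `|v| <= 1 /\ forall s t : R, `|v s - v t| <= c * `|s - t|].

(** Arzela-Ascoli through ultrafilters: pointwise limits exist by compactness of the
    finite-dimensional ball and inherit the Lipschitz constant; equicontinuity and a covering of
    [[-r, 0]] make the convergence uniform. *)
Lemma lip_ball_compact c : 0 <= c -> compact (lip_ball c).
Proof.
move=> c0; rewrite compact_ultra => F UF FB.
have PF : ProperFilter F by case: UF.
have ball1 : compact [set v : V | `|v| <= 1].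
  apply: bounded_closed_compact.
    by exists 1; split=> // N N1 v /= /le_trans; apply; exact: ltW.
  rewrite (_ : [set v | _] = (@Num.norm R V) @^-1` [set x | x <= 1]) //.
  apply: closed_comp; last exact: closed_le.
  by move=> v _; exact: norm_continuous.
have /choice[g Hg] : forall s : R, exists a : V, `|a| <= 1 /\ v s @[v --> F] --> a.
  move=> s; apply: (ultra_cvg UF ball1).
  by apply: filterS FB => v [v1 _]; exact: le_trans (CSpace_le_norm v s) v1.
have glip s t : `|g s - g t| <= c * `|s - t|.
  apply: (@cvgr_to_le _ F _ _ (fun v : C => `|v s - v t|)).
    by apply: cvg_norm; apply: cvgB; [exact: (Hg s).2|exact: (Hg t).2].
  by apply: filterS FB => v [_].
have gclamp s : g (clamp r s) = g s.
  apply: (@cvg_unique _ (@norm_hausdorff _ _) (v s @[v --> F])); last exact: (Hg s).2.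
  have E : (fun v : C => v (clamp r s)) = (fun v : C => v s).
    by apply/funext => v; exact: CSpace_clamp.
  by have := (Hg (clamp r s)).2; rewrite -[X in X --> _]/((fun v : C => v (clamp r s)) @ F) E.
have gc : continuous g.
  move=> s; apply/cvgrPdist_le => e e0.
  have c1 : 0 < c + 1 by rewrite ltr_wpDl.
  have : \forall t \near s, `|s - t| <= e / (c + 1).
    by apply: (@cvgr_dist_le _ _ _ (nbhs s) _ id s); [exact: cvg_id|rewrite divr_gt0].
  apply: filterS => t; rewrite ler_pdivlMr// => H; apply: (le_trans (glip s t)).
  by rewrite (le_trans _ H)// mulrC ler_wpM2l// lerDl.
have gC : g \in @cseg R r n by rewrite inE.
exists (MkC gC); split.
  split=> [|s t]; last exact: glip.
  by apply/CSpace_normP => s _; exact: (Hg s).1.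
apply/cvgrPdist_le => e e0.
have /compact_near_coveringP := @segment_compact R (- r%:num) 0.
move=> /(_ _ F (fun (v : C) s => `|g s - v s| <= e)) H.
have : F (fun v : C => `[- r%:num, 0]%classic `<=` (fun s : R => `|g s - v s| <= e)).
  apply: H => s _; have e2 : 0 < e / 2 by rewrite divr_gt0.
  have c1 : 0 < c + 1 by rewrite ltr_wpDl.
  have /cvgrPdist_le/(_ _ e2) Fs := (Hg s).2.
  exists ([set t : R | `|s - t| <= e / 4 / (c + 1)], lip_ball c `&` [set v : C | `|g s - v s| <= e / 2]).
    split; last exact: filterI.
    by apply: (@cvgr_dist_le _ _ _ (nbhs s) _ id s); [exact: cvg_id|rewrite !divr_gt0].
  move=> [t v] /= [st [[_ vlip] vs]].
  have st' : c * `|s - t| <= e / 4.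
    move: st; rewrite ler_pdivlMr// => /(le_trans _); apply.
    by rewrite mulrC ler_wpM2l// lerDl.
  have := vlip s t; have := glip t s; rewrite (distrC t).
  have := ler_normD (g t - g s) (g s - v t); rewrite subrKA.
  have := ler_normD (g s - v s) (v s - v t); rewrite subrKA.
  lra.
apply: filterS => v Hv; apply/CSpace_normP => s sr.
by apply: Hv; rewrite /= in_itv.
Qed.

End CSpace_theory.

Section bounded_linear.
Context {R : realType} {X Y : normedModType R}.
Implicit Types A B D : X -> Y.

Definition blin A := (forall (a : R) u v, A (a *: u + v) = a *: A u + A v) /\
  exists M : R, forall v, `|A v| <= M * `|v|.

Lemma blinD A u v : blin A -> A (u + v) = A u + A v.
Proof. by case=> /(_ 1 u v); rewrite !scale1r. Qed.

Lemma blin0 A : blin A -> A 0 = 0.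
Proof. by case=> /(_ (-1) 0 0); rewrite scaler0 addr0 scaleN1r addNr. Qed.

Lemma blinZ A (a : R) u : blin A -> A (a *: u) = a *: A u.
Proof. by move=> bA; case: (bA) => /(_ a u 0); rewrite (blin0 bA) !addr0. Qed.

Lemma blinB A u v : blin A -> A (u - v) = A u - A v.
Proof. by move=> bA; rewrite blinD// -scaleN1r blinZ// scaleN1r. Qed.

Lemma blin_sub A B : blin A -> blin B -> blin (A \- B).
Proof.
move=> [lA [M AM]] [lB [N BN]]; split.
  by move=> a u v; rewrite /= lA lB scalerBr opprD addrACA.
exists (M + N) => v /=; rewrite (le_trans (ler_normB _ _))// mulrDl.
exact: lerD.
Qed.

Lemma blin_diff (f : X -> Y) (x : X) : differentiable f x -> blin ('d f x).
Proof.
move=> df; split; first by move=> a u v; rewrite linearP.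
have /linear_bounded_continuous/linear_boundedP/pinfty_ex_gt0[M M0 HM] := diff_continuous df.
by exists M.
Qed.

Lemma opnorm_has_sup A : blin A -> has_sup [set `|A v| | v in [set v : X | `|v| <= 1]].
Proof.
move=> bA; have [_ [M AM]] := bA; split.
  by exists `|A 0|, 0 => //=; rewrite normr0.
exists `|M| => _ [v /= v1 <-]; apply: (le_trans (AM v)).
rewrite (le_trans (ler_wpM2r _ (ler_norm M)))// -[leRHS]mulr1.
exact: ler_wpM2l.
Qed.

Lemma opnorm_ge0 A : blin A -> 0 <= opnorm A.
Proof.
move=> bA; rewrite (le_trans (normr_ge0 (A 0)))//; apply: (ub_le_sup (opnorm_has_sup bA).2).
by exists 0 => //=; rewrite normr0.
Qed.

Lemma opnorm_ub A v : blin A -> `|A v| <= opnorm A * `|v|.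
Proof.
move=> bA; have [->|v0] := eqVneq v 0.
  by rewrite (blin0 bA) !normr0 mulr0.
rewrite -ler_pdivrMr ?normr_gt0// mulrC.
have -> : `|v|^-1 * `|A v| = `|A (`|v|^-1 *: v)|.
  by rewrite blinZ// normrZ normfV normr_id.
apply: (ub_le_sup (opnorm_has_sup bA).2); exists (`|v|^-1 *: v) => //=.
by rewrite normrZ normfV normr_id mulVf// normr_eq0.
Qed.

Lemma opnorm_le A (M : R) : blin A -> (forall v, `|v| <= 1 -> `|A v| <= M) -> opnorm A <= M.
Proof.
move=> bA H; apply: ge_sup; first exact: (opnorm_has_sup bA).1.
by move=> _ [v /= v1 <-]; exact: H.
Qed.

Lemma opnorm_triangle A B D : blin A -> blin B -> blin D ->
  opnorm (A \- D) <= opnorm (A \- B) + opnorm (B \- D).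
Proof.
move=> bA bB bD; apply: opnorm_le => [|v v1]; first exact: blin_sub.
have le1 E : blin E -> `|E v| <= opnorm E.
  move=> bE; rewrite (le_trans (opnorm_ub v bE))// -[leRHS]mulr1.
  by rewrite ler_wpM2l// opnorm_ge0.
rewrite /= -(subrKA (B v)) (le_trans (ler_normD _ _))// lerD//.
  exact: (le1 (A \- B)) (blin_sub bA bB).
exact: (le1 (B \- D)) (blin_sub bB bD).
Qed.

Lemma opnorm_sub_sym A B : opnorm (A \- B) = opnorm (B \- A).
Proof.
rewrite /opnorm; congr sup; apply/seteqP; split=> _ [v v1 <-]; exists v => //=;
by rewrite distrC.
Qed.

Section continuity.
Context {T : pseudoMetricType R} (D : T -> X -> Y).
Hypotheses (Dc : opnorm_continuous D) (Db : forall p, blin (D p)).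

Lemma opnorm_uniform (K : set T) : compact K -> forall e, 0 < e ->
  exists2 k, 0 < k & forall p q, K p -> ball p k q -> forall v, `|D q v - D p v| <= e * `|v|.
Proof.
move=> cK e e0.
have [k k0 kP] := @compact_uniform _ _ K (fun p q => opnorm (D q \- D p)) cK
  (fun p q s => le_trans (opnorm_triangle (Db s) (Db q) (Db p)) (eq_ind _ (fun z => _ <= z) (lexx _) _ (addrC _ _)))
  (fun p q => opnorm_sub_sym (D q) (D p)) (fun p _ => Dc p) e e0.
exists k => // p q Kp pq v.
rewrite (le_trans (opnorm_ub v (blin_sub (Db q) (Db p))))// ler_wpM2r//.
exact: kP.
Qed.

Lemma opnorm_bounded (K : set T) : compact K ->
  exists2 M, 0 <= M & forall p v, K p -> `|D p v| <= M * `|v|.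
Proof.
move=> cK.
have [|M M0 MP] := @compact_locally_bounded _ _ K (fun p => opnorm (D p)) cK.
  move=> p Kp; exists (1 + opnorm (D p)).
  have /cvgr_le/(_ 1 ltr01) := @Dc p; apply: filterS => q qp.
  apply: opnorm_le => // v v1; rewrite -[D q v](subrK (D p v)) (le_trans (ler_normD _ _))//.
  have le1 E : blin E -> `|E v| <= opnorm E.
    move=> bE; rewrite (le_trans (opnorm_ub v bE))// -[leRHS]mulr1.
    by rewrite ler_wpM2l// opnorm_ge0.
  rewrite lerD//; last exact: le1.
  apply: le_trans qp; exact: (le1 (D q \- D p)) (blin_sub _ _).
exists M => // p v Kp; rewrite (le_trans (opnorm_ub v (Db p)))// ler_wpM2r//.
exact: MP.
Qed.

Lemma opnorm_eval_cvg {I : Type} {F : set_system I} {FF : Filter F} (u : I -> T) (v : I -> X)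
    (p : T) (a : X) : u i @[i --> F] --> p -> v i @[i --> F] --> a ->
  D (u i) (v i) @[i --> F] --> D p a.
Proof.
move=> up va; apply/cvgrPdist_le => e e0.
have a1 : 0 < `|a| + 1 by rewrite ltr_wpDl.
pose k := Num.min 1 (e / 2 / (`|a| + 1)).
have k0 : 0 < k by rewrite lt_min ltr01 !divr_gt0.
have D1 : 0 < opnorm (D p) + 1 by rewrite ltr_wpDl// opnorm_ge0.
have : opnorm (D (u i) \- D p) @[i --> F] --> 0 by apply: cvg_comp up (@Dc p).
move=> /cvgr_le/(_ _ k0).
pose m := Num.min 1 (e / 2 / (opnorm (D p) + 1)).
have m0 : 0 < m by rewrite lt_min ltr01 !divr_gt0.
move/cvgrPdist_le : va => /(_ _ m0); apply: filterS2 => i via ui.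
rewrite -(subrKA (D p (v i))) (le_trans (ler_normD _ _))// (splitr e) lerD//.
  rewrite -blinB// (le_trans (opnorm_ub _ (Db p)))//.
  apply: (@le_trans _ _ ((opnorm (D p) + 1) * `|a - v i|)); first by rewrite ler_wpM2r// lerDl.
  by rewrite mulrC -ler_pdivlMr// (le_trans via)// ge_min lexx orbT.
rewrite distrC.
have := opnorm_ub (v i) (blin_sub (Db (u i)) (Db p)) => /le_trans; apply.
have vi1 : `|v i| <= `|a| + 1.
  rewrite -[v i](subrK a) (le_trans (ler_normD _ _))// addrC lerD2l distrC.
  by rewrite (le_trans via)// ge_min lexx.
apply: (@le_trans _ _ (k * (`|a| + 1))); first by rewrite ler_pM// opnorm_ge0//; exact: blin_sub.
by rewrite -ler_pdivlMr// ge_min lexx orbT.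
Qed.

End continuity.

Lemma rder_line (f : X -> Y) a v t : differentiable f (a + t *: v) ->
  rder (fun s => f (a + s *: v)) t ('d f (a + t *: v) v).
Proof.
move=> df; rewrite -deriveE//.
have /cvg_ex[l fl] := @diff_derivable _ _ _ f (a + t *: v) v df.
have -> : 'D_v f (a + t *: v) = l by apply/cvg_lim => //; exact: norm_hausdorff.
apply: rder_quotient; move: fl.
have -> : (fun h : R => h^-1 *: ((f \o shift (a + t *: v)) (h *: v) - f (a + t *: v))) =
   (fun h : R => h^-1 *: (f (a + (t + h) *: v) - f (a + t *: v))).
  apply/funext => h; congr (_ *: (f _ - _)).
  by rewrite /= scalerDl [RHS]addrA [RHS]addrC.
apply: cvg_trans; apply: cvg_app => P [e e0 Pe]; exists e => // h /= he h0.
by apply: Pe => //; rewrite gt_eqF.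
Qed.

(** Mean value inequality for [f (a + t *: v) - t *: A v] on [[0, 1]]. The map [A] is free: 0 gives
    Lipschitz bounds, a derivative at [a] gives remainder estimates. *)
Lemma frechet_mean_value (f : X -> Y) (A : X -> Y) a v (e : R) :
  (forall x, differentiable f x) ->
  (forall t, 0 <= t <= 1 -> `|'d f (a + t *: v) v - A v| <= e) ->
  `|f (a + v) - f a - A v| <= e.
Proof.
move=> df H.
have := @mean_value_const R Y (fun t : R => f (a + t *: v) - t *: A v) e 0 1.
rewrite !scale1r !scale0r addr0 !subr0 mulr1 addrAC; apply => //.
  move=> t; apply: cvgB.
    apply: (@continuous_comp R X Y (fun t : R => a + t *: v) f).
      by apply: cvgD; [exact: cvg_cst|apply: cvgZr_tmp; exact: cvg_id].
    exact: differentiable_continuous.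
  by apply: cvgZr_tmp; exact: cvg_id.
move=> t /andP[t0 t1]; exists ('d f (a + t *: v) v - A v); last first.
  by apply: H; rewrite t0 ltW.
apply: rderB; first exact: rder_line.
move=> k k0; apply: filterS (nbhs_right_gt 0) => h h0.
by rewrite scalerDl (addrC (t *: _)) addrK subrr normr0 mulr_ge0// ltW.
Qed.

End bounded_linear.

Section norm_facts.
Context {R : realType}.

Lemma ball_normP {V : normedModType R} (x y : V) (e : R) : ball x e y <-> `|x - y| < e.
Proof. by rewrite -ball_normE. Qed.

Lemma norm_segment {V : normedModType R} (a v : V) (t M : R) : 0 <= t <= 1 ->
  `|a| <= M -> `|a + v| <= M -> `|a + t *: v| <= M.
Proof.
move=> /andP[t0 t1] aM avM.
have -> : a + t *: v = (1 - t) *: a + t *: (a + v).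
  by rewrite scalerDr addrA -scalerDl subrK scale1r.
rewrite (le_trans (ler_normD _ _))// !normrZ (ger0_norm t0) ger0_norm ?subr_ge0//.
have : (1 - t) * `|a| <= (1 - t) * M by rewrite ler_wpM2l ?subr_ge0.
have : t * `|a + v| <= t * M by rewrite ler_wpM2l.
lra.
Qed.

Lemma norm_ball_compact n (M : R) : compact [set v : 'rV[R]_n | `|v| <= M].
Proof.
apply: bounded_closed_compact.
  exists M; split; first exact: num_real.
  by move=> N N1 v /= /le_trans; apply; exact: ltW.
rewrite (_ : [set v | _] = (@Num.norm R 'rV[R]_n) @^-1` [set x | x <= M]) //.
apply: closed_comp; last exact: closed_le.
by move=> v _; exact: norm_continuous.
Qed.

End norm_facts.

(** * The vector field and its solutions *)

Section vector_field.
Context {R : realType} {Om : metricType R} {r : {posnum R}} {n : nat}.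
Local Notation V := 'rV[R]_n.
Local Notation C := (CSpace r n).
Variables (F : Om -> V -> V -> V) (tau : Om -> C -> R).
Hypothesis Om_compact : compact [set: Om].
Hypothesis htau : forall om x, 0 <= tau om x <= r%:num.
Hypotheses (hF : H1 F) (hT : H2star tau).

Definition delay_arg (e : Om * C) : Om * V * V := (e.1, e.2 0, e.2 (- tau e.1 e.2)).

Definition vfield (e : Om * C) : V := F e.1 (e.2 0) (e.2 (- tau e.1 e.2)).

Lemma D2F_blin om a b : blin (D2F F om a b).
Proof. by have [_ dF _ _ _] := hF; exact/blin_diff/dF. Qed.

Lemma D3F_blin om a b : blin (D3F F om a b).
Proof. by have [_ _ dF _ _] := hF; exact/blin_diff/dF. Qed.

Lemma D2tau_blin om x : blin (D2tau tau om x).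
Proof. by have [[_ dT _] _ _] := hT; exact/blin_diff/dT. Qed.

(** H1 provides partial derivatives only, so one argument moves at a time: the present state at
    frozen [b'], the delayed state at frozen [a]. *)
Lemma F_mean_value om a b a' b' (A B : V -> V) (e1 e2 : R) :
  (forall t, 0 <= t <= 1 ->
     `|D2F F om (a + t *: (a' - a)) b' (a' - a) - A (a' - a)| <= e1) ->
  (forall t, 0 <= t <= 1 ->
     `|D3F F om a (b + t *: (b' - b)) (b' - b) - B (b' - b)| <= e2) ->
  `|F om a' b' - F om a b - A (a' - a) - B (b' - b)| <= e1 + e2.
Proof.
have [_ d2 d3 _ _] := hF => HA HB.
have := @frechet_mean_value _ _ _ (fun u => F om u b') A a (a' - a) e1 (d2 om ^~ b') HA.
have := @frechet_mean_value _ _ _ (fun u => F om a u) B b (b' - b) e2 (d3 om a) HB.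
rewrite ![_ + (_ - _)]addrC !subrK => H2 H1'.
have -> : F om a' b' - F om a b - A (a' - a) - B (b' - b) =
   (F om a' b' - F om a b' - A (a' - a)) + (F om a b' - F om a b - B (b' - b)).
  by rewrite [RHS]addrACA subrKA addrA.
by rewrite (le_trans (ler_normD _ _))// lerD.
Qed.

Lemma F_lipschitz (M : R) : exists2 c, 0 <= c & forall om a b a' b',
  `|a| <= M -> `|b| <= M -> `|a'| <= M -> `|b'| <= M ->
  `|F om a' b' - F om a b| <= c * (`|a' - a| + `|b' - b|).
Proof.
have [_ _ _ c2 c3] := hF.
pose S : set (Om * V * V) := ([set: Om] `*` [set v : V | `|v| <= M]) `*` [set v : V | `|v| <= M].
have cS : compact S.
  by do 2![apply: compact_setX; last exact: norm_ball_compact].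
have [m2 m20 H2] := opnorm_bounded c2 (fun p => D2F_blin p.1.1 p.1.2 p.2) cS.
have [m3 m30 H3] := opnorm_bounded c3 (fun p => D3F_blin p.1.1 p.1.2 p.2) cS.
exists (m2 + m3); first exact: addr_ge0.
move=> om a b a' b' aM bM aM' bM'.
have a'E : a + (a' - a) = a' by rewrite addrC subrK.
have b'E : b + (b' - b) = b' by rewrite addrC subrK.
have := @F_mean_value om a b a' b' (cst 0) (cst 0) (m2 * `|a' - a|) (m3 * `|b' - b|).
rewrite /cst !subr0 => H.
apply: (le_trans (H _ _)) => [t t01|t t01|]; rewrite ?subr0.
- apply: (H2 (om, _, b')); split => //; split => //=.
  by apply: norm_segment => //; rewrite a'E.
- apply: (H3 (om, a, _)); split => //=.
  by apply: norm_segment => //; rewrite b'E.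
- rewrite mulrDl; have : 0 <= m2 * `|b' - b| by rewrite mulr_ge0.
  by have : 0 <= m3 * `|a' - a| by [rewrite mulr_ge0]; lra.
Qed.

Lemma F_uniformly_differentiable (M e : R) : 0 < e -> exists2 k, 0 < k & forall om a b a' b',
  `|a| <= M -> `|b| <= M -> `|a' - a| < k -> `|b' - b| < k ->
  `|F om a' b' - F om a b - D2F F om a b (a' - a) - D3F F om a b (b' - b)|
    <= e * (`|a' - a| + `|b' - b|).
Proof.
move=> e0; have [_ _ _ c2 c3] := hF.
pose S : set (Om * V * V) := ([set: Om] `*` [set v : V | `|v| <= M]) `*` [set v : V | `|v| <= M].
have cS : compact S.
  by do 2![apply: compact_setX; last exact: norm_ball_compact].
have [k2 k20 H2] := opnorm_uniform c2 (fun p => D2F_blin p.1.1 p.1.2 p.2) cS e0.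
have [k3 k30 H3] := opnorm_uniform c3 (fun p => D3F_blin p.1.1 p.1.2 p.2) cS e0.
exists (Num.min k2 k3); first by rewrite lt_min k20 k30.
move=> om a b a' b' aM bM; rewrite !lt_min => /andP[a2 a3] /andP[b2 b3].
have tlt t (v : V) k : 0 <= t <= 1 -> `|v| < k -> `|t *: v| < k.
  move=> /andP[t0 t1]; apply: le_lt_trans.
  by rewrite normrZ ger0_norm// ler_piMl.
rewrite mulrDr; apply: F_mean_value => t t01.
- apply: (H2 (om, a, b) (om, _, b')) => //; split=> /=; last by apply/ball_normP; rewrite distrC.
  split=> /=; first exact: ballxx.
  by apply/ball_normP; rewrite opprD addrA subrr add0r normrN; exact: tlt.
- apply: (H3 (om, a, b) (om, a, _)) => //; split=> /=.
    by apply: ballxx.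
  by apply/ball_normP; rewrite opprD addrA subrr add0r normrN; exact: tlt.
Qed.

Lemma tau_lipschitz (M : R) : exists2 L, 0 <= L & forall om (x1 x2 : C),
  `|x1| <= M -> `|x2| <= M -> `|tau om x1 - tau om x2| <= L * `|x1 - x2|.
Proof.
have [_ H2 _] := hT.
have [||L L0 H] := H2 [set x : C | `|x| <= M].
- exists M; split; first exact: num_real.
  by move=> N N1 v /= /le_trans; apply; exact: ltW.
- rewrite (_ : [set v | _] = (@Num.norm R C) @^-1` [set x | x <= M]) //.
  by apply: closed_comp; [move=> v _; exact: norm_continuous|exact: closed_le].
by exists L; [exact: ltW|exact: H].
Qed.

(** Closed balls of C are in general not compact, so uniformity is obtained over a compact set [S]
    of base points, later the image of K; the perturbed [x'] is arbitrary. *)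
Lemma tau_uniformly_differentiable (S : set (Om * C)) (e : R) : compact S -> 0 < e ->
  exists2 k, 0 < k & forall om x x', S (om, x) -> `|x' - x| < k ->
    `|tau om x' - tau om x - D2tau tau om x (x' - x)| <= e * `|x' - x|.
Proof.
move=> cS e0; have [[_ dT cT] _ _] := hT.
have [k k0 H] := opnorm_uniform cT (fun p => D2tau_blin p.1 p.2) cS e0.
exists k => // om x x' Sx xk.
have := @frechet_mean_value _ _ _ (tau om) (D2tau tau om x) x (x' - x) (e * `|x' - x|).
rewrite (addrC x) subrK; apply; first by move=> z; exact: dT.
move=> t /andP[t0 t1]; apply: (H (om, x) (om, _)) => //; split.
  exact: ballxx.
apply/ball_normP; change (`|x - (x + t *: (x' - x))| < k); rewrite opprD addrA subrr add0r normrN.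
by apply: le_lt_trans xk; rewrite normrZ ger0_norm// ler_piMl.
Qed.

Lemma delay_in om x : - r%:num <= - tau om x <= 0.
Proof. by have /andP[t0 tr] := htau om x; rewrite lerN2 tr oppr_le0 t0. Qed.

Section cvg.
Context {I : Type} {G : set_system I} {FG : Filter G}.
Variables (w : I -> Om) (x : I -> C) (w0 : Om) (x0 : C).
Hypotheses (ww : w i @[i --> G] --> w0) (xx : x i @[i --> G] --> x0).

Lemma tau_cvg : tau (w i) (x i) @[i --> G] --> tau w0 x0.
Proof.
have [[cT _ _] _ _] := hT.
apply: (@cvg_comp _ _ _ (fun i => (w i, x i)) (fun p : Om * C => tau p.1 p.2) _ (nbhs (w0, x0))).
  exact: (cvg_pair ww xx).
exact: (cT (w0, x0)).
Qed.

Lemma delay_arg_cvg : delay_arg (w i, x i) @[i --> G] --> delay_arg (w0, x0).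
Proof.
have e0 : x i 0 @[i --> G] --> x0 0 by apply: CSpace_eval_cvg => //; exact: cvg_cst.
have e1 : x i (- tau (w i) (x i)) @[i --> G] --> x0 (- tau w0 x0).
  by apply: CSpace_eval_cvg => //; apply: cvgN; exact: tau_cvg.
exact: (cvg_pair (cvg_pair ww e0) e1).
Qed.

Lemma vfield_cvg : vfield (w i, x i) @[i --> G] --> vfield (w0, x0).
Proof.
have [cF _ _ _ _] := hF.
apply: (@cvg_comp _ _ _ (fun i => delay_arg (w i, x i))
  (fun p : Om * V * V => F p.1.1 p.1.2 p.2) _ (nbhs (delay_arg (w0, x0)))).
  exact: delay_arg_cvg.
exact: (cF (delay_arg (w0, x0))).
Qed.

End cvg.

Lemma vfield_continuous : continuous vfield.
Proof.
by move=> [w x]; apply: vfield_cvg; [exact: cvg_fst|exact: cvg_snd].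
Qed.

(** The difference [x (- tau x) - xb (- tau xb)] is split at [xb (- tau x)]: the first part is at
    most [|x - xb|], the second at most [N * L * |x - xb|] because [xb] is Lipschitz. Nothing but a
    sup bound is asked of [x]. The form [1 <= c] is the one that [delay_gronwall] wants. *)
Lemma vfield_lipschitz (M N : R) : 0 <= N -> exists2 c, 1 <= c & forall om (x xb : C),
  `|x| <= M -> `|xb| <= M -> (forall s t : R, `|xb s - xb t| <= N * `|s - t|) ->
  `|vfield (om, x) - vfield (om, xb)| <= c * `|x - xb|.
Proof.
move=> N0; have [c c0 Hc] := F_lipschitz M; have [L L0 HL] := tau_lipschitz M.
exists (1 + c * (1 + (1 + N * L))).
  by rewrite lerDl mulr_ge0// !addr_ge0// mulr_ge0.
move=> om x xb xM xbM xbN; have le f s : `|f| <= M -> `|(f : C) s| <= M.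
  by apply: le_trans; exact: CSpace_le_norm.
apply: (le_trans (Hc _ _ _ _ _ _ _ _ _)); [exact: le..|].
set m := `|x - xb|; have m0 : 0 <= m by exact: normr_ge0.
have e1 : `|x 0 - xb 0| <= m by exact: (CSpace_le_norm (x - xb) 0).
have e2 : `|x (- tau om x) - xb (- tau om xb)| <= m + N * (L * m).
  rewrite -(subrKA (xb (- tau om x))) (le_trans (ler_normD _ _))// lerD//.
    exact: (CSpace_le_norm (x - xb)).
  rewrite (le_trans (xbN _ _))// ler_wpM2l// opprK addrC distrC.
  by rewrite (le_trans (HL _ _ _ _ _))// ler_wpM2l.
rewrite mulrDl mul1r -mulrA ler_wpDl//; apply: ler_wpM2l => //.
by rewrite !mulrDl mul1r; lra.
Qed.

End vector_field.

Section paths.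
Context {R : realType} {V : normedModType R}.

Lemma continuous_bounded_itv (f : R -> V) (a b : R) : continuous f ->
  exists2 M, 0 <= M & forall t, a <= t <= b -> `|f t| <= M.
Proof.
move=> cf.
have [|M M0 MP] := @compact_locally_bounded R R `[a, b]%classic (fun t => `|f t|) (@segment_compact _ a b).
  move=> t _; exists (`|f t| + 1).
  have : `|f s| @[s --> t] --> `|f t| by apply: cvg_norm; exact: cf.
  by move=> /cvgr_le; apply; rewrite ltrDl.
by exists M => // t tab; apply: MP; rewrite /= in_itv.
Qed.

Lemma lip_glue (y : R -> V) (a b c N : R) :
  (forall u v, a <= u -> u <= v -> v <= b -> `|y v - y u| <= N * (v - u)) ->
  (forall u v, b <= u -> u <= v -> v <= c -> `|y v - y u| <= N * (v - u)) ->
  forall u v, a <= u -> u <= v -> v <= c -> `|y v - y u| <= N * (v - u).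
Proof.
move=> H1 H2 u v au uv vc; have [vb|/ltW bv] := leP v b; first exact: H1.
have [bu|/ltW ub] := leP b u; first exact: H2.
rewrite -(subrKA (y b)) (le_trans (ler_normD _ _))//.
by have := H1 u b au ub (lexx b); have := H2 b v (lexx b) bv vc; lra.
Qed.

Lemma within_comp_continuous (A : set R) (y : R -> V) (g : R -> R) :
  {within A, continuous y} -> continuous g -> (forall t, A (g t)) -> continuous (y \o g).
Proof.
move=> /subspace_continuousP cy cg Ag t.
apply: (@cvg_comp _ _ _ g y _ (within A (nbhs (g t)))); last exact: cy.
move=> P; rewrite /within /= => H; have {}H : \forall s \near t, A (g s) -> P (g s) by exact: cg H.
change (\forall s \near t, P (g s)).
by apply: filterS H => s /(_ (Ag s)).
Qed.

End paths.

Section solutions.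
Context {R : realType} {Om : metricType R} {r : {posnum R}} {n : nat}.
Local Notation V := 'rV[R]_n.
Local Notation C := (CSpace r n).
Local Notation W := (WSpace r n).
Local Notation half := ([set s : R | 0 <= s]).
Variables (sigma : R -> Om -> Om) (F : Om -> V -> V -> V) (tau : Om -> C -> R).
Hypothesis Om_compact : compact [set: Om].
Hypotheses (hsigma : is_flow sigma) (htau : forall om x, 0 <= tau om x <= r%:num).
Hypotheses (hF : H1 F) (hT : H2star tau).
Local Notation f := (vfield F tau).

(** Continuity on the whole line, rather than on [[-r, oo)] alone, frees every use of [segC] from
    side conditions; the values before -r do not matter. *)
Definition gsol om (y : R -> V) := continuous y /\
  forall t, 0 <= t -> is_deriv_in half y t (f (sigma t om, segC r y t)).

Lemma vfield_seg om y t : continuous y ->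
  f (om, segC r y t) = F om (y t) (y (t - tau om (segC r y t))).
Proof.
move=> cy; rewrite /vfield/= segC_val//; last by rewrite lexx oppr_le0 ge0.
by rewrite addr0 segC_val// delay_in.
Qed.

Lemma sigma_continuous om : continuous (sigma ^~ om).
Proof.
have [cs _ _] := hsigma => t.
apply: (@cvg_comp _ _ _ (fun t : R => (t, om)) (fun p : R * Om => sigma p.1 p.2) _ (nbhs (t, om))).
  have i1 : s @[s --> t] --> t by exact: cvg_id.
  have i2 : om @[s --> t] --> om by exact: cvg_cst.
  exact: (cvg_pair i1 i2).
exact: (cs (t, om)).
Qed.

Lemma vfield_along_continuous om y : continuous y ->
  continuous (fun t : R => f (sigma t om, segC r y t)).
Proof.
move=> cy t; apply: (vfield_cvg hF hT); first exact: sigma_continuous.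
exact: segC_continuous.
Qed.

Lemma half_right (t : R) : 0 <= t -> \forall h \near 0^'+, half (t + h).
Proof. by move=> t0; apply: filterS (nbhs_right_gt 0) => h h0 /=; rewrite addr_ge0// ltW. Qed.

Lemma deriv_half_rder (y : R -> V) t d : 0 <= t -> is_deriv_in half y t d -> rder y t d.
Proof. by move=> t0; apply: rder_deriv_in; exact: half_right. Qed.

Lemma seg0_lip (y : R -> V) N : continuous y ->
  (forall s t : R, `|segC r y 0 s - segC r y 0 t| <= N * `|s - t|) ->
  forall u v, - r%:num <= u -> u <= v -> v <= 0 -> `|y v - y u| <= N * (v - u).
Proof.
move=> cy H u v ru uv v0.
rewrite !(@segC_segC _ _ _ y (segC r y 0))//; last 2 first.
- by rewrite ru (le_trans uv).
- by rewrite (le_trans ru uv).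
by rewrite (le_trans (H _ _))// ger0_norm ?subr_ge0.
Qed.

Lemma deriv_bounded_lip (y : R -> V) (a b N : R) : continuous y ->
  (forall t, a <= t < b -> exists2 d, rder y t d & `|d| <= N) ->
  forall u v, a <= u -> u <= v -> v <= b -> `|y v - y u| <= N * (v - u).
Proof.
move=> cy H u v au uv vb; apply: mean_value_const => // t /andP[ut tv].
by apply: H; rewrite (le_trans au ut) (lt_le_trans tv).
Qed.

Lemma gsol_lip om y T : gsol om y -> (exists x : W, segC r y 0 = x) ->
  exists2 N, 0 <= N & forall u v, - r%:num <= u -> u <= v -> v <= T ->
    `|y v - y u| <= N * (v - u).
Proof.
move=> [cy dy] [x xE].
have [N1 N10 HN1] := WSpace_lip x.
have [N2 N20 HN2] := continuous_bounded_itv 0 T (@vfield_along_continuous om _ cy).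
exists (N1 + N2); first exact: addr_ge0.
apply: (lip_glue (b := 0)) => u v au uv vb.
  apply: (@le_trans _ _ (N1 * (v - u))).
    by apply: (@seg0_lip y N1) => // s t; rewrite xE.
  by rewrite ler_wpM2r ?subr_ge0// lerDl.
apply: (@le_trans _ _ (N2 * (v - u))); last by rewrite ler_wpM2r ?subr_ge0// lerDr.
apply: (@deriv_bounded_lip y 0 T) => // t /andP[t0 tT].
exists (f (sigma t om, segC r y t)); first exact: deriv_half_rder (dy _ t0).
by apply: HN2; rewrite t0 ltW.
Qed.

(** Only [y2] is assumed Lipschitz, since [vfield_lipschitz] asks regularity of one argument;
    [delay_gronwall] then applies with zero initial and forcing terms. *)
Lemma sol_unique om (y1 y2 : R -> V) (T N : R) : 0 <= N ->
  continuous y1 -> continuous y2 ->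
  (forall s, - r%:num <= s <= 0 -> y1 s = y2 s) ->
  (forall t, 0 <= t < T -> rder y1 t (f (sigma t om, segC r y1 t))) ->
  (forall t, 0 <= t < T -> rder y2 t (f (sigma t om, segC r y2 t))) ->
  (forall u v, - r%:num <= u -> u <= v -> v <= T -> `|y2 v - y2 u| <= N * (v - u)) ->
  forall t, - r%:num <= t <= T -> y1 t = y2 t.
Proof.
move=> N0 c1 c2 e0 d1 d2 l2 t /andP[rt tT].
have [t0|/ltW t0] := leP t 0; first by apply: e0; rewrite rt.
have [M1 M10 HM1] := continuous_bounded_itv (- r%:num) T c1.
have [M2 M20 HM2] := continuous_bounded_itv (- r%:num) T c2.
have [c c_ge1 Hc] := vfield_lipschitz Om_compact hF hT (M1 + M2) N0.
have : `|y1 t - y2 t| <= (0 + 0) * expR (c * (t - 0)).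
  apply: (@delay_gronwall _ _ (fun t => y1 t - y2 t) r%:num 0 T) => //.
  - by move=> s; apply: cvgB; [exact: c1|exact: c2].
  - by move=> s; rewrite sub0r => /e0 ->; rewrite subrr normr0.
  - move=> s /andP[s0 sT].
    exists (f (sigma s om, segC r y1 s) - f (sigma s om, segC r y2 s)).
      by apply: rderB; [apply: d1|apply: d2]; rewrite s0.
    move=> m Hm; rewrite addr0.
    have rs : - r%:num <= s - r%:num by rewrite lerDr.
    apply: (le_trans (Hc _ _ _ _ _ _)).
    + apply: segC_norm_le => // v /andP[v1 v2]; rewrite (le_trans (HM1 v _)) ?lerDl//.
      by rewrite (le_trans rs v1) (le_trans v2 (ltW sT)).
    + apply: segC_norm_le => // v /andP[v1 v2]; rewrite (le_trans (HM2 v _)) ?lerDr//.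
      by rewrite (le_trans rs v1) (le_trans v2 (ltW sT)).
    + apply: segC_lip => // u v u1 uv v1; apply: l2 => //; first exact: le_trans u1.
      exact: le_trans v1 (ltW sT).
    + by rewrite ler_wpM2l ?(le_trans ler01)//; apply: segC_le.
  - by rewrite t0.
by rewrite addr0 mul0r normr_le0 subr_eq0 => /eqP.
Qed.

Lemma gsol_solution om (x : W) y : gsol om y -> segC r y 0 = x ->
  is_solution sigma F tau om x +oo y.
Proof.
move=> [cy dy] y0; split => //.
- exact: continuous_subspaceT.
- by move=> s sr; exact: segC_segC y0 sr.
move=> t t0 _; rewrite -vfield_seg//.
by apply: is_deriv_in_sub (dy t t0) => s [].
Qed.

Lemma maxl_continuous (a : R) : continuous (fun t : R => Num.max a t).
Proof. by move=> t; apply: (@continuous_max R R (cst a) idfun); [exact: cvg_cst|exact: cvg_id]. Qed.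

Lemma minr_continuous (a : R) : continuous (fun t : R => Num.min t a).
Proof. by move=> t; apply: (@continuous_min R R idfun (cst a)); [exact: cvg_id|exact: cvg_cst]. Qed.

(** Freezing [y] at its value in -r gives a continuous function on the line; segments at times
    [t >= 0] do not see the change. *)
Lemma solution_gsol om (x : W) y : is_solution sigma F tau om x +oo y ->
  exists Y, [/\ gsol om Y, segC r Y 0 = x & forall t, - r%:num <= t -> y t = Y t].
Proof.
move=> [_ cy y0 dy].
pose Y t := y (Num.max (- r%:num) t).
have yY t : - r%:num <= t -> y t = Y t by move=> rt; rewrite /Y (max_idPr rt).
have cY : continuous Y.
  apply: (within_comp_continuous cy (@maxl_continuous (- r%:num))) => t /=.
  by rewrite ltry le_max lexx.
exists Y; split=> //; last first.
  apply: CSpace_ext => s sr; rewrite segC_val// add0r -yY; last by case/andP: sr.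
  exact: y0.
split=> // t t0; have rt : - r%:num <= t - r%:num by rewrite lerDr.
have sE : segC r Y t = segC r y t.
  by apply: segC_eq => s /andP[s1 _]; rewrite yY// (le_trans rt).
have := dy t t0 (ltry _); rewrite -sE; set tt := tau _ _ => H.
have /andP[tt0 ttr] : 0 <= tt <= r%:num by exact: htau.
rewrite vfield_seg// -/tt -!yY; last 2 first.
- by rewrite (le_trans rt)// lerD2l lerN2.
- by rewrite (le_trans _ t0)// oppr_le0 ge0.
apply: (@is_deriv_in_eq _ _ _ y) => //.
  by move=> s /= s0; apply: yY; rewrite (le_trans _ s0)// oppr_le0 ge0.
by apply: is_deriv_in_sub H => s /= s0; rewrite ltry.
Qed.

Lemma is_solution_unique om (x : W) T y Y : is_solution sigma F tau om x T y ->
  gsol om Y -> segC r Y 0 = x -> forall t, - r%:num <= t -> (t%:E < T)%E -> y t = Y t.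
Proof.
move=> [T0 cy y0 dy] gY Y0 t rt tT.
have [cY dY] := gY.
have [t0|t0] := leP t 0.
  by rewrite y0 ?rt//; apply/esym/(segC_segC cY Y0); rewrite rt.
(* Freezing [y] outside [[-r, t]] makes it globally continuous and leaves right derivatives in
   [[0, t)] unchanged. *)
pose y1 s := y (Num.max (- r%:num) (Num.min s t)).
have y1E s : - r%:num <= s <= t -> y1 s = y s.
  by move=> /andP[rs st]; rewrite /y1 (min_idPl st) (max_idPr rs).
have c1 : continuous y1.
  apply: (within_comp_continuous cy (g := fun s => Num.max (- r%:num) (Num.min s t))) => s.
    apply: (@continuous_comp _ _ _ (fun s : R => Num.min s t) (fun s => Num.max (- r%:num) s)).
      exact: minr_continuous.
    exact: maxl_continuous.
  rewrite /= le_max lexx; split=> //; apply: le_lt_trans tT.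
  by rewrite lee_fin ge_max rt ge_min lexx orbT.
have [N N0 YN] := gsol_lip t gY (ex_intro _ x Y0).
rewrite -y1E ?rt ?lexx//.
apply: (@sol_unique om y1 Y t N) => //; last by rewrite rt lexx.
- move=> s /andP[rs s0]; rewrite y1E ?rs ?(le_trans s0 (ltW t0))// y0 ?rs//.
  by apply/esym/(segC_segC cY Y0); rewrite rs.
- move=> s /andP[s0 st].
  have rs : - r%:num <= s - r%:num by rewrite lerDr.
  have sT : (s%:E < T)%E by apply: lt_trans tT; rewrite lte_fin.
  have sE : segC r y1 s = segC r y s.
    apply: segC_eq => v /andP[v1 v2]; rewrite y1E// (le_trans rs v1).
    by rewrite (le_trans v2 (ltW st)).
  have := dy s s0 sT; rewrite -sE; set tt := tau _ _ => H.
  have /andP[tt0 ttr] : 0 <= tt <= r%:num by exact: htau.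
  rewrite vfield_seg// -/tt !y1E; last 2 first.
  + by rewrite (le_trans rs) ?lerD2l ?lerN2//= (le_trans _ (ltW st))// gerBl.
  + by rewrite (le_trans _ s0) ?oppr_le0 ?ge0// ltW.
  have {}H : rder y s (F (sigma s om) (y s) (y (s - tt))).
    apply: rder_deriv_in H; apply/near0rP; exists (t - s); first by rewrite subr_gt0.
    move=> h /andP[h0 hts] /=; split; first by rewrite addr_ge0// ltW.
    by apply: lt_trans tT; rewrite lte_fin -ltrBrDl.
  move=> e e0; have /near0rP[k k0 kP] := H e e0.
  apply/near0rP; exists (Num.min k (t - s)); first by rewrite lt_min k0 subr_gt0.
  move=> h /andP[h0]; rewrite lt_min => /andP[hk hts].
  have rs' : - r%:num <= s by rewrite (le_trans _ s0)// oppr_le0 ge0.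
  rewrite !y1E; last 2 first.
  + by rewrite rs' ltW.
  + by rewrite (le_trans rs') ?lerDl ?(ltW h0)//= -lerBrDl ltW.
  by apply: kP; rewrite h0.
- by move=> s /andP[s0 _]; apply: deriv_half_rder (dY _ s0).
Qed.

(** A global solution is maximal, so the choice in [maxsol] is not the default. Whatever maximal
    pair is chosen agrees with [y] by uniqueness, and its maximality against the extension [y]
    forces an infinite lifetime. *)
Lemma maxsol_gsol om (x : W) y : gsol om y -> segC r y 0 = x ->
  lifetime sigma F tau om x = +oo%E /\
  forall t, - r%:num <= t -> solution sigma F tau t om x = y t.
Proof.
move=> gy y0; rewrite /lifetime /solution.
have : is_maximal_solution sigma F tau om x (maxsol sigma F tau om x).1 (maxsol sigma F tau om x).2.
  apply: (@xgetPex _ _ [set Ty | is_maximal_solution sigma F tau om x Ty.1 Ty.2]).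
  exists (+oo%E, y); split; first exact: gsol_solution.
  by move=> T' y' /=; rewrite leye_eq => /eqP.
case: (maxsol _ _ _ _ _) => T z /= [sz mz].
have zy := is_solution_unique sz gy y0.
have TE : +oo%E = T.
  apply: mz (gsol_solution gy y0) _; first exact: leey.
  by move=> t rt tT; rewrite zy.
by split=> // t rt; apply: zy => //; rewrite -TE ltry.
Qed.

(** The default of [maxsol] has lifetime 0, so an infinite lifetime certifies that a maximal
    solution was really chosen. *)
Lemma lifetime_gsol om (x : W) : lifetime sigma F tau om x = +oo%E ->
  exists y, [/\ gsol om y, segC r y 0 = x &
    forall t, - r%:num <= t -> solution sigma F tau t om x = y t].
Proof.
rewrite /lifetime /solution /maxsol => lT.
have [[Ty mTy]|nT] := pselect (exists Ty,
    [set Ty | is_maximal_solution sigma F tau om x Ty.1 Ty.2] Ty).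
  have [+ _] := @xgetPex _ (0%E, cst 0) _ (ex_intro _ Ty mTy).
  by rewrite lT => /solution_gsol.
exfalso; move: lT; rewrite xgetPN => //= Ty mTy; apply: nT; by exists Ty.
Qed.

Lemma solution_segE om (x : W) y t : gsol om y -> segC r y 0 = x -> 0 <= t ->
  wfun (solution_seg sigma F tau t om x) = segC r y t.
Proof.
move=> gy y0 t0; have [_ sE] := maxsol_gsol gy y0.
have [cy _] := gy; have [N N0 yN] := gsol_lip t gy (ex_intro _ x y0).
have rt : - r%:num <= t - r%:num by rewrite lerDr.
rewrite /solution_seg -(@segWE _ _ _ y t N)//; last first.
  by move=> u v u1 uv v1; apply: yN => //; exact: le_trans u1.
by rewrite /segW; congr (wfun (insubd _ _)); apply: segC_eq => s /andP[s1 _]; rewrite sE// (le_trans rt).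
Qed.

Lemma gsol_shift om y s : 0 <= s -> gsol om y -> gsol (sigma s om) (fun t => y (s + t)).
Proof.
move=> s0 [cy dy]; split.
  move=> t; apply: (@continuous_comp _ _ _ (fun t => s + t) y); last exact: cy.
  by apply: cvgD; [exact: cvg_cst|exact: cvg_id].
have [_ _ sD] := hsigma.
move=> t t0; rewrite -sD (addrC t) segC_shift.
apply: is_deriv_in_sub (is_deriv_in_shift (dy (s + t) (addr_ge0 s0 t0))).
by move=> u /= u0; rewrite addr_ge0.
Qed.

End solutions.

(** * Truncation and global existence *)

Section truncation.
Context {R : realType} {n : nat}.
Local Notation V := 'rV[R]_n.

Lemma rV_norm_leP (v : V) (M : R) : 0 <= M -> (`|v| <= M) <-> (forall j, `|v ord0 j| <= M).
Proof.
move=> M0; split=> [vM j|H].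
  apply: le_trans vM; rewrite [leRHS]/Num.Def.normr/= mx_normrE.
  exact: (le_bigmax _ (fun ij => `|v ij.1 ij.2|) (ord0, j)).
rewrite [leLHS]/Num.Def.normr/= mx_normrE; apply: bigmax_le => // -[i j] _ /=.
by rewrite (ord1 i).
Qed.

(** Clipping coordinate by coordinate fits the max norm: the map is 1-Lipschitz and is the identity
    on the ball of radius [M]. *)
Definition trunc (M : R) (v : V) : V := \row_j Num.max (- M) (Num.min (v ord0 j) M).

Lemma trunc_le M v : 0 <= M -> `|trunc M v| <= M.
Proof.
move=> M0; apply/rV_norm_leP => // j; rewrite mxE ler_norml.
by rewrite le_max lexx ge_max ge_min lexx orbT andbT/= ge0_cp.
Qed.

Lemma trunc_id M v : `|v| <= M -> trunc M v = v.
Proof.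
move=> vM; have M0 : 0 <= M by exact: le_trans vM.
have /rV_norm_leP H := vM; apply/rowP => j; rewrite mxE.
have := H M0 j; rewrite ler_norml => /andP[H1 H2].
by rewrite (min_idPl H2) (max_idPr H1).
Qed.

Lemma trunc_lip M v w : `|trunc M v - trunc M w| <= `|v - w|.
Proof.
apply/rV_norm_leP => // j; rewrite !mxE.
have /rV_norm_leP : `|v - w| <= `|v - w| by [].
move=> /(_ (normr_ge0 _) j); apply: le_trans; rewrite !mxE.
set a := v _ _; set b := w _ _; rewrite /Num.max /Num.min.
have := ler_norm (a - b); have := ler_norm (b - a); rewrite (distrC b a).
by case: (ltP a M) => ?; case: (ltP b M) => ?;
  do 2?[case: (ltP (- M) _) => ?]; rewrite ler_norml; move=> *; apply/andP; split; lra.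
Qed.

Lemma trunc_continuous M : continuous (trunc M).
Proof.
move=> v; have Fv : Filter (nbhs v) by exact: nbhs_filter.
apply/cvgrPdist_le => e e0.
have /cvgrPdist_le /(_ _ e0) : w @[w --> v] --> v by exact: cvg_id.
by apply: filterS => w; apply: le_trans; exact: trunc_lip.
Qed.

End truncation.

Section truncated_solutions.
Context {R : realType} {Om : metricType R} {r : {posnum R}} {n : nat}.
Local Notation V := 'rV[R]_n.
Local Notation C := (CSpace r n).
Local Notation W := (WSpace r n).
Local Notation half := ([set s : R | 0 <= s]).
Variables (sigma : R -> Om -> Om) (F : Om -> V -> V -> V) (tau : Om -> C -> R).
Hypothesis Om_compact : compact [set: Om].
Hypotheses (hsigma : is_flow sigma) (htau : forall om x, 0 <= tau om x <= r%:num).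
Hypotheses (hF : H1 F) (hT : H2star tau).
Local Notation f := (vfield F tau).

Lemma vfield_bounded (M : R) : exists2 N, 0 <= N & forall om (x : C), `|x| <= M -> `|f (om, x)| <= N.
Proof.
pose S : set (Om * V * V) := ([set: Om] `*` [set v : V | `|v| <= M]) `*` [set v : V | `|v| <= M].
have cS : compact S.
  by do 2![apply: compact_setX; last exact: norm_ball_compact].
have [cF _ _ _ _] := hF.
have [|N N0 HN] := @compact_locally_bounded R _ S (fun p => `|F p.1.1 p.1.2 p.2|) cS.
  move=> p _; exists (`|F p.1.1 p.1.2 p.2| + 1).
  have : `|F q.1.1 q.1.2 q.2| @[q --> p] --> `|F p.1.1 p.1.2 p.2| by apply: cvg_norm; exact: cF.
  by move=> /cvgr_le; apply; rewrite ltrDl.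
exists N => // om x xM; apply: (HN (om, x 0, x (- tau om x))).
by split; [split=> //|]; apply: le_trans xM; exact: CSpace_le_norm.
Qed.

(* With its argument truncated at norm M the equation has global solutions; those
   that stay in the ball of radius M solve the original one. *)
Definition tsol M om (y : R -> V) := continuous y /\
  forall t, 0 <= t -> is_deriv_in half y t (f (sigma t om, segC r (trunc M \o y) t)).

Lemma trunc_comp_continuous M (y : R -> V) : continuous y -> continuous (trunc M \o y).
Proof.
move=> cy t; apply: (@continuous_comp _ _ _ y (trunc M)); first exact: cy.
exact: trunc_continuous.
Qed.

Lemma trunc_comp_norm M (y : R -> V) t : 0 <= M -> continuous y ->
  `|segC r (trunc M \o y) t| <= M.
Proof.
move=> M0 cy; apply: segC_norm_le; first exact: trunc_comp_continuous.
by move=> s _; exact: trunc_le.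
Qed.

Lemma tsol_exists M om (x : W) : 0 <= M -> exists y, tsol M om y /\ segC r y 0 = x.
Proof.
move=> M0.
have [Nx Nx0 xL] := WSpace_lip x.
have [Nf Nf0 fN] := vfield_bounded M.
have N0 : 0 <= Nx + Nf by exact: addr_ge0.
have [c c1 Hc] := vfield_lipschitz Om_compact hF hT M N0.
(* The truncated field is bounded by [Nf], so the iterates keep the Lipschitz constant [Nx + Nf]; on
   this class [vfield_lipschitz] provides the constant that [picard] needs. *)
pose X (y : R -> V) := [/\ continuous y, forall t, t <= 0 -> y t = x t &
  forall u v, u <= v -> `|y v - y u| <= (Nx + Nf) * (v - u)].
pose G t (y : R -> V) := f (sigma t om, segC r (trunc M \o y) t).
have xmin (t : R) : 0 <= t -> x t = x 0.
  by move=> t0; rewrite -(CSpace_clamp x t) /clamp (min_idPr t0) (max_idPr _)// oppr_le0.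
have Gb y t : continuous y -> `|G t y| <= Nf.
  by move=> cy; apply: fN; exact: trunc_comp_norm.
have [||||||||||y [[cy yx yl] _ dy]] := @picard R n r%:num c Nf x G X.
- by [].
- by [].
- exact: xmin.
- split=> //; first exact: CSpace_continuous.
  move=> u v uv; rewrite (le_trans (xL v u))// ger0_norm ?subr_ge0//.
  by rewrite ler_wpM2r ?subr_ge0// lerDl.
- by move=> y [].
- move=> y [cy _ _] t; apply: (@continuous_comp _ _ _ (fun t : R => Num.max t 0) (fun t => G t y)).
    by apply: (@continuous_max R R idfun (cst 0)); [exact: cvg_id|exact: cvg_cst].
  by apply: (vfield_along_continuous hsigma hF hT); exact: trunc_comp_continuous.
- move=> y Y [cy _ _] cY Yx dY; split=> // u v uv.
  apply: (@lip_glue _ _ Y u 0 v) => // a b ua ab bv.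
    have a0 : a <= 0 by exact: le_trans bv.
    rewrite !Yx//; rewrite (le_trans (xL b a))// ger0_norm ?subr_ge0//.
    by rewrite ler_wpM2r ?subr_ge0// lerDl.
  apply: (@le_trans _ _ (Nf * (b - a))); last by rewrite ler_wpM2r ?subr_ge0// lerDr.
  apply: (@deriv_bounded_lip _ _ Y 0 v) => // t /andP[t0 _].
  by exists (G t y); [exact: deriv_half_rder (dY t t0)|exact: Gb].
- move=> u y Xu uy cy; split=> //.
    move=> t t0; apply: (@cvg_unique _ (@norm_hausdorff _ _) (u k t @[k --> \oo])); first exact: uy.
    rewrite (_ : (fun k => u k t) = (fun=> x t)); first exact: cvg_cst.
    by apply/funext => k; have [_ ->] := Xu k.
  move=> a b ab; apply: (@cvgr_to_le _ \oo _ _ (fun k => `|u k b - u k a|)).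
    by apply: cvg_norm; apply: cvgB; exact: uy.
  by apply: nearW => k; have [_ _] := Xu k; apply.
- move=> y1 y2 t m [c1' _ _] [c2' _ l2] t0 Hm.
  apply: (le_trans (Hc _ _ _ _ _ _)).
  + exact: trunc_comp_norm.
  + exact: trunc_comp_norm.
  + apply: segC_lip => //; first exact: trunc_comp_continuous.
    by move=> u v _ uv _; apply: (le_trans (trunc_lip _ _ _)); exact: l2.
  + rewrite ler_wpM2l ?(le_trans ler01)//; apply: segC_le; [exact: trunc_comp_continuous..|].
    by move=> s st; apply: (le_trans (trunc_lip _ _ _)); exact: Hm.
- by move=> t t0; apply: Gb; exact: CSpace_continuous.
exists y; split=> //; apply: CSpace_ext => s /andP[rs s0].
by rewrite segC_val ?rs// add0r yx.
Qed.

Lemma tsol_shift M om y s : 0 <= s -> tsol M om y -> tsol M (sigma s om) (fun t => y (s + t)).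
Proof.
move=> s0 [cy dy]; split.
  move=> t; apply: (@continuous_comp _ _ _ (fun t => s + t) y); last exact: cy.
  by apply: cvgD; [exact: cvg_cst|exact: cvg_id].
have [_ _ sD] := hsigma.
move=> t t0; rewrite -sD (addrC t).
rewrite (_ : trunc M \o (fun t => y (s + t)) = fun t => (trunc M \o y) (s + t))// segC_shift.
apply: is_deriv_in_sub (is_deriv_in_shift (dy (s + t) (addr_ge0 s0 t0))).
by move=> u /= u0; rewrite addr_ge0.
Qed.

Lemma tsol_gsol M om y : tsol M om y -> (forall t, - r%:num <= t -> `|y t| <= M) ->
  gsol sigma F tau om y.
Proof.
move=> [cy dy] yM; split=> // t t0; have := dy t t0.
rewrite (@segC_eq _ _ _ (trunc M \o y) y)// => s /andP[s1 _] /=; apply: trunc_id.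
by apply: yM; rewrite (le_trans _ s1)// lerDr.
Qed.

End truncated_solutions.

(** * Orbits in K *)

Section orbits.
Context {R : realType} {Om : metricType R} {r : {posnum R}} {n : nat}.
Local Notation V := 'rV[R]_n.
Local Notation C := (CSpace r n).
Local Notation W := (WSpace r n).
Local Notation J := (`[- r%:num, 0]%classic).
Variables (sigma : R -> Om -> Om) (F : Om -> V -> V -> V) (tau : Om -> C -> R).
Hypothesis Om_compact : compact [set: Om].
Hypotheses (hsigma : is_flow sigma) (htau : forall om x, 0 <= tau om x <= r%:num).
Hypotheses (hF : H1 F) (hT : H2star tau).
Variable K : set (Om * W).
Hypotheses (K_inv : positively_invariant sigma F tau K) (K_compact : compact K).
Hypothesis K_back : forall p, K p -> admits_backward_extension sigma F tau K p.
Local Notation f := (vfield F tau).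
Local Notation Pi := (skew_product sigma F tau).

(** K is compact for the norm of W, but segments move continuously in time in general only for the
    norm of C, so limits are taken after forgetting to C. *)
Definition embed (p : Om * W) : Om * C := (p.1, wfun p.2).

Lemma embed_continuous : continuous embed.
Proof.
move=> p.
have c1 : fst q @[q --> p] --> p.1 by exact: cvg_fst.
have cs : snd q @[q --> p] --> p.2 by exact: cvg_snd.
have c2 : (@wfun R r n \o snd) q @[q --> p] --> (wfun p.2 : C).
  exact: (cvg_comp _ _ cs (@wfun_continuous R r n p.2)).
exact: (cvg_pair c1 c2).
Qed.

Lemma embed_inj : injective embed.
Proof. by move=> [a x] [b y] [-> /val_inj ->]. Qed.

Lemma embed_compact : compact (embed @` K).
Proof. by apply: continuous_compact => //; apply: continuous_subspaceT; exact: embed_continuous. Qed.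

Definition orb (p : Om * W) : R -> V :=
  xget (cst 0) [set y | gsol sigma F tau p.1 y /\ segC r y 0 = wfun p.2].

Lemma orbP p : K p -> gsol sigma F tau p.1 (orb p) /\ segC r (orb p) 0 = wfun p.2.
Proof.
move=> Kp; apply: (@xgetPex _ _ [set y | gsol sigma F tau p.1 y /\ segC r y 0 = wfun p.2]).
have [lp _] := K_inv Kp.
by have [y [gy y0 _]] := lifetime_gsol htau lp; exists y.
Qed.

Lemma orb_continuous p : K p -> continuous (orb p).
Proof. by move=> /orbP[[]]. Qed.

Lemma solution_orb p t : K p -> - r%:num <= t -> solution sigma F tau t p.1 p.2 = orb p t.
Proof.
move=> /orbP[gp p0] rt.
by have [_] := maxsol_gsol Om_compact hsigma htau hF hT gp p0; apply.
Qed.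

Lemma embed_Pi p t : K p -> 0 <= t -> embed (Pi t p) = (sigma t p.1, segC r (orb p) t).
Proof.
move=> /orbP[gp p0] t0; rewrite /embed /skew_product /=.
by rewrite (solution_segE Om_compact hsigma htau hF hT gp p0 t0).
Qed.

Lemma wfun_Pi p t : K p -> 0 <= t -> wfun (Pi t p).2 = segC r (orb p) t.
Proof. by move=> Kp t0; have /(congr1 snd) := embed_Pi Kp t0. Qed.

Lemma K_Pi p t : K p -> 0 <= t -> K (Pi t p).
Proof. by move=> Kp t0; have [_] := K_inv Kp; apply. Qed.

Lemma orb_Pi p s t : K p -> 0 <= s -> - r%:num <= t -> orb (Pi s p) t = orb p (s + t).
Proof.
move=> Kp s0 rt; have KPp := K_Pi Kp s0.
have [gp p0] := orbP Kp; rewrite -solution_orb//.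
have e0 : segC r (fun t => orb p (s + t)) 0 = wfun (Pi s p).2.
  by rewrite segC_shift addr0 wfun_Pi.
have [_ sE] := maxsol_gsol Om_compact hsigma htau hF hT (gsol_shift hsigma s0 gp) e0.
exact: sE.
Qed.

Lemma Pi_Pi p s t : K p -> 0 <= s -> 0 <= t -> Pi t (Pi s p) = Pi (s + t) p.
Proof.
move=> Kp s0 t0; have KPp := K_Pi Kp s0; have [_ _ sD] := hsigma.
apply: embed_inj; rewrite !embed_Pi// ?addr_ge0//=; congr pair.
  by rewrite -sD addrC.
rewrite -segC_shift; apply: segC_eq => u /andP[u1 _]; apply: orb_Pi => //.
by rewrite (le_trans _ u1)// lerDr.
Qed.

Lemma Pi0 p : K p -> Pi 0 p = p.
Proof.
move=> Kp; have [_ s0 _] := hsigma; have [_ p0] := orbP Kp.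
by apply: embed_inj; rewrite embed_Pi// s0 p0.
Qed.

Lemma orb_rder p t : K p -> 0 <= t -> rder (orb p) t (f (embed (Pi t p))).
Proof.
move=> Kp t0; have [[_ dp] _] := orbP Kp.
by rewrite embed_Pi//; apply: deriv_half_rder => //; exact: dp.
Qed.

Lemma K_bounded : exists2 M, 0 <= M & forall p, K p -> `|wfun p.2| <= M.
Proof.
apply: (compact_locally_bounded K_compact) => p _; exists (`|wfun p.2| + 1).
have : `|(embed q).2| @[q --> p] --> `|(embed p).2|.
  apply: cvg_norm; apply: (@cvg_comp _ _ _ embed snd _ (nbhs (embed p))); first exact: embed_continuous.
  exact: cvg_snd.
by move=> /cvgr_le; apply; rewrite ltrDl.
Qed.

Lemma orb_bounded p t M : K p -> (forall p, K p -> `|wfun p.2| <= M) -> - r%:num <= t ->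
  `|orb p t| <= M.
Proof.
move=> Kp HM rt; have [t0|/ltW t0] := leP t 0.
  have [[cp _] p0] := orbP Kp; rewrite (segC_segC cp p0) ?rt//.
  exact: le_trans (CSpace_le_norm _ _) (HM _ Kp).
have [_ p0] := orbP (K_Pi Kp t0).
have r0 : - r%:num <= 0 by rewrite oppr_le0 ge0.
rewrite -[t]addr0 -(orb_Pi Kp t0 r0).
have [[cp _] p0'] := orbP (K_Pi Kp t0); rewrite (segC_segC cp p0') ?oppr_le0 ?ge0 ?lexx//.
exact: le_trans (CSpace_le_norm _ _) (HM _ (K_Pi Kp t0)).
Qed.

Lemma K_vfield_bounded : exists2 N, 0 <= N & forall p, K p -> `|f (embed p)| <= N.
Proof.
have [M M0 HM] := K_bounded; have [N N0 HN] := vfield_bounded tau Om_compact hF M.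
by exists N => // p Kp; apply: HN; exact: HM.
Qed.

(** The form in which backward extensions are used: the segment in [p] is the orbit of [q] over
    [[0, r]], where the equation holds. *)
Lemma K_backward p : K p -> exists2 q, K q & Pi r%:num q = p.
Proof.
move=> Kp; have [th [_ Kth th0 H]] := K_back Kp.
exists (th (- r%:num)); first by apply: Kth; rewrite oppr_le0.
by rewrite H ?lexx ?oppr_le0// subrr.
Qed.

Lemma orb_lip_half N p : (forall p, K p -> `|f (embed p)| <= N) -> K p ->
  forall u v, 0 <= u -> u <= v -> `|orb p v - orb p u| <= N * (v - u).
Proof.
move=> HN Kp u v u0 uv.
apply: (@deriv_bounded_lip _ _ (orb p) 0 v) => //; first exact: orb_continuous.
move=> t /andP[t0 _]; exists (f (embed (Pi t p))); first exact: orb_rder.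
by apply: HN; exact: K_Pi.
Qed.

(** Going back by time [r] moves [[-r, oo)] into [[0, oo)], so the bound on the field also controls
    the initial segment, with one constant for all of K. *)
Lemma orb_lip N p : (forall p, K p -> `|f (embed p)| <= N) -> K p ->
  forall u v, - r%:num <= u -> u <= v -> `|orb p v - orb p u| <= N * (v - u).
Proof.
move=> HN Kp u v ru uv; have [q Kq <-] := K_backward Kp.
rewrite !orb_Pi// ?(le_trans ru)//.
apply: (le_trans (orb_lip_half HN Kq _ _)); rewrite ?lerD2l//.
  by rewrite -lerBlDl sub0r.
by rewrite opprD addrACA subrr add0r.
Qed.

Lemma K_lip N p : 0 <= N -> (forall p, K p -> `|f (embed p)| <= N) -> K p ->
  forall s t : R, `|p.2 s - p.2 t| <= N * `|s - t|.
Proof.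
move=> N0 HN Kp s t; have [_ <-] := orbP Kp.
apply: segC_lip => //; first exact: orb_continuous.
by move=> u v u1 uv _; apply: orb_lip => //; rewrite sub0r in u1.
Qed.

Lemma is_deriv_in_J q s : K q -> - r%:num <= s <= 0 ->
  is_deriv_in J (Pi r%:num q).2 s (f (embed (Pi (r%:num + s) q))).
Proof.
move=> Kq /andP[rs s0]; have r0 : 0 <= r%:num by [].
have rs0 : 0 <= r%:num + s by rewrite -lerBlDl sub0r.
have [[cq dq] _] := orbP Kq.
have := dq _ rs0; rewrite -embed_Pi// => /is_deriv_in_shift H.
rewrite wfun_Pi//.
apply: (@is_deriv_in_eq _ _ _ (fun t => orb q (r%:num + t))) => //.
- by move=> t /=; rewrite in_itv/= => tJ; rewrite segC_val.
- by rewrite /= in_itv/= rs.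
apply: is_deriv_in_sub H => t /=; rewrite in_itv/= => /andP[rt _].
by rewrite -lerBlDl sub0r.
Qed.

(** As [r > 0], every point of [[-r, 0]] has other points of the interval arbitrarily near, on the
    left except at -r; this makes the limit in [deriv_in] unique, endpoints included. *)
Lemma J_proper s : - r%:num <= s <= 0 -> ProperFilter (within [set h | J (s + h)] 0^').
Proof.
move=> /andP[rs s0]; apply: Build_ProperFilter_ex => A [e /= e0 eA].
have r0 : 0 < r%:num by [].
have [rs'|rs'] := ltP (- r%:num) s.
  exists (- Num.min (e / 2) (s + r%:num)).
  have m0 : 0 < Num.min (e / 2) (s + r%:num) by rewrite lt_min divr_gt0//= -ltrBlDr sub0r.
  apply: eA => /=.
  - rewrite sub0r opprK gtr0_norm// gt_min ltr_pdivrMr// ltr_pMr//.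
    by rewrite ltr1n.
  - by rewrite oppr_eq0 gt_eqF.
  - rewrite in_itv/=; apply/andP; split; last by rewrite subr_le0 (le_trans s0)// ltW.
    have : Num.min (e / 2) (s + r%:num) <= s + r%:num by rewrite ge_min lexx orbT.
    by lra.
have sE : s = - r%:num by apply/eqP; rewrite eq_le rs' rs.
exists (Num.min (e / 2) r%:num).
have m0 : 0 < Num.min (e / 2) r%:num by rewrite lt_min divr_gt0//=.
apply: eA => /=.
- rewrite sub0r normrN gtr0_norm// gt_min ltr_pdivrMr// ltr_pMr//.
  by rewrite ltr1n.
- by rewrite gt_eqF.
- rewrite in_itv/= sE lerDl (ltW m0)/= addrC subr_le0.
  by rewrite ge_min lexx orbT.
Qed.

Lemma deriv_in_J q s : K q -> - r%:num <= s <= 0 ->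
  deriv_in J (Pi r%:num q).2 s = f (embed (Pi (r%:num + s) q)).
Proof. by move=> Kq sJ; apply: (deriv_inE (J_proper sJ)); exact: is_deriv_in_J. Qed.

Lemma K_deriv_bounded N p s : (forall p, K p -> `|f (embed p)| <= N) -> K p ->
  - r%:num <= s <= 0 -> `|deriv_in J p.2 s| <= N.
Proof.
move=> HN Kp sJ; have [q Kq <-] := K_backward Kp.
rewrite deriv_in_J//; apply: HN; apply: K_Pi => //.
by case/andP: sJ => rs _; rewrite -lerBlDl sub0r.
Qed.

Lemma flow_uniform e : 0 < e -> exists2 k, 0 < k & forall om h, 0 <= h < k -> ball om e (sigma h om).
Proof.
move=> e0; have [cs s0 _] := hsigma.
have /compact_near_coveringP cO := Om_compact.
have : \forall k \near 0^'+, [set: Om] `<=` [set om | forall h, 0 <= h < k -> ball om e (sigma h om)].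
  apply: cO => om _; have e2 : 0 < e / 2 by rewrite divr_gt0.
  have : nbhs (sigma 0 om) (ball om (e / 2)) by rewrite s0; exact: nbhsx_ballx.
  move=> /(cs (0, om))[[A B] /= [nA nB] AB].
  have /nbhs_ballP[k /= k0 kA] := nA.
  exists (B `&` ball om (e / 2), [set h | h < k]).
    split; last exact: nbhs_right_lt.
    by apply: filterI => //; exact: nbhsx_ballx.
  move=> [om' k'] /= [[Bo oo'] k'k] h /andP[h0 hk'].
  rewrite (splitr e); apply: (ball_triangle (y := om)); first exact: ball_sym.
  apply: (AB (h, om')); split=> //=; apply: kA.
  by rewrite /ball/= sub0r normrN ger0_norm// (lt_trans hk').
move=> /near0rP[k k0 kP]; exists (k / 2); first by rewrite divr_gt0.
move=> om h hk; apply: (kP (k / 2)) => //.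
by rewrite divr_gt0//= ltr_pdivrMr// ltr_pMr// ltr1n.
Qed.

(** [f] is uniformly continuous at the compact image of K in Omega x C, and in a short time points
    of that image move little: the base by [flow_uniform], the segment by the common Lipschitz
    constant. *)
Lemma orbit_derivative_uniform e : 0 < e -> exists2 k, 0 < k &
  forall q s t, K q -> 0 <= s -> s <= t -> t < s + k ->
    `|f (embed (Pi t q)) - f (embed (Pi s q))| <= e.
Proof.
move=> e0; have [N N0 HN] := K_vfield_bounded.
have [k k0 kP] := @compact_uniform _ _ (embed @` K) (fun p q => `|f q - f p|) embed_compact
  (fun p q s => le_trans (ler_distD (f q) (f s) (f p)) (eq_ind _ (fun z => _ <= z) (lexx _) _ (addrC _ _)))
  (fun p q => distrC (f q) (f p))
  (fun p _ => eq_ind _ (fun z => _ --> z)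
    (cvg_norm (cvgB (vfield_continuous hF hT (x := p)) (cvg_cst (f p)))) _
    (etrans (congr1 Num.norm (subrr (f p))) (normr0 _))) e e0.
have [k1 k10 k1P] := flow_uniform k0.
have N1 : 0 < N + 1 by rewrite ltr_wpDl.
exists (Num.min k1 (k / (N + 1))); first by rewrite lt_min k10 divr_gt0.
move=> q s t Kq s0 st; rewrite -ltrBlDl lt_min => /andP[ts1 ts2].
have t0 : 0 <= t by exact: le_trans st.
apply: kP; first by exists (Pi s q) => //; exact: K_Pi.
have -> : t = s + (t - s) by rewrite addrC subrK.
have ts0 : 0 <= t - s by rewrite subr_ge0.
rewrite -Pi_Pi// !embed_Pi//; [|exact: K_Pi..].
split; first by apply: k1P; rewrite ts0.
apply/ball_normP; apply: (@le_lt_trans _ _ (N * (t - s))); last first.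
  by move: ts2; rewrite ltr_pdivlMr// mulrC; apply: le_lt_trans; rewrite ler_wpM2r// lerDl.
have KP := K_Pi Kq s0; rewrite distrC.
have cP := orb_continuous KP; have cq := orb_continuous Kq.
have -> : segC r (orb q) s = segC r (orb (Pi s q)) 0.
  rewrite -[s in segC _ _ s]addr0 -segC_shift; apply: segC_eq => u /andP[ru _].
  by rewrite orb_Pi//; rewrite sub0r in ru.
apply/CSpace_normP => u /andP[ru u0].
change (`|segC r (orb (Pi s q)) (t - s) u - segC r (orb (Pi s q)) 0 u| <= N * (t - s)).
rewrite !segC_val// ?ru// add0r.
apply: (le_trans (orb_lip HN KP _ _)) => //; first by rewrite lerDr.
by rewrite addrK.
Qed.

(** By [deriv_in_J] the derivative of a segment in K is the field along an earlier orbit, so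
    [orbit_derivative_uniform] gives it a common modulus of continuity; the mean value inequality
    for [p.2 t - t *: d0] integrates it. *)
Lemma K_uniformly_differentiable e : 0 < e -> exists2 k, 0 < k & forall p s s', K p ->
  - r%:num <= s <= 0 -> - r%:num <= s' <= 0 -> `|s' - s| < k ->
  `|p.2 s' - p.2 s - (s' - s) *: deriv_in J p.2 s| <= e * `|s' - s|.
Proof.
move=> e0; have [k k0 kP] := orbit_derivative_uniform e0.
exists k => // p s s' Kp sJ sJ' ssk; have [q Kq pE] := K_backward Kp.
pose d0 := deriv_in J p.2 s.
have dE t : - r%:num <= t <= 0 -> `|t - s| < k -> `|deriv_in J p.2 t - d0| <= e.
  move=> tJ tsk; rewrite /d0 -pE !deriv_in_J//.
  have [rt t0] := andP tJ; have [rs s0] := andP sJ.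
  have rs0 : 0 <= r%:num + s by rewrite -lerBlDl sub0r.
  have rt0 : 0 <= r%:num + t by rewrite -lerBlDl sub0r.
  move: tsk; rewrite ltr_norml => /andP[ts1 ts2].
  have [st|/ltW ts] := leP s t.
    by apply: kP; rewrite ?lerD2l// -addrA ltrD2l -ltrBlDl.
  by rewrite distrC; apply: kP; rewrite ?lerD2l// -addrA ltrD2l -ltrBlDl -opprB ltrNl.
have main a b : - r%:num <= a -> a <= b -> b <= 0 -> `|a - s| < k -> `|b - s| < k ->
    `|p.2 b - p.2 a - (b - a) *: d0| <= e * (b - a).
  move=> ra ab b0 ak bk.
  have := @mean_value_const _ _ (fun t => p.2 t - t *: d0) e a b.
  have E (x y z w : V) : x - y - (z - w) = x - z - (y - w) by rewrite !opprD !opprK addrACA.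
  rewrite E -scalerBl; apply => //.
    move=> t; apply: cvgB; first exact: CSpace_continuous.
    by apply: cvgZr_tmp; exact: cvg_id.
  move=> t /andP[at_ tb].
  have tJ : - r%:num <= t <= 0 by rewrite (le_trans ra at_) (le_trans (ltW tb)).
  exists (deriv_in J p.2 t - d0); last first.
    apply: dE => //; move: ak bk; rewrite !ltr_norml => /andP[a1 a2] /andP[b1 b2].
    by apply/andP; split; lra.
  apply: rderB.
    rewrite -pE deriv_in_J//; apply: rder_deriv_in (is_deriv_in_J Kq tJ).
    apply/near0rP; exists (b - t); first by rewrite subr_gt0.
    move=> h /andP[h0 hb] /=; rewrite in_itv/=; apply/andP; split.
      by rewrite (le_trans ra)// (le_trans at_)// lerDl ltW.
    by rewrite (le_trans _ b0)// -lerBrDl ltW.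
  move=> z z0; apply: filterS (nbhs_right_gt 0) => h h0.
  by rewrite scalerDl (addrC (t *: _)) addrK subrr normr0 mulr_ge0// ltW.
have ss0 : `|s - s| < k by rewrite subrr normr0.
have [rs s0] := andP sJ; have [rs' s0'] := andP sJ'.
(* For [s' < s] the estimate runs from [s'] up to [s] while the slope is still taken at [s]; this is
   why [main] keeps [d0] fixed. *)
have [ss|/ltW ss] := leP s s'.
  by rewrite [X in _ * X]ger0_norm ?subr_ge0//; exact: main.
rewrite [X in _ * X]distrC [X in _ * X]ger0_norm ?subr_ge0//.
have := main s' s rs' ss s0 ssk ss0.
have -> : p.2 s' - p.2 s - (s' - s) *: d0 = - (p.2 s - p.2 s' - (s - s') *: d0).
  by rewrite !opprD !opprK -scaleNr opprB (addrC (- p.2 s)).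
by rewrite normrN.
Qed.

End orbits.

(** * The linearized equation *)

Section linear_solutions.
Context {R : realType} {Om : metricType R} {r : {posnum R}} {n : nat}.
Local Notation V := 'rV[R]_n.
Local Notation C := (CSpace r n).
Local Notation W := (WSpace r n).
Local Notation J := (`[- r%:num, 0]%classic).
Variables (sigma : R -> Om -> Om) (F : Om -> V -> V -> V) (tau : Om -> C -> R).
Hypothesis Om_compact : compact [set: Om].
Hypotheses (hsigma : is_flow sigma) (htau : forall om x, 0 <= tau om x <= r%:num).
Hypotheses (hF : H1 F) (hT : H2star tau).
Variable K : set (Om * W).
Hypotheses (K_inv : positively_invariant sigma F tau K) (K_compact : compact K).
Hypothesis K_back : forall p, K p -> admits_backward_extension sigma F tau K p.
Local Notation f := (vfield F tau).
Local Notation Pi := (skew_product sigma F tau).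
Local Notation orb := (@orb R Om r n sigma F tau).
Local Notation L := (linearization F tau).

Let orbP p : K p -> gsol sigma F tau p.1 (orb p) /\ segC r (orb p) 0 = wfun p.2.
Proof. exact: (orbP htau K_inv). Qed.
Let orb_continuous p : K p -> continuous (orb p).
Proof. exact: (orb_continuous htau K_inv). Qed.
Let embed_Pi p t : K p -> 0 <= t -> embed (Pi t p) = (sigma t p.1, segC r (orb p) t).
Proof. exact: (embed_Pi Om_compact hsigma htau hF hT K_inv). Qed.
Let K_Pi p t : K p -> 0 <= t -> K (Pi t p).
Proof. exact: (K_Pi K_inv). Qed.

(** Continuous dependence within K for the C distance. The reference orbit is Lipschitz, so
    [delay_gronwall] applies; moving the base point acts as a forcing term, small uniformly on
    [[0, T]] by compactness. *)
Lemma orb_near q0 T e : K q0 -> 0 < e -> exists2 k, 0 < k & forall q, K q ->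
  ball (embed q0) k (embed q) -> forall t, - r%:num <= t <= T -> `|orb q t - orb q0 t| <= e.
Proof.
move=> Kq0 e0.
have [M M0 HM] := K_bounded K_compact.
have [N N0 HN] := K_vfield_bounded tau Om_compact hF K_compact.
have [c c1 Hc] := vfield_lipschitz Om_compact hF hT M N0.
(* Initial error and forcing are each at most [k1]; Gronwall multiplies their sum by the
   exponential, which gives [e]. *)
pose k1 := e / 2 / expR (c * `|T|).
have k10 : 0 < k1 by rewrite !divr_gt0// expR_gt0.
have cY0 := orb_continuous Kq0.
have [cs _ _] := hsigma.
have : \forall om \near q0.1, forall t, 0 <= t <= T ->
    `|f (sigma t om, segC r (orb q0) t) - f (sigma t q0.1, segC r (orb q0) t)| <= k1.
  have /compact_near_coveringP := @segment_compact R 0 T.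
  move=> /(_ _ (nbhs q0.1) (fun om t => `|f (sigma t om, segC r (orb q0) t)
     - f (sigma t q0.1, segC r (orb q0) t)| <= k1)) H.
  have {}H : \forall om \near q0.1, `[0, T]%classic `<=` (fun t => `|f (sigma t om, segC r (orb q0) t)
     - f (sigma t q0.1, segC r (orb q0) t)| <= k1).
    apply: H => t _.
    have i1 : p.1 @[p --> (t, q0.1)] --> t by exact: cvg_fst.
    have i2 : p.2 @[p --> (t, q0.1)] --> q0.1 by exact: cvg_snd.
    have i3 : sigma p.1 p.2 @[p --> (t, q0.1)] --> sigma t q0.1 := cs (t, q0.1).
    have i4 : sigma p.1 q0.1 @[p --> (t, q0.1)] --> sigma t q0.1.
      by apply: (@cvg_comp _ _ _ fst (sigma ^~ q0.1) _ (nbhs t)) => //; exact: sigma_continuous.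
    have i5 : segC r (orb q0) p.1 @[p --> (t, q0.1)] --> segC r (orb q0) t.
      by apply: (@cvg_comp _ _ _ fst (segC r (orb q0)) _ (nbhs t)) => //; exact: segC_continuous.
    have : `|f (sigma p.1 p.2, segC r (orb q0) p.1) - f (sigma p.1 q0.1, segC r (orb q0) p.1)|
        @[p --> (t, q0.1)] --> `|f (sigma t q0.1, segC r (orb q0) t) - f (sigma t q0.1, segC r (orb q0) t)|.
      by apply: cvg_norm; apply: cvgB; exact: (vfield_cvg hF hT).
    by rewrite subrr normr0 => /cvgr_le/(_ _ k10).
  by apply: filterS H => om H t t0T; apply: H; rewrite /= in_itv.
move=> /nbhs_ballP[k2 /= k20 k2P].
exists (Num.min k1 k2); first by rewrite lt_min k10 k20.
move=> q Kq [/= b1 b2] t /andP[rt tT].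
have cY := orb_continuous Kq.
have [[_ dY] Y0] := orbP Kq; have [[_ dY0] Y00] := orbP Kq0.
have init s : - r%:num <= s <= 0 -> `|orb q s - orb q0 s| <= k1.
  move=> sr; rewrite (segC_segC cY Y0)// (segC_segC cY0 Y00)//.
  apply: (le_trans (CSpace_le_norm (wfun q.2 - wfun q0.2) s)); rewrite distrC ltW//.
  by move/ball_normP : b2; move=> /lt_le_trans; apply; rewrite ge_min lexx.
have k1e : k1 <= e.
  rewrite /k1 ler_pdivrMr ?expR_gt0//; have : 1 <= expR (c * `|T|).
    by rewrite -expR0 ler_expR mulr_ge0// (le_trans ler01).
  by move=> /(ler_wpM2l (ltW e0)); lra.
have [t0|/ltW t0] := leP t 0; first by apply: (le_trans (init t _)); rewrite ?rt.
have : `|orb q t - orb q0 t| <= (k1 + k1) * expR (c * (t - 0)).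
  apply: (@delay_gronwall _ _ (fun t => orb q t - orb q0 t) r%:num 0 T) => //; last by rewrite t0.
  - by move=> s; apply: cvgB; [exact: cY|exact: cY0].
  - exact: ltW.
  - exact: ltW.
  - by move=> s; rewrite sub0r; exact: init.
  move=> s /andP[s0 sT].
  exists (f (sigma s q.1, segC r (orb q) s) - f (sigma s q0.1, segC r (orb q0) s)).
    by apply: rderB; apply: deriv_half_rder => //; [exact: dY|exact: dY0].
  move=> m Hm; rewrite -(subrKA (f (sigma s q.1, segC r (orb q0) s))).
  apply: (le_trans (ler_normD _ _)); apply: lerD; last first.
    apply: k2P; last by rewrite s0 ltW.
    by apply: le_ball b1; rewrite ge_min lexx orbT.
  have rs : - r%:num <= s - r%:num by rewrite lerDr.
  apply: (le_trans (Hc _ _ _ _ _ _)).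
  + have := HM _ (K_Pi Kq s0); have := embed_Pi Kq s0.
    by move=> /(congr1 snd) /= ->.
  + have := HM _ (K_Pi Kq0 s0); have := embed_Pi Kq0 s0.
    by move=> /(congr1 snd) /= ->.
  + apply: segC_lip => // u v u1 uv _.
    apply: (orb_lip Om_compact hsigma htau hF hT K_inv K_back HN Kq0) => //.
    exact: le_trans u1.
  + by rewrite ler_wpM2l ?(le_trans ler01)//; apply: segC_le.
rewrite subr0 => /le_trans; apply.
apply: (@le_trans _ _ ((k1 + k1) * expR (c * `|T|))).
  rewrite ler_wpM2l ?addr_ge0 ?(ltW k10)// ler_expR ler_wpM2l ?(le_trans ler01)//.
  by rewrite (le_trans tT)// ler_norm.
by rewrite -mulr2n -mulr_natl /k1 mulrA divfK ?gt_eqF ?expR_gt0// mulrC divfK.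
Qed.

Lemma embed_Pi_cvg {I : Type} {G : set_system I} {FG : Filter G} (q : I -> Om * W) (s : I -> R)
    (q0 : Om * W) (s0 : R) : K q0 -> 0 <= s0 -> (\forall i \near G, K (q i)) -> (\forall i \near G, 0 <= s i) ->
  embed (q i) @[i --> G] --> embed q0 -> s i @[i --> G] --> s0 ->
  embed (Pi (s i) (q i)) @[i --> G] --> embed (Pi s0 q0).
Proof.
move=> Kq0 s00 Kq sge qq ss; have [cs _ _] := hsigma.
rewrite embed_Pi//.
suff : (sigma (s i) (q i).1, segC r (orb (q i)) (s i)) @[i --> G] -->
    (sigma s0 q0.1, segC r (orb q0) s0).
  apply: cvg_trans; apply: near_eq_cvg; apply: filterS2 Kq sge => i Kqi si0.
  by rewrite -embed_Pi.
have q1 : (q i).1 @[i --> G] --> q0.1.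
  by apply: (@cvg_comp _ _ _ (fun i => embed (q i)) fst _ (nbhs (embed q0))) => //; exact: cvg_fst.
have q2 : (embed (q i)).2 @[i --> G] --> (embed q0).2.
  by apply: (@cvg_comp _ _ _ (fun i => embed (q i)) snd _ (nbhs (embed q0))) => //; exact: cvg_snd.
have i1 : sigma (s i) (q i).1 @[i --> G] --> sigma s0 q0.1.
  apply: (@cvg_comp _ _ _ (fun i => (s i, (q i).1)) (fun p : R * Om => sigma p.1 p.2) _ (nbhs (s0, q0.1))).
    exact: (cvg_pair ss q1).
  exact: (cs (s0, q0.1)).
suff i2 : segC r (orb (q i)) (s i) @[i --> G] --> segC r (orb q0) s0 by exact: (cvg_pair i1 i2).
have cY0 := orb_continuous Kq0.
apply/cvgrPdist_le => e e0; have e2 : 0 < e / 2 by rewrite divr_gt0.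
have [k k0 kP] := orb_near (s0 + 1) Kq0 e2.
have c0 : segC r (orb q0) (s i) @[i --> G] --> segC r (orb q0) s0.
  by apply: (@cvg_comp _ _ _ s (segC r (orb q0)) _ (nbhs s0)) => //; exact: segC_continuous.
move/cvgrPdist_le : c0 => /(_ _ e2) c0.
have qk : \forall i \near G, ball (embed q0) k (embed (q i)).
  have b1 : \forall i \near G, ball q0.1 k (q i).1 by apply: q1; exact: nbhsx_ballx.
  move/cvgrPdist_lt : q2 => /(_ _ k0); apply: filterS2 b1 => i b1 b2.
  by split => //=; apply/ball_normP.
have s1 : \forall i \near G, s i <= s0 + 1 by apply: (cvgr_le _ ss); rewrite ltrDl.
apply: filterS (filterI (filterI qk s1) (filterI c0 (filterI Kq sge))) => i [[bi si1] [ci [Kqi si0]]].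
rewrite -(subrKA (segC r (orb q0) (s i))) (le_trans (ler_normD _ _))// (splitr e) lerD//.
apply: segC_le => //; first exact: orb_continuous.
move=> u /andP[u1 u2]; rewrite distrC; apply: kP => //.
by rewrite (le_trans _ u1) ?lerDr//= (le_trans u2).
Qed.

(* On K the derivative of x at -tau is the vector field at an earlier point of the
   orbit, so a is a continuous function of the point of K. *)
Definition lin_gen (e : Om * C) (a : V) (phi : C) : V :=
  D2F F e.1 (e.2 0) (e.2 (- tau e.1 e.2)) (phi 0)
  + D3F F e.1 (e.2 0) (e.2 (- tau e.1 e.2)) (phi (- tau e.1 e.2))
  - D2tau tau e.1 e.2 phi *: D3F F e.1 (e.2 0) (e.2 (- tau e.1 e.2)) a.

Lemma linE p phi : L p phi = lin_gen (embed p) (deriv_in J p.2 (- tau p.1 p.2)) phi.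
Proof. by case: p. Qed.

Lemma lin_gen_linear e a k phi psi :
  lin_gen e a (k *: phi + psi) = k *: lin_gen e a phi + lin_gen e a psi.
Proof.
rewrite /lin_gen.
have [l2 _] := D2F_blin hF e.1 (e.2 0) (e.2 (- tau e.1 e.2)).
have [l3 _] := D3F_blin hF e.1 (e.2 0) (e.2 (- tau e.1 e.2)).
have [lt _] := D2tau_blin hT e.1 e.2.
change ((k *: phi + psi) 0) with (k *: phi 0 + psi 0).
change ((k *: phi + psi) (- tau e.1 e.2)) with (k *: phi (- tau e.1 e.2) + psi (- tau e.1 e.2)).
rewrite l2 l3 lt.
have E (x x' y y' d : V) (t t' : R) : (k *: x + x') + (k *: y + y') - (k * t + t') *: d =
    k *: (x + y - t *: d) + (x' + y' - t' *: d).
  by rewrite scalerBr scalerDr scalerA scalerDl opprD (addrACA (k *: x)) (addrACA (k *: x + k *: y)).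
exact: E.
Qed.

Lemma linB p phi psi : L p (phi - psi) = L p phi - L p psi.
Proof.
rewrite !linE; set e := embed p; set a := deriv_in _ _ _.
have := lin_gen_linear e a (-1) psi phi.
by rewrite !scaleN1r (addrC (- psi)) (addrC (- lin_gen e a psi)).
Qed.

Lemma linZ p (k : R) phi : L p (k *: phi) = k *: L p phi.
Proof.
rewrite !linE; have := lin_gen_linear (embed p) (deriv_in J p.2 (- tau p.1 p.2)) k phi 0.
have := lin_gen_linear (embed p) (deriv_in J p.2 (- tau p.1 p.2)) (-1) 0 0.
by rewrite scaler0 addr0 scaleN1r addNr addr0 => -> ; rewrite addr0.
Qed.

Lemma lin_gen_cvg {I : Type} {G : set_system I} {FG : Filter G} (w : I -> Om * C) (a : I -> V)
    (phi : I -> C) (w0 : Om * C) (a0 : V) (phi0 : C) : w i @[i --> G] --> w0 -> a i @[i --> G] --> a0 ->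
  phi i @[i --> G] --> phi0 -> lin_gen (w i) (a i) (phi i) @[i --> G] --> lin_gen w0 a0 phi0.
Proof.
move=> ww aa pp; have [_ _ _ c2 c3] := hF; have [[_ _ cT] _ _] := hT.
have w1 : (w i).1 @[i --> G] --> w0.1.
  by apply: (@cvg_comp _ _ _ w fst _ (nbhs w0)) => //; exact: cvg_fst.
have w2 : (w i).2 @[i --> G] --> w0.2.
  by apply: (@cvg_comp _ _ _ w snd _ (nbhs w0)) => //; exact: cvg_snd.
have dd : delay_arg tau ((w i).1, (w i).2) @[i --> G] --> delay_arg tau (w0.1, w0.2).
  exact: (delay_arg_cvg hT).
have p0 : phi i 0 @[i --> G] --> phi0 0 by apply: CSpace_eval_cvg => //; exact: cvg_cst.
have p1 : phi i (- tau (w i).1 (w i).2) @[i --> G] --> phi0 (- tau w0.1 w0.2).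
  by apply: CSpace_eval_cvg => //; apply: cvgN; exact: tau_cvg.
apply: cvgB; last apply: cvgZ.
- by apply: cvgD; [exact: (opnorm_eval_cvg c2 (fun p => D2F_blin hF p.1.1 p.1.2 p.2) dd p0)
    |exact: (opnorm_eval_cvg c3 (fun p => D3F_blin hF p.1.1 p.1.2 p.2) dd p1)].
- exact: (opnorm_eval_cvg cT (fun p => D2tau_blin hT p.1 p.2) ww pp).
- exact: (opnorm_eval_cvg c3 (fun p => D3F_blin hF p.1.1 p.1.2 p.2) dd aa).
Qed.

Lemma lin_bounded : exists2 c, 1 <= c & forall p phi, K p -> `|L p phi| <= c * `|phi|.
Proof.
have [M M0 HM] := K_bounded K_compact.
have [N N0 HN] := K_vfield_bounded tau Om_compact hF K_compact.
have [_ _ _ c2 c3] := hF; have [[_ _ cT] _ _] := hT.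
pose S : set (Om * V * V) := ([set: Om] `*` [set v : V | `|v| <= M]) `*` [set v : V | `|v| <= M].
have cS : compact S.
  by do 2![apply: compact_setX; last exact: norm_ball_compact].
have [m2 m20 B2] := opnorm_bounded c2 (fun p => D2F_blin hF p.1.1 p.1.2 p.2) cS.
have [m3 m30 B3] := opnorm_bounded c3 (fun p => D3F_blin hF p.1.1 p.1.2 p.2) cS.
have [mt mt0 Bt] := opnorm_bounded cT (fun p => D2tau_blin hT p.1 p.2) (embed_compact K_compact).
exists (1 + (m2 + m3 + mt * (m3 * N))); first by rewrite lerDl !addr_ge0// !mulr_ge0.
move=> p phi Kp; rewrite linE /lin_gen /=.
set d := tau p.1 p.2.
have SP : S (p.1, p.2 0, p.2 (- d)).
  by split; [split=> //|]; apply: le_trans (HM p Kp); exact: CSpace_le_norm.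
have D3 := K_deriv_bounded Om_compact hsigma htau hF hT K_inv K_back HN Kp (delay_in htau p.1 p.2).
rewrite mulrDl mul1r ler_wpDl// mulrDl mulrDl.
apply: (le_trans (ler_normB _ _)); apply: lerD.
  apply: (le_trans (ler_normD _ _)); apply: lerD.
    by apply: (le_trans (B2 _ _ SP)); rewrite ler_wpM2l//; exact: CSpace_le_norm.
  by apply: (le_trans (B3 _ _ SP)); rewrite ler_wpM2l//; exact: CSpace_le_norm.
rewrite normrZ mulrAC; apply: ler_pM => //.
  by apply: (Bt (embed p)); exists p.
by apply: (le_trans (B3 _ _ SP)); rewrite ler_wpM2l.
Qed.

Local Notation half := ([set s : R | 0 <= s]).
Let Pi_Pi p s t : K p -> 0 <= s -> 0 <= t -> Pi t (Pi s p) = Pi (s + t) p.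
Proof. exact: (Pi_Pi Om_compact hsigma htau hF hT K_inv). Qed.

(** Lets a tolerance [e / (c + 1)] be chosen without knowing whether [c] is positive. *)
Lemma frac_le (c e : R) : 0 <= c -> 0 <= e -> c * (e / (c + 1)) <= e.
Proof.
move=> c0 e0; rewrite mulrA ler_pdivrMr ?ltr_wpDl//.
by rewrite mulrDr mulr1 mulrC lerDl.
Qed.

(** The delayed increment [x (- d') - xb (- d)] is its linearization plus an error [rho]. Replacing
    [h (- d')] by [h (- d)] costs [l * m * |d' - d|], of order [m^2]; this is where the Lipschitz
    bound on the increment is needed. The other parts of [rho] are the Taylor errors of [xb] and of
    [tau], and [F] adds its own: four terms, each at most [e / 4 * m]. *)
Lemma lin_remainder (l e : R) : 0 <= l -> 0 < e -> exists2 k, 0 < k & forall p (x : C) m,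
  K p -> `|x - wfun p.2| <= m -> m <= k ->
  (forall s t : R, - r%:num <= s <= 0 -> - r%:num <= t <= 0 ->
     `|(x - wfun p.2) s - (x - wfun p.2) t| <= l * m * `|s - t|) ->
  `|f (p.1, x) - f (embed p) - L p (x - wfun p.2)| <= e * m.
Proof.
move=> l0 e0.
have [M M0 HM] := K_bounded K_compact.
have [N N0 HN] := K_vfield_bounded tau Om_compact hF K_compact.
have [T T0 HTau] := tau_lipschitz hT (M + 1).
have [_ _ _ _ c3] := hF.
pose S : set (Om * V * V) := ([set: Om] `*` [set v : V | `|v| <= M]) `*` [set v : V | `|v| <= M].
have cS : compact S.
  by do 2![apply: compact_setX; last exact: norm_ball_compact].
have [m3 m30 B3] := opnorm_bounded c3 (fun p => D3F_blin hF p.1.1 p.1.2 p.2) cS.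
(* Bounds [|x (- d') - xb (- d)| / m]: 1 for the increment at equal times, [N * T] for the shift of
   the delay along [xb]. *)
pose c2 := 1 + N * T.
have c20 : 0 <= c2 by rewrite addr_ge0// mulr_ge0.
have e4 : 0 < e / 4 by rewrite divr_gt0.
have pos c : 0 <= c -> 0 < c + 1 by move=> c0; rewrite ltr_wpDl.
pose e1 := e / 4 / (1 + c2 + 1).
pose e2 := e / 4 / (m3 * T + 1).
pose e3 := e / 4 / (m3 * N + 1).
have e10 : 0 < e1 by rewrite divr_gt0// pos// addr_ge0.
have e20 : 0 < e2 by rewrite divr_gt0// pos// mulr_ge0.
have e30 : 0 < e3 by rewrite divr_gt0// pos// mulr_ge0.
have [k1 k10 P1] := F_uniformly_differentiable Om_compact hF M e10.
have [k2 k20 P2] := K_uniformly_differentiable Om_compact hsigma htau hF hT K_inv K_compact K_back e20.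
have [k3 k30 P3] := tau_uniformly_differentiable hT (embed_compact K_compact) e30.
pose k4 := e / 4 / (m3 * (l * T) + 1).
have k40 : 0 < k4 by rewrite divr_gt0// pos// !mulr_ge0.
(* The entry 1 keeps [x] in the ball of radius [M + 1] where [T] is valid, [k4] tames the quadratic
   term, and the others bring the increments below the thresholds [k1], [k2], [k3]; the halves make
   these bounds strict. *)
pose k := Num.min (Num.min 1 k4) (Num.min (k1 / 2 / (c2 + 1)) (Num.min (k2 / 2 / (T + 1)) (k3 / 2))).
have k0 : 0 < k by rewrite !lt_min ltr01 k40 !divr_gt0 ?pos.
exists k => // p x m Kp xm mk hl.
have m0 : 0 <= m by exact: le_trans xm.
have := mk; rewrite !le_min => /andP[/andP[m1 m4] /andP[mk1 /andP[mk2 mk3]]].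
set om := p.1; set xb := wfun p.2; set h := x - xb.
set d := tau om xb; set d' := tau om x.
set A := D2F F om (xb 0) (xb (- d)); set B := D3F F om (xb 0) (xb (- d)).
set D := deriv_in J p.2 (- d).
have xbM : `|xb| <= M by exact: HM.
have xM : `|x| <= M + 1.
  rewrite -[x](subrK xb) (le_trans (ler_normD _ _))// addrC lerD//.
  exact: le_trans xm m1.
have dd : `|d' - d| <= T * m.
  rewrite (le_trans (HTau om x xb xM _))//; first by rewrite (le_trans xbM)// lerDl.
  by rewrite ler_wpM2l.
have dJ : - r%:num <= - d <= 0 by exact: (delay_in htau).
have dJ' : - r%:num <= - d' <= 0 by exact: (delay_in htau).
have hs s : `|h s| <= m by apply: le_trans xm; exact: CSpace_le_norm.
have DN : `|D| <= N by exact: (K_deriv_bounded Om_compact hsigma htau hF hT K_inv K_back HN Kp dJ).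
have xbl : `|xb (- d') - xb (- d)| <= N * (T * m).
  rewrite (le_trans (K_lip Om_compact hsigma htau hF hT K_inv K_back N0 HN Kp _ _))//.
  by rewrite ler_wpM2l// opprK addrC distrC.
have bb : `|x (- d') - xb (- d)| <= c2 * m.
  rewrite -(subrKA (xb (- d'))) (le_trans (ler_normD _ _))// mulrDl mul1r lerD//.
    exact: (hs (- d')).
  by rewrite -mulrA.
have half_lt (a c kk : R) : 0 <= c -> 0 < kk -> a <= c * m -> m <= kk / 2 / (c + 1) -> a < kk.
  move=> c0 kk0 ac mkk; apply: (le_lt_trans ac).
  apply: (@le_lt_trans _ _ (kk / 2)); last by rewrite ltr_pdivrMr// ltr_pMr// ltr1n.
  apply: (le_trans (ler_wpM2l c0 mkk)); apply: frac_le => //.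
  by rewrite divr_ge0// ltW.
have step1 : `|F om (x 0) (x (- d')) - F om (xb 0) (xb (- d)) - A (x 0 - xb 0) - B (x (- d') - xb (- d))|
    <= e / 4 * m.
  apply: (le_trans (P1 _ _ _ _ _ _ _ _ _)).
  - exact: le_trans (CSpace_le_norm _ _) xbM.
  - exact: le_trans (CSpace_le_norm _ _) xbM.
  - apply: (half_lt _ c2) => //; apply: (le_trans (hs 0)).
    by rewrite ler_peMl// /c2 lerDl mulr_ge0.
  - exact: (half_lt _ c2).
  apply: (@le_trans _ _ (e1 * ((1 + c2) * m))).
    by rewrite ler_wpM2l ?(ltW e10)// mulrDl mul1r lerD//; exact: (hs 0).
  rewrite mulrA ler_wpM2r// mulrC; apply: frac_le; first exact: addr_ge0.
  exact: ltW.
(* Shift inside the increment, Taylor error of the orbit segment at [- d], Taylor error of [tau]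
   times the slope [D]. *)
pose rho := (h (- d') - h (- d)) + (p.2 (- d') - p.2 (- d) - (- d' - - d) *: D)
   + (d - d' + D2tau tau om xb h) *: D.
have rhoE : x (- d') - xb (- d) = h (- d) - D2tau tau om xb h *: D + rho.
  rewrite /rho; change (h (- d')) with (x (- d') - xb (- d')).
  by apply/rowP => j; rewrite !mxE; ring.
have rho_le : `|rho| <= l * T * m * m + e2 * T * m + e3 * N * m.
  apply: (le_trans (ler_normD _ _)); apply: lerD.
    apply: (le_trans (ler_normD _ _)); apply: lerD.
      apply: (le_trans (hl _ _ dJ' dJ)).
      have -> : l * T * m * m = l * m * (T * m) by ring.
      by rewrite ler_wpM2l ?mulr_ge0// opprK addrC distrC.
    have dk2 : `|- d' - - d| < k2.
      rewrite opprK addrC distrC.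
      exact: (half_lt _ T).
    apply: (le_trans (P2 p (- d) (- d') Kp dJ dJ' dk2)).
    by rewrite -mulrA ler_wpM2l ?(ltW e20)// opprK addrC distrC.
  rewrite normrZ mulrAC ler_pM//.
  have -> : d - d' + D2tau tau om xb h = - (d' - d - D2tau tau om xb h).
    by rewrite !opprD !opprK (addrC d).
  rewrite normrN; have hk3 : `|x - xb| < k3.
    apply: (le_lt_trans xm); apply: (le_lt_trans mk3).
    by rewrite ltr_pdivrMr// ltr_pMr// ltr1n.
  apply: (le_trans (P3 om xb x _ hk3)); first by exists p.
  by rewrite ler_wpM2l ?(ltW e30).
have bB : blin B by exact: (D3F_blin hF om (xb 0) (xb (- d))).
have SP : S (om, xb 0, xb (- d)).
  by split; [split=> //|]; apply: le_trans xbM; exact: CSpace_le_norm.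
have Brho : `|B rho| <= 3 * (e / 4 * m).
  apply: (le_trans (B3 _ rho SP)); apply: (le_trans (ler_wpM2l m30 rho_le)).
  have q1 : m3 * (l * T) * k4 <= e / 4 by apply: frac_le; rewrite ?mulr_ge0// ltW.
  have q2 : m3 * T * e2 <= e / 4 by apply: frac_le; rewrite ?mulr_ge0// ltW.
  have q3 : m3 * N * e3 <= e / 4 by apply: frac_le; rewrite ?mulr_ge0// ltW.
  have q1' : m3 * (l * T) * m <= e / 4.
    by apply: le_trans q1; rewrite ler_wpM2l// !mulr_ge0.
  have := ler_wpM2r m0 q1'; have := ler_wpM2r m0 q2; have := ler_wpM2r m0 q3.
  set E := e / 4 * m; lra.
have -> : f (p.1, x) - f (embed p) - L p h =
    (F om (x 0) (x (- d')) - F om (xb 0) (xb (- d)) - A (x 0 - xb 0) - B (x (- d') - xb (- d)))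
    + B rho.
  rewrite linE /lin_gen -/om -/xb -/d -/A -/B -/D rhoE.
  set u := h (- d); set tt := D2tau tau om xb h.
  rewrite (blinD (u - tt *: D) rho bB) (blinB u (tt *: D) bB) (blinZ tt D bB).
  change (h 0) with (x 0 - xb 0).
  by apply/rowP => j; rewrite !mxE; ring.
apply: (le_trans (ler_normD _ _)).
by move: step1 Brho; set E := e / 4 * m; have -> : e * m = 4 * E by [rewrite /E; field]; lra.
Qed.

Definition lsol p (v : C) (z : R -> V) := [/\ continuous z, segC r z 0 = v &
  forall t, 0 <= t -> is_deriv_in half z t (L (Pi t p) (segC r z t))].

(** Shifted by [r], the derivative inside the segment becomes the field at time
    [t + r - tau >= t >= 0] of the orbit of [q], which is continuous in [t] and [q]. *)
Lemma lin_orbit q t phi : K q -> 0 <= t -> L (Pi (t + r%:num) q) phi =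
  lin_gen (embed (Pi (t + r%:num) q))
   (f (embed (Pi (t + r%:num - tau (Pi (t + r%:num) q).1 (Pi (t + r%:num) q).2) q))) phi.
Proof.
move=> Kq t0; rewrite linE.
set d := tau _ _.
have dJ : - r%:num <= - d <= 0 by exact: (delay_in htau).
have rd : 0 <= r%:num - d by case/andP: dJ => dJ _; rewrite -lerBlDl sub0r.
have E := deriv_in_J Om_compact hsigma htau hF hT K_inv (K_Pi Kq t0) dJ.
rewrite Pi_Pi// Pi_Pi// addrA in E.
by rewrite E.
Qed.

Lemma lin_orbit_cvg {I : Type} {G : set_system I} {FG : Filter G} (q : I -> Om * W) (s : I -> R)
    (phi : I -> C) (q0 : Om * W) (s0 : R) (phi0 : C) : K q0 -> 0 <= s0 ->
  (\forall i \near G, K (q i)) -> (\forall i \near G, 0 <= s i) ->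
  embed (q i) @[i --> G] --> embed q0 -> s i @[i --> G] --> s0 ->
  phi i @[i --> G] --> phi0 ->
  L (Pi (s i + r%:num) (q i)) (phi i) @[i --> G] --> L (Pi (s0 + r%:num) q0) phi0.
Proof.
move=> Kq0 s00 Kq sge qq ss pp; rewrite lin_orbit//.
have sr : s i + r%:num @[i --> G] --> s0 + r%:num by apply: cvgD => //; exact: cvg_cst.
have srge : \forall i \near G, 0 <= s i + r%:num.
  by apply: filterS sge => i si; rewrite addr_ge0.
have PP : embed (Pi (s i + r%:num) (q i)) @[i --> G] --> embed (Pi (s0 + r%:num) q0).
  by apply: embed_Pi_cvg; rewrite ?addr_ge0.
pose w i := embed (Pi (s i + r%:num) (q i)).
pose w0 := embed (Pi (s0 + r%:num) q0).
have w1 : (w i).1 @[i --> G] --> w0.1.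
  by apply: (@cvg_comp _ _ _ w fst _ (nbhs w0)) => //; exact: cvg_fst.
have w2 : (w i).2 @[i --> G] --> w0.2.
  by apply: (@cvg_comp _ _ _ w snd _ (nbhs w0)) => //; exact: cvg_snd.
have tt : tau (w i).1 (w i).2 @[i --> G] --> tau w0.1 w0.2 by exact: (tau_cvg hT).
have aa : f (embed (Pi (s i + r%:num - tau (w i).1 (w i).2) (q i))) @[i --> G] -->
    f (embed (Pi (s0 + r%:num - tau w0.1 w0.2) q0)).
  apply: (@cvg_comp _ _ _ (fun i => embed (Pi (s i + r%:num - tau (w i).1 (w i).2) (q i))) f
    _ (nbhs (embed (Pi (s0 + r%:num - tau w0.1 w0.2) q0)))); last exact: (vfield_continuous hF hT).
  apply: embed_Pi_cvg => //.
  - have /andP[_ tr] := htau w0.1 w0.2; lra.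
  - apply: filterS sge => i si; have /andP[_ tr] := htau (w i).1 (w i).2; lra.
  - exact: (cvgB sr tt).
suff : lin_gen (w i) (f (embed (Pi (s i + r%:num - tau (w i).1 (w i).2) (q i)))) (phi i)
    @[i --> G] --> lin_gen w0 (f (embed (Pi (s0 + r%:num - tau w0.1 w0.2) q0))) phi0.
  apply: cvg_trans; apply: near_eq_cvg; apply: filterS2 Kq sge => i Kqi si.
  by rewrite lin_orbit.
exact: lin_gen_cvg.
Qed.

(** Base points are written as [Pi r q], so that convergence of [q] in Omega x C is enough for
    continuity; by [K_backward] every point of K has this form. *)
Lemma lin_shift_cvg {I : Type} {G : set_system I} {FG : Filter G} (q : I -> Om * W) (s : I -> R)
    (phi : I -> C) (q0 : Om * W) (s0 : R) (phi0 : C) : K q0 -> 0 <= s0 ->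
  (\forall i \near G, K (q i)) -> (\forall i \near G, 0 <= s i) ->
  embed (q i) @[i --> G] --> embed q0 -> s i @[i --> G] --> s0 ->
  phi i @[i --> G] --> phi0 ->
  L (Pi (s i) (Pi r%:num (q i))) (phi i) @[i --> G] --> L (Pi s0 (Pi r%:num q0)) phi0.
Proof.
move=> Kq0 s00 Kq sge qq ss pp.
have E q' s' : K q' -> 0 <= s' -> Pi s' (Pi r%:num q') = Pi (s' + r%:num) q'.
  by move=> Kq' s0'; rewrite Pi_Pi// (addrC s').
rewrite (E _ _ Kq0 s00).
apply: cvg_trans (lin_orbit_cvg Kq0 s00 Kq sge qq ss pp); apply: near_eq_cvg.
by apply: filterS2 Kq sge => i Kqi si; rewrite (E _ _ Kqi si).
Qed.

Lemma lin_along_continuous p z : K p -> continuous z ->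
  continuous (fun t : R => L (Pi (Num.max t 0) p) (segC r z (Num.max t 0))).
Proof.
move=> Kp cz t.
have [q Kq <-] := K_backward K_back Kp.
have cm : Num.max s 0 @[s --> t] --> Num.max t 0.
  by apply: (@continuous_max R R idfun (cst 0)); [exact: cvg_id|exact: cvg_cst].
have ge s : 0 <= Num.max s 0 :> R by rewrite le_max lexx orbT.
apply: lin_shift_cvg => //.
- exact: nearW.
- exact: nearW.
- exact: cvg_cst.
- apply: (@cvg_comp _ _ _ (fun s : R => Num.max s 0) (segC r z) _ (nbhs (Num.max t 0))) => //.
  exact: segC_continuous.
Qed.

Variable c : R.
Hypotheses (c1 : 1 <= c) (cL : forall p phi, K p -> `|L p phi| <= c * `|phi|).

Let c0 : 0 <= c. Proof. exact: le_trans c1. Qed.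

Lemma lsol_exists p v : K p -> exists z, lsol p v z.
Proof.
move=> Kp.
have vmin (t : R) : 0 <= t -> v t = v 0.
  by move=> t0; rewrite -(CSpace_clamp v t) /clamp (min_idPr t0) (max_idPr _)// oppr_le0.
have [||||||||||z [cz zv dz]] := @picard R n r%:num c (c * `|v|) v
    (fun t z => L (Pi t p) (segC r z t)) (fun z => continuous z).
- exact: c1.
- exact: mulr_ge0.
- exact: vmin.
- exact: CSpace_continuous.
- by [].
- move=> y cy.
  exact: (lin_along_continuous Kp cy).
- by [].
- by [].
- move=> y1 y2 t m cy1 cy2 t0 Hm.
  rewrite -linB; apply: (le_trans (cL _ (K_Pi Kp t0))).
  by rewrite ler_wpM2l//; exact: segC_le.
- move=> t t0; apply: (le_trans (cL _ (K_Pi Kp t0))); rewrite ler_wpM2l//.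
  by apply: segC_norm_le => [|s _]; [exact: CSpace_continuous|exact: CSpace_le_norm].
exists z; split=> //; apply: CSpace_ext => s /andP[rs s0].
by rewrite segC_val ?rs// add0r zv.
Qed.

Lemma lsol_rder p v z t : lsol p v z -> 0 <= t -> rder z t (L (Pi t p) (segC r z t)).
Proof. by move=> [_ _ dz] t0; apply: deriv_half_rder => //; exact: dz. Qed.

Lemma segCB (y1 y2 : R -> V) t : continuous y1 -> continuous y2 ->
  segC r (fun s => y1 s - y2 s) t = segC r y1 t - segC r y2 t.
Proof.
move=> cy1 cy2; apply: CSpace_ext => s sr.
have cy : continuous (fun s => y1 s - y2 s) by move=> x; apply: cvgB; [exact: cy1|exact: cy2].
rewrite (segC_val t cy sr); change (y1 (t + s) - y2 (t + s) = segC r y1 t s - segC r y2 t s).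
by rewrite !segC_val.
Qed.

Lemma segCZ (k : R) (y : R -> V) t : continuous y ->
  segC r (fun s => k *: y s) t = k *: segC r y t.
Proof.
move=> cy; apply: CSpace_ext => s sr.
have cky : continuous (fun s => k *: y s).
  by move=> x; apply: cvgZ; [exact: cvg_cst|exact: cy].
rewrite (segC_val t cky sr); change (k *: y (t + s) = k *: segC r y t s).
by rewrite !segC_val.
Qed.

Lemma lsol_growth p v z t : K p -> lsol p v z -> 0 <= t -> `|z t| <= `|v| * expR (c * t).
Proof.
move=> Kp lz t0; have [cz zv _] := lz.
have H : forall s, 0 <= s <= t -> `|z s| <= `|v| * expR (c * (s - 0)).
  have := @delay_gronwall _ _ z r%:num 0 t `|v| c 0; rewrite addr0; apply => //.
  - by move=> s; rewrite sub0r => sr; rewrite (segC_segC cz zv sr); exact: CSpace_le_norm.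
  move=> s /andP[s0 st]; exists (L (Pi s p) (segC r z s)); first exact: (lsol_rder lz s0).
  move=> m Hm; rewrite addr0; apply: (le_trans (cL _ (K_Pi Kp s0))).
  by rewrite ler_wpM2l//; exact: segC_norm_le.
by have := H t; rewrite subr0; apply; rewrite t0 lexx.
Qed.

Lemma lsol_init p v z t : lsol p v z -> - r%:num <= t <= 0 -> z t = v t.
Proof. by move=> [cz zv _]; exact: segC_segC. Qed.

Lemma lsol_sub p v v' z z' : lsol p v z -> lsol p v' z' ->
  lsol p (v - v') (fun t => z t - z' t).
Proof.
move=> [cz zv dz] [cz' zv' dz']; split.
- by move=> x; apply: cvgB; [exact: cz|exact: cz'].
- by rewrite segCB// zv zv'.
move=> t t0; rewrite segCB// linB.
have /is_deriv_inP H := dz t t0; have /is_deriv_inP H' := dz' t t0.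
apply/is_deriv_inP => e e0; have e2 : 0 < e / 2 by rewrite divr_gt0.
have [k k0 kP] := H _ e2; have [k' k0' kP'] := H' _ e2.
exists (Num.min k k'); first by rewrite lt_min k0.
move=> h; rewrite lt_min => /andP[hk hk'] th.
set a := L _ _; set b := L _ _.
have -> : z (t + h) - z' (t + h) - (z t - z' t) - h *: (a - b) =
  (z (t + h) - z t - h *: a) - (z' (t + h) - z' t - h *: b).
  by apply/rowP => j; rewrite !mxE; ring.
apply: (le_trans (ler_normB _ _)); rewrite [e in leRHS](splitr e) mulrDl.
by apply: lerD; [exact: kP|exact: kP'].
Qed.

Lemma lsol_scale (k : R) p v z : lsol p v z -> lsol p (k *: v) (fun t => k *: z t).
Proof.
move=> [cz zv dz]; split.
- by move=> x; apply: cvgZ; [exact: cvg_cst|exact: cz].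
- by rewrite segCZ// zv.
move=> t t0; rewrite segCZ// linZ.
have /is_deriv_inP H := dz t t0; apply/is_deriv_inP => e e0.
have k1 : 0 < `|k| + 1 by rewrite ltr_wpDl.
have [d d0 dP] := H _ (divr_gt0 e0 k1); exists d => // h hd th.
set a := L _ _.
have -> : k *: z (t + h) - k *: z t - h *: (k *: a) = k *: (z (t + h) - z t - h *: a).
  by apply/rowP => j; rewrite !mxE; ring.
rewrite normrZ; apply: (le_trans (ler_wpM2l (normr_ge0 _) (dP h hd th))).
rewrite mulrA ler_wpM2r//; apply: frac_le => //; exact: ltW.
Qed.

Lemma lsol_unique p v z z' t : K p -> lsol p v z -> lsol p v z' -> - r%:num <= t -> z t = z' t.
Proof.
move=> Kp lz lz' rt; have [t0|/ltW t0] := leP t 0.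
  by rewrite (lsol_init lz) ?rt// (lsol_init lz') ?rt.
have := lsol_growth Kp (lsol_sub lz lz') t0.
by rewrite subrr normr0 mul0r normr_le0 subr_eq0 => /eqP.
Qed.

Lemma lsol_shift p v z s : K p -> 0 <= s -> lsol p v z ->
  lsol (Pi s p) (segC r z s) (fun t => z (s + t)).
Proof.
move=> Kp s0 [cz zv dz]; split.
- move=> t; apply: (@continuous_comp _ _ _ (fun t => s + t) z); last exact: cz.
  by apply: cvgD; [exact: cvg_cst|exact: cvg_id].
- by rewrite segC_shift addr0.
move=> t t0; rewrite segC_shift (Pi_Pi Kp s0 t0).
apply: is_deriv_in_sub (is_deriv_in_shift (dz (s + t) (addr_ge0 s0 t0))).
by move=> u /= u0; rewrite addr_ge0.
Qed.

(** Smoothing: after time 0 the slope is at most [c] times a sup bound over the preceding window,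
    which puts rescaled segments from time [r] on into [lip_ball c]. *)
Lemma lsol_lip p v z a b m : K p -> lsol p v z -> 0 <= a ->
  (forall s, a - r%:num <= s <= b -> `|z s| <= m) ->
  forall x y, a <= x -> x <= y -> y <= b -> `|z y - z x| <= c * m * (y - x).
Proof.
move=> Kp lz a0 Hm; have [cz _ _] := lz.
apply: deriv_bounded_lip => // t /andP[at_ tb]; have t0 := le_trans a0 at_.
exists (L (Pi t p) (segC r z t)); first exact: (lsol_rder lz t0).
apply: (le_trans (cL _ (K_Pi Kp t0))); rewrite ler_wpM2l//; apply: segC_norm_le => // s /andP[s1 s2].
by apply: Hm; rewrite (le_trans _ s1) ?lerD2r//= (le_trans s2)// ltW.
Qed.

Lemma linear_solution_lsol p v z t : K p -> lsol p v z -> - r%:num <= t ->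
  linear_solution sigma F tau t p v = z t.
Proof.
move=> Kp lz rt; rewrite /linear_solution.
have [cz zv dz] := lz.
have : is_linear_solution sigma F tau p v (xget (cst 0) [set z | is_linear_solution sigma F tau p v z]).
  apply: (@xgetPex _ _ [set z | is_linear_solution sigma F tau p v z]); exists z; split.
  - exact: continuous_subspaceT.
  - by move=> s sr; exact: lsol_init lz sr.
  - exact: dz.
set y : R -> V := xget _ _; clearbody y => -[cy yv dy].
pose Y t := y (Num.max (- r%:num) t).
have yY s : - r%:num <= s -> y s = Y s by move=> rs; rewrite /Y (max_idPr rs).
have cY : continuous Y.
  apply: (within_comp_continuous cy (@maxl_continuous R (- r%:num))) => s /=.
  by rewrite le_max lexx.
rewrite yY//; apply: (lsol_unique Kp _ lz rt); split=> //.
  apply: CSpace_ext => s sr; rewrite segC_val// add0r -yY; last by case/andP: sr.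
  exact: yv.
move=> s s0.
have sE : segC r Y s = segC r y s.
  by apply: segC_eq => u /andP[u1 _]; rewrite yY// (le_trans _ u1)// lerDr.
rewrite sE; apply: (@is_deriv_in_eq _ _ _ y); last exact: dy.
  by move=> u /= u0; apply: yY; rewrite (le_trans _ u0)// oppr_le0 ge0.
by [].
Qed.

Lemma linear_seg_lsol p (v : W) z t : K p -> lsol p (wfun v) z -> 0 <= t ->
  wfun (linear_seg sigma F tau t p v) = segC r z t.
Proof.
move=> Kp lz t0; have [cz zv _] := lz.
have [N N0 HN] := WSpace_lip v.
have E : segC r (fun s => linear_solution sigma F tau s p (wfun v)) t = segC r z t.
  apply: segC_eq => s /andP[s1 _]; apply: linear_solution_lsol => //.
  by rewrite (le_trans _ s1)// lerDr.
have [M M0 HM] := continuous_bounded_itv (- r%:num) t cz.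
rewrite /linear_seg -(@segWE _ _ _ z t (N + c * M))//.
- by rewrite /segW E.
- by rewrite addr_ge0// mulr_ge0.
move=> x y x1 xy yt.
apply: (@lip_glue _ _ z (- r%:num) 0 t) => //; last by rewrite (le_trans _ x1)// lerDr.
- move=> a b ra ab b0; apply: (@le_trans _ _ (N * (b - a))).
    by apply: (seg0_lip (r := r) (N := N) cz _ ra ab b0) => s u; rewrite zv.
  by rewrite ler_wpM2r ?subr_ge0// lerDl mulr_ge0.
move=> a b a0 ab bt; apply: (@le_trans _ _ (c * M * (b - a))).
  apply: (lsol_lip Kp lz (lexx 0) _ a0 ab bt) => s; rewrite sub0r; exact: HM.
by rewrite ler_wpM2r ?subr_ge0// lerDr.
Qed.

(** Joint continuous dependence on base point and initial value at one time [T]. The base point is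
    parametrized by the earlier [q], in which the coefficients are continuous; their variation along
    the fixed [z0] is a forcing term in [delay_gronwall]. *)
Lemma lsol_near q0 v0 z0 T e : K q0 -> lsol (Pi r%:num q0) v0 z0 -> 0 <= T -> 0 < e ->
  \forall q \near q0 & v \near v0, K q ->
    forall z, lsol (Pi r%:num q) v z -> `|segC r z T - segC r z0 T| <= e.
Proof.
move=> Kq0 lz0 T0 e0.
have r0 : 0 <= r%:num by [].
pose e1 := e / 2 / expR (c * `|T|).
have e10 : 0 < e1 by rewrite !divr_gt0// expR_gt0.
have [cz0 zv0 dz0] := lz0.
(* Clipping times at 0 keeps the coefficients meaningful when the covering argument moves [t]
   slightly below 0. *)
pose z0s (t : R) := segC r z0 (Num.max t 0).
have ge (t : R) : 0 <= Num.max t 0 by rewrite le_max lexx orbT.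
have : \forall q \near within K (nbhs q0), `[0, T]%classic `<=` (fun t : R =>
    `|L (Pi (Num.max t 0) (Pi r%:num q)) (z0s t) - L (Pi (Num.max t 0) (Pi r%:num q0)) (z0s t)| <= e1).
  have /compact_near_coveringP := @segment_compact R 0 T.
  move=> /(_ _ (within K (nbhs q0)) (fun q (t : R) =>
    `|L (Pi (Num.max t 0) (Pi r%:num q)) (z0s t) - L (Pi (Num.max t 0) (Pi r%:num q0)) (z0s t)| <= e1)).
  apply => t _.
  pose G := filter_prod (nbhs t) (within K (nbhs q0)).
  have FG : Filter G by exact: filter_prod_filter.
  have i1 : p.1 @[p --> G] --> t by exact: cvg_fst.
  have i2 : p.2 @[p --> G] --> within K (nbhs q0) by exact: cvg_snd.
  have i2' : embed p.2 @[p --> G] --> embed q0.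
    apply: (@cvg_comp _ _ _ snd embed _ (within K (nbhs q0))) => //.
    by apply: cvg_within_filter; exact: embed_continuous.
  have i3 : Num.max p.1 0 @[p --> G] --> Num.max t 0.
    apply: (@cvg_comp _ _ _ fst (fun t : R => Num.max t 0) _ (nbhs t)) => //.
    by apply: (@continuous_max R R idfun (cst 0)); [exact: cvg_id|exact: cvg_cst].
  have i4 : z0s p.1 @[p --> G] --> z0s t.
    apply: (@cvg_comp _ _ _ (fun p => Num.max p.1 0) (segC r z0) _ (nbhs (Num.max t 0))) => //.
    exact: segC_continuous.
  have KG : \forall p \near G, K p.2.
    by apply: i2; exact: withinT.
  have i5 : L (Pi (Num.max p.1 0) (Pi r%:num p.2)) (z0s p.1) @[p --> G] -->
      L (Pi (Num.max t 0) (Pi r%:num q0)) (z0s t).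
    apply: lin_shift_cvg => //.
    exact: nearW.
  have i6 : L (Pi (Num.max p.1 0) (Pi r%:num q0)) (z0s p.1) @[p --> G] -->
      L (Pi (Num.max t 0) (Pi r%:num q0)) (z0s t).
    apply: lin_shift_cvg => //.
    - exact: nearW.
    - exact: nearW.
    - exact: cvg_cst.
  pose l := L (Pi (Num.max t 0) (Pi r%:num q0)) (z0s t).
  have e12 : 0 < e1 / 2 by rewrite divr_gt0.
  move/cvgrPdist_le : i5 => /(_ _ e12) i5; move/cvgrPdist_le : i6 => /(_ _ e12).
  apply: filterS2 i5 => p A B.
  apply: (le_trans (ler_distD l _ _)); rewrite (splitr e1).
  by apply: lerD; [rewrite distrC; exact: A|exact: B].
move=> Hq.
have Hv : \forall v \near v0, `|v0 - v| <= e1.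
  by apply: (@cvgr_dist_le _ _ _ (nbhs v0) _ id v0); [exact: cvg_id|].
exists ([set q | K q -> `[0, T]%classic `<=` (fun t : R =>
    `|L (Pi (Num.max t 0) (Pi r%:num q)) (z0s t) - L (Pi (Num.max t 0) (Pi r%:num q0)) (z0s t)| <= e1)],
  [set v | `|v0 - v| <= e1]); first by split.
move=> [q v] /= [{}Hq {}Hv] Kq z lz; have [cz zv dz] := lz.
have init s : - r%:num <= s <= 0 -> `|z s - z0 s| <= e1.
  move=> sr; rewrite (segC_segC cz zv sr) (segC_segC cz0 zv0 sr) distrC.
  exact: le_trans (CSpace_le_norm (v0 - v) s) Hv.
have e1e : e1 <= e.
  rewrite /e1 ler_pdivrMr ?expR_gt0//; have : 1 <= expR (c * `|T|).
    by rewrite -expR0 ler_expR mulr_ge0.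
  by move=> /(ler_wpM2l (ltW e0)); lra.
apply: segC_le => // t /andP[tT1 tT].
have [t0|/ltW t0] := leP t 0.
  by apply: le_trans e1e; apply: init; rewrite t0 (le_trans _ tT1)// lerDr.
have : `|z t - z0 t| <= (e1 + e1) * expR (c * (t - 0)).
  apply: (@delay_gronwall _ _ (fun t => z t - z0 t) r%:num 0 T e1 c e1).
  - exact: r0.
  - by move=> s; apply: cvgB; [exact: cz|exact: cz0].
  - exact: ltW.
  - exact: ltW.
  - exact: c1.
  - by move=> s; rewrite sub0r; exact: init.
  - move=> s /andP[s0 sT].
    exists (L (Pi s (Pi r%:num q)) (segC r z s) - L (Pi s (Pi r%:num q0)) (segC r z0 s)).
      by apply: rderB; [exact: (lsol_rder lz s0)|exact: (lsol_rder lz0 s0)].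
    move=> m Hm; rewrite -(subrKA (L (Pi s (Pi r%:num q)) (segC r z0 s))).
    apply: (le_trans (ler_normD _ _)); apply: lerD.
      rewrite -linB; apply: (le_trans (cL _ _)); first by apply: K_Pi => //; exact: K_Pi.
      by apply: ler_wpM2l => //; exact: segC_le.
    have := Hq Kq s; rewrite /= in_itv/= s0 (ltW sT) => /(_ isT).
    by rewrite /z0s (max_idPl s0).
  - by rewrite t0 tT.
rewrite subr0 => /le_trans; apply.
apply: (@le_trans _ _ ((e1 + e1) * expR (c * `|T|))).
  apply: ler_wpM2l; first by rewrite addr_ge0// ltW.
  by rewrite ler_expR; apply: ler_wpM2l => //; rewrite (le_trans tT)// ler_norm.
by rewrite -mulr2n -mulr_natl /e1 mulrA divfK ?gt_eqF ?expR_gt0// mulrC divfK.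
Qed.

(** * From pointwise to uniform exponential decay *)

Section uniform_decay.
Variable b : R.
Hypothesis b0 : 0 < b.
Hypothesis pointwise_decay : forall p v z, K p -> lip_ball c v -> lsol p v z ->
  forall e, 0 < e -> exists2 T, 0 <= T & `|segC r z T| < e * expR (- b * T).

(* One decay by kappa absorbs the growth e^{c r} over a window of length r, so that
   the segment at time T + r is in the scaled Lipschitz ball with the norm required
   to iterate. *)
Let kappa := expR (- (c + b) * r%:num).

(** Strict decay at some time persists for nearby [q] and [v] by [lsol_near]; a covering of the
    product of K and [lip_ball c] bounds these times by one [T1], though [T] itself still depends on
    the point. *)
Lemma decay_time : exists2 T1, 0 <= T1 & forall p v z, K p -> lip_ball c v -> lsol p v z ->
  exists T, 0 <= T <= T1 /\ `|segC r z T| <= kappa * expR (- b * T).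
Proof.
have r0 : 0 <= r%:num by [].
have kappa0 : 0 < kappa by exact: expR_gt0.
have /compact_near_coveringP cov : compact (K `*` lip_ball (r := r) (n := n) c).
  by apply: compact_setX => //; exact: lip_ball_compact.
pose P (T1 : R) (qv : (Om * W) * C) := K qv.1 -> forall z, lsol (Pi r%:num qv.1) qv.2 z ->
  exists T, 0 <= T <= T1 /\ `|segC r z T| <= kappa * expR (- b * T).
have : \forall T1 \near +oo, K `*` lip_ball (r := r) (n := n) c `<=` P T1.
  apply: cov => -[q0 v0] [/= Kq0 bv0].
  have Kp0 : K (Pi r%:num q0) by exact: K_Pi.
  have [z0 lz0] := lsol_exists v0 Kp0.
  have [T T0 HT] := pointwise_decay Kp0 bv0 lz0 kappa0.
  have e0 : 0 < kappa * expR (- b * T) - `|segC r z0 T| by rewrite subr_gt0.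
  have [[A B] /= [nA nB] AB] := lsol_near Kq0 lz0 T0 e0.
  exists (A `*` B, [set T1 | T <= T1]).
    split; last by apply: nbhs_pinfty_ge; exact: num_real.
    by exists (A, B).
  move=> [[q v] T1] /= [[Aq Bv] TT1] Kq z lz; exists T; split; first by rewrite T0.
  have := AB (q, v) (conj Aq Bv) Kq z lz => /=.
  have := ler_normD (segC r z T - segC r z0 T) (segC r z0 T); rewrite subrK.
  by move=> A1 A2; apply: (le_trans A1); rewrite -lerBrDr.
move=> /pinfty_ex_gt0[T1 T10 H]; exists T1; first exact: ltW.
move=> p v z Kp bv lz; have [q Kq pE] := K_backward K_back Kp.
by subst p; exact: (H (q, v) (conj Kq bv) Kq z lz).
Qed.

(** Each round rescales the data into [lip_ball c], uses one decay time [T], waits [r] for smoothing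
    and restarts at [S = T + r]. As [S >= r], [m] rounds cover [[0, m r]]; times up to [T1 + r] are
    covered by the growth bound, which fixes the prefactor. *)
Lemma decay_iterate T1 p v z rho (m : nat) : 0 <= T1 ->
  (forall p v z, K p -> lip_ball c v -> lsol p v z ->
    exists T, 0 <= T <= T1 /\ `|segC r z T| <= kappa * expR (- b * T)) ->
  K p -> lsol p v z -> 0 <= rho -> `|v| <= rho ->
  (forall s t : R, `|v s - v t| <= c * rho * `|s - t|) ->
  forall t, 0 <= t <= m%:R * r%:num ->
    `|z t| <= rho * expR ((c + b) * (T1 + r%:num)) * expR (- b * t).
Proof.
move=> T10 HT; have r0 : 0 < r%:num by [].
have short q w y sig t : K q -> lsol q w y -> `|w| <= sig -> 0 <= t -> t <= T1 + r%:num ->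
    `|y t| <= sig * expR ((c + b) * (T1 + r%:num)) * expR (- b * t).
  move=> Kq ly wsig t0 tT; apply: (le_trans (lsol_growth Kq ly t0)).
  rewrite -mulrA -expRD; apply: ler_pM => //; rewrite ?expR_ge0//.
  rewrite ler_expR; have : (c + b) * t <= (c + b) * (T1 + r%:num).
    by apply: ler_wpM2l => //; rewrite addr_ge0// ltW.
  lra.
elim: m p v z rho => [|m IH] p v z rho Kp lz rho0 vrho vl t /andP[t0 tm].
  by apply: (short _ _ _ _ _ Kp lz) => //; rewrite (le_trans tm)// mul0r addr_ge0// ltW.
have [/(short _ _ _ _ _ Kp lz vrho t0)//|tT] := leP t (T1 + r%:num).
(* Rescaling divides by [rho]; for [rho = 0] the solution vanishes. *)
have [rhoE|rhoN] := eqVneq rho 0.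
  have := lsol_growth Kp lz t0 => /le_trans; apply.
  by move: vrho; rewrite rhoE normr_le0 => /eqP ->; rewrite normr0 !mul0r.
have rhop : 0 < rho by rewrite lt_neqAle eq_sym rhoN.
have bv : lip_ball c (rho^-1 *: v).
  split; first by rewrite normrZ normfV gtr0_norm// mulrC ler_pdivrMr// mul1r.
  move=> s u; change (`|rho^-1 *: v s - rho^-1 *: v u| <= c * `|s - u|).
  rewrite -scalerBr normrZ normfV gtr0_norm// mulrC ler_pdivrMr//.
  by rewrite mulrAC; exact: vl.
have [cz _ _] := lz.
have [T [/andP[T0 TT1] HzT]] := HT _ _ _ Kp bv (lsol_scale rho^-1 lz).
have {}HzT : `|segC r z T| <= rho * (kappa * expR (- b * T)).
  by move: HzT; rewrite segCZ// normrZ normfV gtr0_norm// mulrC ler_pdivrMr// mulrC.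
pose S := T + r%:num.
have S0 : 0 <= S by rewrite addr_ge0.
pose rho' := rho * expR (- b * S).
have rho'0 : 0 <= rho' by rewrite mulr_ge0 ?expR_ge0.
(* [kappa] cancels the growth [exp(c r)] during the wait and supplies the decay [exp(- b r)] due for
   it. *)
have rho'E : rho' = rho * (kappa * expR (- b * T)) * expR (c * r%:num).
  by rewrite /rho' /kappa -!mulrA -!expRD; congr (_ * expR _); rewrite /S; ring.
(* The bound reaches back to [T - r = S - 2 r], so it controls the slope on the whole window
   [[S - r, S]]. *)
have HzTS s : T - r%:num <= s <= S -> `|z s| <= rho'.
  move=> /andP[s1 s2]; have [sT|/ltW Ts] := leP s T.
    apply: (@le_trans _ _ (rho * (kappa * expR (- b * T)))).
      apply: le_trans HzT; have := CSpace_le_norm (segC r z T) (s - T).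
      by rewrite segC_val// ?lerBrDl ?subr_le0 ?sT ?andbT// addrC subrK.
    rewrite rho'E ler_peMr ?mulr_ge0 ?expR_ge0//.
    by rewrite -expR0 ler_expR mulr_ge0// ltW.
  have sT0 : 0 <= s - T by rewrite subr_ge0.
  have KPT := K_Pi Kp T0.
  have lzT := lsol_shift Kp T0 lz.
  have := lsol_growth KPT lzT sT0.
  rewrite (addrC T) subrK => /le_trans; apply; rewrite rho'E; apply: ler_pM => //.
  by rewrite ler_expR; apply: ler_wpM2l => //; rewrite lerBlDl.
have St : S <= t by rewrite (le_trans _ (ltW tT))// lerD2r.
have KPS := K_Pi Kp S0.
have lzS := lsol_shift Kp S0 lz.
have := IH _ _ _ rho' KPS lzS rho'0 _ _ (t - S).
rewrite (addrC S) subrK => H; apply: (le_trans (H _ _ _)).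
- apply: segC_norm_le => // s /andP[s1 s2]; apply: HzTS; rewrite s2 andbT.
  by apply: le_trans s1; rewrite /S; lra.
- apply: segC_lip => //; first by rewrite mulr_ge0.
  move=> x y x1 xy yS; apply: (lsol_lip Kp lz T0 HzTS _ xy yS).
  by apply: le_trans x1; rewrite /S addrK.
- rewrite subr_ge0 St/= lerBlDr; apply: (le_trans tm).
  by rewrite -natr1 mulrDl mul1r lerD2l /S lerDr.
- rewrite /rho' mulrAC -[X in _ <= X]mulrA [X in _ <= _ * X]mulrC mulrA.
  rewrite mulrAC -!mulrA -!expRD.
  by apply: ler_wpM2l => //; rewrite ler_expR; lra.
Qed.

(** A datum in C need not be Lipschitz, but the segment at time [r] is, with constant [c * rho], and
    [decay_iterate] starts there. The factor [exp((c + b) r)] pays for the growth and the missing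
    decay during this first wait. *)
Lemma uniform_decay : exists2 k, 1 <= k & forall p v z, K p -> lsol p v z ->
  forall t, - r%:num <= t -> `|z t| <= k * expR (- b * t) * `|v|.
Proof.
have [T1 T10 HT] := decay_time.
have r0 : 0 < r%:num by [].
pose Q := expR ((c + b) * (T1 + r%:num)).
have cb0 : 0 <= c + b by rewrite addr_ge0// ltW.
have Q1 : 1 <= Q by rewrite -expR0 ler_expR mulr_ge0// addr_ge0// ltW.
pose k := expR ((c + b) * r%:num) * Q.
have E1 : 1 <= expR ((c + b) * r%:num) by rewrite -expR0 ler_expR mulr_ge0// ltW.
have k1 : 1 <= k by rewrite -[1]mulr1; apply: ler_pM.
exists k => // p v z Kp lz t rt; have [cz _ _] := lz.
have [tr|/ltW tr] := leP t r%:num.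
  have zt : `|z t| <= `|v| * expR (c * r%:num).
    have [t0|/ltW t0] := leP t 0.
      rewrite (lsol_init lz) ?rt//; apply: (le_trans (CSpace_le_norm _ _)).
      by rewrite ler_peMr// -expR0 ler_expR mulr_ge0// ltW.
    apply: (le_trans (lsol_growth Kp lz t0)).
    by apply: ler_wpM2l => //; rewrite ler_expR; apply: ler_wpM2l.
  apply: (le_trans zt); rewrite mulrC; apply: ler_wpM2r => //.
  rewrite /k mulrAC -expRD.
  apply: (@le_trans _ _ (expR ((c + b) * r%:num - b * t))).
    rewrite ler_expR mulrDl -addrA lerDl subr_ge0.
    by apply: ler_wpM2l => //; exact: ltW.
  by rewrite mulNr ler_peMr ?expR_ge0.
have rr : 0 <= r%:num by exact: ltW.
have KPr := K_Pi Kp rr.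
have lzr := lsol_shift Kp rr lz.
pose rho := `|v| * expR (c * r%:num).
have rho0 : 0 <= rho by rewrite mulr_ge0// expR_ge0.
have zrho s : - r%:num <= s <= r%:num -> `|z s| <= rho.
  move=> /andP[s1 s2]; have [s0|/ltW s0] := leP s 0.
    rewrite (lsol_init lz) ?s1//; apply: (le_trans (CSpace_le_norm _ _)).
    by rewrite ler_peMr// -expR0 ler_expR mulr_ge0// ltW.
  apply: (le_trans (lsol_growth Kp lz s0)).
  by apply: ler_wpM2l => //; rewrite ler_expR; apply: ler_wpM2l.
have [m Hm] : exists m : nat, t - r%:num <= m%:R * r%:num.
  exists (Num.bound ((t - r%:num) / r%:num)); rewrite -ler_pdivrMr//.
  by apply: ltW; apply: archi_boundP; rewrite divr_ge0// subr_ge0.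
have := decay_iterate T10 HT KPr lzr rho0 _ _ (m := m) (t := t - r%:num).
rewrite (addrC r%:num) subrK => H; apply: (le_trans (H _ _ _)).
- apply: segC_norm_le => // s /andP[s1 s2]; apply: zrho; rewrite s2 andbT.
  by apply: le_trans s1; rewrite subrr oppr_le0.
- apply: segC_lip => //; first by rewrite mulr_ge0.
  move=> x y x1 xy yS.
  apply: (lsol_lip Kp lz (lexx 0) _ _ xy yS).
    by move=> s; rewrite sub0r; exact: zrho.
  by move: x1; rewrite subrr.
- by rewrite subr_ge0 tr.
have -> : expR (- b * (t - r%:num)) = expR (b * r%:num) * expR (- b * t).
  by rewrite -expRD; congr expR; ring.
rewrite -/Q /rho /k (mulrDl c b) (expRD (c * _)).
by rewrite le_eqVlt; apply/orP; left; apply/eqP; ring.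
Qed.

End uniform_decay.

End linear_solutions.

(** * Contraction near K *)

Section stability.
Context {R : realType} {Om : metricType R} {r : {posnum R}} {n : nat}.
Local Notation V := 'rV[R]_n.
Local Notation C := (CSpace r n).
Local Notation W := (WSpace r n).
Variables (sigma : R -> Om -> Om) (F : Om -> V -> V -> V) (tau : Om -> C -> R).
Hypothesis Om_compact : compact [set: Om].
Hypotheses (hsigma : is_flow sigma) (htau : forall om x, 0 <= tau om x <= r%:num).
Hypotheses (hF : H1 F) (hT : H2star tau).
Variable K : set (Om * W).
Hypotheses (K_inv : positively_invariant sigma F tau K) (K_compact : compact K).
Hypothesis K_back : forall p, K p -> admits_backward_extension sigma F tau K p.
Local Notation f := (vfield F tau).
Local Notation Pi := (skew_product sigma F tau).
Local Notation orb := (@orb R Om r n sigma F tau).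
Local Notation L := (linearization F tau).

Let orbP p : K p -> gsol sigma F tau p.1 (orb p) /\ segC r (orb p) 0 = wfun p.2.
Proof. exact: (orbP htau K_inv). Qed.
Let orb_continuous p : K p -> continuous (orb p).
Proof. exact: (orb_continuous htau K_inv). Qed.
Let embed_Pi p t : K p -> 0 <= t -> embed (Pi t p) = (sigma t p.1, segC r (orb p) t).
Proof. exact: (embed_Pi Om_compact hsigma htau hF hT K_inv). Qed.
Let K_Pi p t : K p -> 0 <= t -> K (Pi t p).
Proof. exact: (K_Pi K_inv). Qed.
Let Pi_Pi p s t : K p -> 0 <= s -> 0 <= t -> Pi t (Pi s p) = Pi (s + t) p.
Proof. exact: (Pi_Pi Om_compact hsigma htau hF hT K_inv). Qed.

Local Notation lsol := (@lsol R Om r n sigma F tau).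
Variables (c M N cf : R).
Hypotheses (c1 : 1 <= c) (cL : forall p phi, K p -> `|L p phi| <= c * `|phi|).
Hypotheses (M0 : 0 <= M) (KM : forall p, K p -> `|wfun p.2| <= M).
Hypotheses (KN : forall p, K p -> `|f (embed p)| <= N).
Hypotheses (cf1 : 1 <= cf) (fL : forall om (x xb : C), `|x| <= M + 1 -> `|xb| <= M + 1 ->
  (forall s t : R, `|xb s - xb t| <= N * `|s - t|) ->
  `|f (om, x) - f (om, xb)| <= cf * `|x - xb|).

Let c0 : 0 <= c. Proof. exact: le_trans c1. Qed.
Let cf0 : 0 <= cf. Proof. exact: le_trans cf1. Qed.

Let orb_Pi p s t : K p -> 0 <= s -> - r%:num <= t -> orb (Pi s p) t = orb p (s + t).
Proof. exact: (orb_Pi Om_compact hsigma htau hF hT K_inv). Qed.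

Lemma orb_le p t : K p -> - r%:num <= t -> `|orb p t| <= M.
Proof. by move=> Kp; exact: (orb_bounded Om_compact hsigma htau hF hT K_inv Kp KM). Qed.

Let N0 p : K p -> 0 <= N. Proof. by move=> /KN; exact: le_trans. Qed.

Lemma sub_orb_continuous p (y : R -> V) : K p -> continuous y ->
  continuous (fun s => y s - orb p s).
Proof. by move=> Kp cy s; apply: cvgB; [exact: cy|exact: orb_continuous]. Qed.

Lemma orb_seg_lip p t : K p -> 0 <= t ->
  forall s u : R, `|segC r (orb p) t s - segC r (orb p) t u| <= N * `|s - u|.
Proof.
move=> Kp t0; apply: segC_lip; [exact: orb_continuous|exact: N0 Kp|].
move=> u v u1 uv _; apply: (orb_lip Om_compact hsigma htau hF hT K_inv K_back KN Kp) => //.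
by apply: le_trans u1; rewrite lerDr.
Qed.

Lemma orb_seg_le p t : K p -> 0 <= t -> `|segC r (orb p) t| <= M.
Proof.
move=> Kp t0; apply: segC_norm_le => [|s /andP[s1 _]]; first exact: orb_continuous.
by apply: orb_le => //; apply: le_trans s1; rewrite lerDr.
Qed.

Lemma vfield_orb_diff p (y : R -> V) t m : K p -> 0 <= t -> continuous y ->
  (forall s, t - r%:num <= s <= t -> `|y s| <= M + 1) ->
  (forall s, t - r%:num <= s <= t -> `|y s - orb p s| <= m) ->
  `|f (sigma t p.1, segC r y t) - f (sigma t p.1, segC r (orb p) t)| <= cf * m.
Proof.
move=> Kp t0 cy yM ym; apply: (le_trans (fL _ _ _ _)).
- exact: segC_norm_le.
- by apply: (le_trans (orb_seg_le Kp t0)); rewrite lerDl.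
- exact: orb_seg_lip.
- by apply: ler_wpM2l => //; apply: segC_le => //; exact: orb_continuous.
Qed.

(** The orbit stays in the ball of radius [M], where truncation is the identity, and truncation does
    not increase distances; so a truncated path can be compared with the orbit before it is known to
    be a true solution. *)
Lemma tsol_growth p y A t : K p -> tsol sigma F tau (M + 1) p.1 y -> 0 <= A ->
  (forall s, - r%:num <= s <= 0 -> `|y s - orb p s| <= A) -> 0 <= t ->
  `|y t - orb p t| <= A * expR (cf * t).
Proof.
move=> Kp [cy dy] A0 init t0.
have [[co do_] _] := orbP Kp.
have := @delay_gronwall _ _ (fun t => y t - orb p t) r%:num 0 t A cf 0; rewrite addr0 => H.
have {H} := H _ _ A0 (lexx 0) cf1 _ _ t; rewrite subr0; apply => //.
- exact: sub_orb_continuous.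
- by move=> s; rewrite sub0r; exact: init.
- move=> s /andP[s0 st]; exists (f (sigma s p.1, segC r (trunc (M + 1) \o y) s)
      - f (sigma s p.1, segC r (orb p) s)).
    by apply: rderB; apply: deriv_half_rder => //; [exact: dy|exact: do_].
  move=> m Hm; rewrite addr0; apply: vfield_orb_diff => //.
  + exact: trunc_comp_continuous.
  + by move=> u _; apply: trunc_le; rewrite addr_ge0.
  + move=> u uS; rewrite -(@trunc_id _ _ (M + 1) (orb p u)).
      by apply: (le_trans (trunc_lip _ _ _)); exact: Hm.
    apply: (le_trans (orb_le Kp _)); last by rewrite lerDl.
    by case/andP: uS => u1 _; apply: le_trans u1; rewrite lerDr.
- by rewrite t0 lexx.
Qed.

Lemma along_remainder (l e : R) : 0 <= l -> 0 < e -> exists2 k, 0 < k & forall p (y : R -> V) t m,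
  K p -> 0 <= t -> continuous y -> m <= k ->
  (forall s, t - r%:num <= s <= t -> `|y s - orb p s| <= m) ->
  (forall u v, t - r%:num <= u -> u <= v -> v <= t ->
    `|(y v - orb p v) - (y u - orb p u)| <= l * m * (v - u)) ->
  `|f (sigma t p.1, segC r y t) - f (sigma t p.1, segC r (orb p) t)
     - L (Pi t p) (segC r (fun s => y s - orb p s) t)| <= e * m.
Proof.
move=> l0 e0.
have [k k0 H] := lin_remainder Om_compact hsigma htau hF hT K_inv K_compact K_back l0 e0.
exists k => // p y t m Kp t0 cy mk ym yl; have co := orb_continuous Kp.
have m0 : 0 <= m.
  by apply: le_trans (ym t _) => //; rewrite lexx andbT gerBl.
have E := embed_Pi Kp t0; have E2 : wfun (Pi t p).2 = segC r (orb p) t := congr1 snd E.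
have := H (Pi t p) (segC r y t) m (K_Pi Kp t0).
rewrite E E2 -segCB// => {}H.
apply: H => //.
- by apply: segC_norm_le => //; exact: sub_orb_continuous.
- move=> s u _ _; apply: segC_lip; last exact: yl.
    exact: sub_orb_continuous.
  exact: mulr_ge0.
Qed.

(** Supplies the slope of order [m] that [along_remainder] asks for. It holds from time 0 on, so the
    remainder estimate is available from time [r], or from 0 if the initial increment is itself
    Lipschitz of that order. *)
Lemma vfield_diff_lip p (y : R -> V) T m : K p -> continuous y ->
  (forall t, 0 <= t < T -> rder y t (f (sigma t p.1, segC r y t))) ->
  (forall t, - r%:num <= t <= T -> `|y t - orb p t| <= m) -> m <= 1 ->
  forall u v, 0 <= u -> u <= v -> v <= T ->
   `|(y v - orb p v) - (y u - orb p u)| <= cf * m * (v - u).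
Proof.
move=> Kp cy dy ym m1; have [[co do_] _] := orbP Kp.
apply: (@deriv_bounded_lip _ _ (fun t => y t - orb p t)).
  exact: sub_orb_continuous.
move=> t /andP[t0 tT].
have rt s : t - r%:num <= s <= t -> - r%:num <= s <= T.
  by move=> /andP[s1 s2]; rewrite (le_trans _ s1) ?lerDr//= (le_trans s2)// ltW.
exists (f (sigma t p.1, segC r y t) - f (sigma t p.1, segC r (orb p) t)).
  by apply: rderB; [apply: dy; rewrite t0|apply: deriv_half_rder => //; exact: do_].
apply: vfield_orb_diff => // s /rt sT; last exact: ym.
rewrite -[y s](subrK (orb p s)) (le_trans (ler_normD _ _))// addrC lerD//.
  by apply: orb_le => //; case/andP: sT.
exact: le_trans (ym s sT) m1.
Qed.

(** Gronwall for the distance to the linear solution started at time [a] with the same segment: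
    initial error 0, forcing [e * m]. It is used with [a = r] for the contraction and with [a = 0]
    for a Lipschitz increment. *)
Lemma linear_approximation p (y : R -> V) a T m e z : K p -> continuous y -> 0 <= a -> 0 <= e ->
  (forall t, 0 <= t < T -> rder y t (f (sigma t p.1, segC r y t))) -> 0 <= m ->
  (forall t, a <= t < T ->
    `|f (sigma t p.1, segC r y t) - f (sigma t p.1, segC r (orb p) t)
     - L (Pi t p) (segC r (fun s => y s - orb p s) t)| <= e * m) ->
  lsol (Pi a p) (segC r (fun s => y s - orb p s) a) z ->
  forall t, a <= t <= T -> `|(y t - orb p t) - z (t - a)| <= e * m * expR (c * (t - a)).
Proof.
move=> Kp cy a0 e0 dy m0 rem lz t /andP[at_ tT].
have [[co do_] _] := orbP Kp; have [cz _ _] := lz.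
have ch := sub_orb_continuous Kp cy.
have czs : continuous (fun s => z (s - a)).
  move=> s; apply: (@continuous_comp _ _ _ (fun s => s - a) z); last exact: cz.
  by apply: cvgB; [exact: cvg_id|exact: cvg_cst].
have := @delay_gronwall _ _ (fun s => (y s - orb p s) - z (s - a)) r%:num a T 0 c (e * m).
rewrite add0r; apply => //; last by rewrite at_.
- by move=> s; apply: cvgB; [exact: ch|exact: czs].
- exact: mulr_ge0.
- move=> s /andP[s1 s2]; have sa : - r%:num <= s - a <= 0 by rewrite subr_le0 s2 andbT lerBrDr addrC.
  have sE : a + (s - a) = s by rewrite addrC subrK.
  by rewrite (lsol_init lz sa) (segC_val _ ch sa) sE subrr normr0.
move=> s /andP[as_ sT]; have s0 : 0 <= s by exact: le_trans as_.
have sa0 : 0 <= s - a by rewrite subr_ge0.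
have PE : Pi (s - a) (Pi a p) = Pi s p by rewrite (Pi_Pi Kp a0 sa0) addrC subrK.
set X := f (sigma s p.1, segC r y s) - f (sigma s p.1, segC r (orb p) s).
exists (X - L (Pi s p) (segC r z (s - a))).
  apply: rderB.
    by apply: rderB; [apply: dy; rewrite s0|apply: deriv_half_rder => //; exact: do_].
  have := lsol_rder lz sa0; rewrite PE.
  have -> : (fun s => z (s - a)) = (fun s => z (- a + s)) by apply/funext => u; rewrite addrC.
  by rewrite (addrC s) => Hz; apply/(rder_shift z (- a) s).
move=> m' Hm'.
have -> : X - L (Pi s p) (segC r z (s - a)) =
   (X - L (Pi s p) (segC r (fun s => y s - orb p s) s))
   + L (Pi s p) (segC r (fun s => y s - orb p s) s - segC r z (s - a)).
  by rewrite (linB hF hT) addrA subrK.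
rewrite addrC; apply: (le_trans (ler_normD _ _)); apply: lerD; last first.
  by apply: rem; rewrite as_.
apply: (le_trans (cL _ (K_Pi Kp s0))); apply: ler_wpM2l => //.
have -> : segC r z (s - a) = segC r (fun s => z (s - a)) s.
  have -> : (fun s => z (s - a)) = (fun s => z (- a + s)) by apply/funext => u; rewrite addrC.
  by rewrite segC_shift addrC.
by apply: segC_le => // u; exact: Hm'.
Qed.

Section contraction.
Variables (k b b' : R).
Hypotheses (k1 : 1 <= k) (b0 : 0 < b) (bb' : b < b').
Hypothesis decay : forall p v z, K p -> lsol p v z ->
  forall t, - r%:num <= t -> `|z t| <= k * expR (- b' * t) * `|v|.

(** Up to time [r] the difference grows by at most [exp(cf r)]; from [r] on it is shadowed by a
    linear solution decaying at rate [b' > b]. Linear part and shadowing error each take half of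
    [exp(- b T) * A]. *)
Lemma step_contraction : exists T d, [/\ r%:num <= T, 0 < T, 0 < d & forall p y A, K p ->
  tsol sigma F tau (M + 1) p.1 y -> 0 <= A -> A <= d ->
  (forall s, - r%:num <= s <= 0 -> `|y s - orb p s| <= A) ->
  forall s, T - r%:num <= s <= T -> `|y s - orb p s| <= expR (- b * T) * A].
Proof.
have r0 : 0 < r%:num by [].
have bb0 : 0 < b' - b by rewrite subr_gt0.
have b'0 : 0 < b' by exact: lt_trans bb'.
(* Collects the losses: [k], [exp(cf r)] before smoothing, and [exp(2 b' r)] because the window
   begins at [T - r] and the linear solution at [r]. With [(b' - b) * T >= X], the inequality
   [1 + x <= exp x] gives [HX]. *)
pose X := 2 * k * expR (2 * b' * r%:num + cf * r%:num).
have X0 : 0 <= X by rewrite !mulr_ge0 ?expR_ge0// (le_trans ler01).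
pose T := 2 * r%:num + X / (b' - b).
have XT : 0 <= X / (b' - b) by rewrite divr_ge0// ltW.
have T2r : 2 * r%:num <= T by rewrite lerDl.
have rT : r%:num <= T by apply: le_trans T2r; lra.
have T0 : 0 < T by exact: lt_le_trans rT.
have HX : k * expR (2 * b' * r%:num + cf * r%:num) * expR (- b' * T) <= expR (- b * T) / 2.
  have -> : expR (- b * T) = expR ((b' - b) * T) * expR (- b' * T).
    by rewrite -expRD; congr expR; ring.
  rewrite [leRHS]mulrAC; apply: ler_wpM2r; first exact: expR_ge0.
  rewrite ler_pdivlMr// mulrC mulrA -/X.
  apply: (@le_trans _ _ (1 + (b' - b) * T)); last exact: expR_ge1Dx.
  have -> : (b' - b) * T = (b' - b) * (2 * r%:num) + X by rewrite /T mulrDr [X in _ + X]mulrC divfK// gt_eqF.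
  by have : 0 <= (b' - b) * (2 * r%:num) by [rewrite !mulr_ge0// ltW]; lra.
(* Compensates the growth [exp(cf T)] contained in [m] and the factor [exp(c T)] from Gronwall,
   leaving half of the target. *)
pose e := expR (- b * T) / 2 / expR ((cf + c) * T).
have e0 : 0 < e by rewrite !divr_gt0// expR_gt0.
have [d1 d10 Hd1] := along_remainder cf0 e0.
have E0 : 0 < expR (cf * T) by exact: expR_gt0.
(* This radius makes [m <= 1], so the path stays in the ball of radius [M + 1], and [m <= d1], so
   the remainder estimate applies. *)
exists T, (Num.min 1 d1 / expR (cf * T)); split => //.
  by rewrite divr_gt0// lt_min ltr01.
move=> p y A Kp ty A0; rewrite ler_pdivlMr// le_min => /andP[A1 Ad] init s /andP[s1 s2].
pose m := A * expR (cf * T).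
have m0 : 0 <= m by rewrite mulr_ge0// ltW.
have [cy dy] := ty; have [[co do_] _] := orbP Kp.
have growth t : 0 <= t -> `|y t - orb p t| <= A * expR (cf * t) := tsol_growth Kp ty A0 init.
have hm t : - r%:num <= t <= T -> `|y t - orb p t| <= m.
  move=> /andP[rt tT]; have [t0|/ltW t0] := leP t 0.
    apply: (le_trans (init t _)); rewrite ?rt//.
    by rewrite /m ler_peMr// -expR0 ler_expR mulr_ge0// ltW.
  apply: (le_trans (growth t t0)); rewrite /m ler_wpM2l// ler_expR.
  exact: ler_wpM2l.
have yM t : - r%:num <= t <= T -> `|y t| <= M + 1.
  move=> tT; rewrite -[y t](subrK (orb p t)) (le_trans (ler_normD _ _))// addrC lerD//.
    by apply: orb_le => //; case/andP: tT.
  exact: le_trans (hm t tT) A1.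
have win t u : 0 <= t -> t <= T -> t - r%:num <= u <= t -> - r%:num <= u <= T.
  by move=> t0 tT /andP[u1 u2]; rewrite (le_trans _ u1) ?lerDr//= (le_trans u2).
have dy' t : 0 <= t < T -> rder y t (f (sigma t p.1, segC r y t)).
  move=> /andP[t0 tT]; have := deriv_half_rder t0 (dy t t0).
  rewrite (@segC_eq _ _ _ (trunc (M + 1) \o y) y)// => u uS /=.
  by apply: trunc_id; apply: yM; exact: (win t u t0 (ltW tT) uS).
have hlip := vfield_diff_lip Kp cy dy' hm A1.
have rem t : r%:num <= t < T ->
    `|f (sigma t p.1, segC r y t) - f (sigma t p.1, segC r (orb p) t)
     - L (Pi t p) (segC r (fun s => y s - orb p s) t)| <= e * m.
  move=> /andP[rt tT]; have t0 : 0 <= t by exact: le_trans rt.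
  apply: Hd1 => //.
  - by move=> u uS; apply: hm; exact: (win t u t0 (ltW tT) uS).
  - move=> u v u1 uv vt; apply: hlip => //; last by rewrite (le_trans vt)// ltW.
    by apply: le_trans u1; rewrite subr_ge0.
have Kpr : K (Pi r%:num p) by exact: K_Pi.
pose hr := segC r (fun s => y s - orb p s) r%:num.
have [z lz] := lsol_exists Om_compact hsigma htau hF hT K_inv K_compact K_back c1 cL hr Kpr.
have ch := sub_orb_continuous Kp cy.
have hrA : `|hr| <= A * expR (cf * r%:num).
  apply: segC_norm_le => // u /andP[u1 u2]; rewrite subrr in u1.
  apply: (le_trans (growth u u1)); apply: ler_wpM2l => //.
  by rewrite ler_expR; exact: ler_wpM2l.
have rs : r%:num <= s by apply: le_trans s1; rewrite lerBrDr -mulr2n -mulr_natl.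
have srT : r%:num <= s <= T by rewrite rs s2.
have := linear_approximation Kp cy (ltW r0) (ltW e0) dy' m0 rem lz srT.
have zs : `|z (s - r%:num)| <= expR (- b * T) / 2 * A.
  apply: (le_trans (decay Kpr lz _)); first by rewrite lerBrDl addrN; exact: le_trans rs.
  apply: (@le_trans _ _ (k * expR (- b' * (T - 2 * r%:num)) * (A * expR (cf * r%:num)))).
    apply: ler_pM => //; first by rewrite mulr_ge0 ?expR_ge0// (le_trans ler01).
    apply: ler_wpM2l; first exact: le_trans k1.
    rewrite ler_expR !mulNr lerN2; apply: ler_wpM2l; first exact: ltW.
    by move: s1; lra.
  apply: le_trans (ler_wpM2r A0 HX).
  have -> : expR (- b' * (T - 2 * r%:num)) = expR (2 * b' * r%:num) * expR (- b' * T).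
    by rewrite -expRD; congr expR; ring.
  by rewrite (expRD (2 * b' * _)) le_eqVlt; apply/orP; left; apply/eqP; ring.
have em : e * m * expR (c * (s - r%:num)) <= expR (- b * T) / 2 * A.
  apply: (@le_trans _ _ (e * m * expR (c * T))).
    apply: ler_wpM2l; first by rewrite mulr_ge0// ltW.
    by rewrite ler_expR; apply: ler_wpM2l => //; move: s2; lra.
  rewrite /m (_ : e * _ * _ = e * expR ((cf + c) * T) * A); last by rewrite mulrDl expRD; ring.
  by rewrite /e divfK// gt_eqF// expR_gt0.
have := ler_normD (y s - orb p s - z (s - r%:num)) (z (s - r%:num)); rewrite subrK.
move=> B1 B2; apply: (le_trans B1); apply: (le_trans (lerD (le_trans B2 em) zs)).
by rewrite -mulrDl -splitr.
Qed.

(** The new bound [exp(- b T) * A] is again at most [d], and the shifted path solves the truncated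
    equation over [Pi T p], so the step repeats; growth inside one period gives the prefactor. *)
Lemma contraction_iterate T d p y A (j : nat) : 0 < T -> r%:num <= T ->
  (forall p y A, K p ->
    tsol sigma F tau (M + 1) p.1 y -> 0 <= A -> A <= d ->
    (forall s, - r%:num <= s <= 0 -> `|y s - orb p s| <= A) ->
    forall s, T - r%:num <= s <= T -> `|y s - orb p s| <= expR (- b * T) * A) ->
  K p -> tsol sigma F tau (M + 1) p.1 y -> 0 <= A -> A <= d ->
  (forall s, - r%:num <= s <= 0 -> `|y s - orb p s| <= A) ->
  forall t, 0 <= t <= j%:R * T ->
    `|y t - orb p t| <= expR ((cf + b) * T) * expR (- b * t) * A.
Proof.
move=> T0 rT H.
have short q x B t : K q -> tsol sigma F tau (M + 1) q.1 x -> 0 <= B ->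
    (forall s, - r%:num <= s <= 0 -> `|x s - orb q s| <= B) -> 0 <= t -> t <= T ->
    `|x t - orb q t| <= expR ((cf + b) * T) * expR (- b * t) * B.
  move=> Kq tx B0 init t0 tT.
  apply: (le_trans (tsol_growth Kq tx B0 init t0)); rewrite mulrC ler_wpM2r//.
  rewrite -expRD ler_expR; have : (cf + b) * t <= (cf + b) * T.
    by apply: ler_wpM2l => //; rewrite addr_ge0// ltW.
  lra.
elim: j p y A => [|j IH] p y A Kp ty A0 Ad init t /andP[t0 tj].
  by apply: short => //; rewrite (le_trans tj)// mul0r ltW.
have [/(short _ _ _ _ Kp ty A0 init t0)//|/ltW tT] := leP t T.
have KpT := K_Pi Kp (ltW T0).
have tyT : tsol sigma F tau (M + 1) (Pi T p).1 (fun s => y (T + s)).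
  exact: (tsol_shift hsigma (ltW T0) ty).
have eT1 : expR (- b * T) <= 1 by rewrite -expR0 ler_expR mulNr oppr_le0 mulr_ge0// ltW.
have A'0 : 0 <= expR (- b * T) * A by rewrite mulr_ge0// expR_ge0.
have A'd : expR (- b * T) * A <= d by apply: le_trans Ad; rewrite ler_piMl.
have := IH _ _ _ KpT tyT A'0 A'd _ (t - T).
rewrite (orb_Pi Kp (ltW T0)); last first.
  by have r0 : 0 <= r%:num by []; lra.
rewrite (addrC T) subrK => HI; apply: (le_trans (HI _ _)).
- move=> s /andP[rs s0]; rewrite (orb_Pi Kp (ltW T0) rs); apply: (H p y A Kp ty A0 Ad init).
  by rewrite lerD2l rs gerDl.
- by rewrite subr_ge0 tT/= lerBlDr (le_trans tj)// -natr1 mulrDl mul1r.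
rewrite mulrA; apply: ler_wpM2r => //; rewrite -mulrA; apply: ler_wpM2l; first exact: expR_ge0.
by rewrite -expRD ler_expR; lra.
Qed.

(** Existence and decay come together: the truncated solution is global, the contraction keeps it
    within distance 1 of the orbit, so truncation never acts and it is the true solution. *)
Lemma stable_C_of_decay : stable_C sigma F tau K b.
Proof.
have [T [d [rT T0 d0 HT]]] := step_contraction.
pose Q := expR ((cf + b) * T).
have Q1 : 1 <= Q by rewrite -expR0 ler_expR mulr_ge0 ?addr_ge0// ltW.
have Q0 : 0 < Q by exact: lt_le_trans Q1.
(* The bound [Q^-1] ensures [Q * A <= 1], the margin between the radii [M] and [M + 1]. *)
exists Q, (Num.min d Q^-1); split => //; first by rewrite lt_min d0 invr_gt0.
move=> om xb x Kp; set A := `|wfun x - wfun xb|; rewrite le_min => /andP[Ad AQ].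
have A0 : 0 <= A by exact: normr_ge0.
have MM : 0 <= M + 1 by rewrite addr_ge0.
have [y [ty y0]] := tsol_exists Om_compact hsigma hF hT om x MM.
pose p := (om, xb); have [[co do_] o0] := orbP Kp; have [cy dy] := ty.
have init s : - r%:num <= s <= 0 -> `|y s - orb p s| <= A.
  move=> sr; rewrite (segC_segC cy y0 sr) (segC_segC co o0 sr).
  exact: (CSpace_le_norm (wfun x - wfun xb) s).
have bound t : - r%:num <= t -> `|y t - orb p t| <= Q * expR (- b * t) * A.
  move=> rt; have [t0|/ltW t0] := leP t 0.
    apply: (le_trans (init t _)); rewrite ?rt// ler_peMl//.
    rewrite -[leLHS]mulr1; apply: ler_pM => //.
    by rewrite -expR0 ler_expR mulNr oppr_ge0 mulr_ge0_le0// ltW.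
  have [j Hj] : exists j : nat, t <= j%:R * T.
    exists (Num.bound (t / T)); rewrite -ler_pdivrMr//.
    by apply: ltW; apply: archi_boundP; rewrite divr_ge0// ltW.
  by apply: (contraction_iterate T0 rT HT Kp ty A0 Ad init (j := j)); rewrite t0.
have yM t : - r%:num <= t -> `|y t| <= M + 1.
  move=> rt; rewrite -[y t](subrK (orb p t)) (le_trans (ler_normD _ _))// addrC lerD//.
    exact: orb_le.
  have [t0|/ltW t0] := leP t 0.
    apply: (le_trans (init t _)); rewrite ?rt//; apply: (le_trans AQ).
    by rewrite invf_le1.
  apply: (le_trans (bound t rt)).
  have : expR (- b * t) <= 1 by rewrite -expR0 ler_expR mulNr oppr_le0 mulr_ge0// ltW.
  move=> e1; apply: (@le_trans _ _ (Q * 1 * A)).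
    by apply: ler_wpM2r => //; apply: ler_wpM2l => //; exact: ltW.
  by rewrite mulr1 -ler_pdivlMl// mulr1.
have gy := tsol_gsol ty yM.
have [lt sE] := maxsol_gsol Om_compact hsigma htau hF hT gy y0.
have soE t : - r%:num <= t -> solution sigma F tau t om xb = orb p t.
  exact: (solution_orb Om_compact hsigma htau hF hT K_inv Kp).
split=> //.
- by move=> t rt; rewrite (sE t rt) (soE t rt); exact: bound.
move=> t t0.
have -> : wfun (solution_seg sigma F tau t om x) = segC r y t.
  exact: (solution_segE Om_compact hsigma htau hF hT gy y0 t0).
have -> : wfun (solution_seg sigma F tau t om xb) = segC r (orb p) t.
  exact: (wfun_Pi Om_compact hsigma htau hF hT K_inv Kp t0).
apply: segC_le => // s /andP[s1 s2].
apply: (le_trans (bound s _)); first by apply: le_trans s1; rewrite lerDr.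
apply: ler_wpM2r => //; rewrite -[leRHS]mulrA; apply: ler_wpM2l; first exact: ltW.
rewrite -expRD ler_expR; have : b * (t - r%:num) <= b * s by apply: ler_wpM2l => //; exact: ltW.
lra.
Qed.

End contraction.

End stability.

(** * The Lipschitz norm of a segment *)

Section translation.
Context {R : realType}.
Local Notation mu := (@lebesgue_measure R).

Lemma lebesgue_measure_translate (a : R) (A : set R) : measurable A ->
  mu ((fun s => a + s) @^-1` A) = mu A.
Proof.
move=> mA.
have mf : measurable_fun [set: measurableTypeR R] (fun s : measurableTypeR R => (a + s : measurableTypeR R)).
  apply: continuous_measurable_fun => s; apply: cvgD; [exact: cvg_cst|exact: cvg_id].
apply/esym.
apply: (@lebesgue_measure_unique R (pushforward mu (fun s : measurableTypeR R => (a + s : measurableTypeR R)))) => //.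
move=> X [[x y] _ <-] /=.
rewrite /pushforward.
have -> : (fun s : R => a + s) @^-1` `]x, y]%classic = `]x - a, y - a]%classic.
  apply/seteqP; split=> s /=; rewrite !in_itv/=; move=> /andP[? ?]; apply/andP; split; lra.
rewrite !lebesgue_measure_itv/= !lte_fin ltrD2r; case: ifPn => // xy.
by rewrite -!EFinD; congr EFin; ring.
Qed.

Lemma ae_translate (P : R -> Prop) (a : R) :
  {ae mu, forall s, P s} -> {ae mu, forall s, P (a + s)}.
Proof.
move=> [A [mA A0 PA]]; exists ((fun s => a + s) @^-1` A); split.
- rewrite -[X in measurable X]setTI; apply: (_ : measurable_fun _ _) => //.
  apply: continuous_measurable_fun => s; apply: cvgD; [exact: cvg_cst|exact: cvg_id].
- by apply: etrans (lebesgue_measure_translate a mA) A0.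
- by move=> s /= nP; exact: PA.
Qed.

End translation.

Section wnorm.
Context {R : realType} {r : {posnum R}} {n : nat}.
Local Notation V := 'rV[R]_n.
Local Notation W := (WSpace r n).
Local Notation J := (`[- r%:num, 0]%classic).
Local Notation mu := (@lebesgue_measure R).

(** A limit that does not exist is the default point, which is 0, so the bound also holds where
    [deriv_in] has no genuine value. *)
Lemma norm_lim_le {T : Type} (F : set_system T) (g : T -> V) (M : R) : ProperFilter F -> 0 <= M ->
  (\forall x \near F, `|g x| <= M) -> `|lim (g x @[x --> F])| <= M.
Proof.
move=> PF M0 gM; have [cg|ncg] := pselect (cvg (g x @[x --> F])).
  by apply: (cvgr_to_le (cvg_norm cg)).
have -> : lim (g x @[x --> F]) = 0.
  have -> : (0 : V) = point.
    by apply/matrixP => i j; rewrite mxE /point /= mxE.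
  by apply: xgetPN => l Hl; apply: ncg; apply/cvg_ex; exists l.
by rewrite normr0.
Qed.

Lemma linfnorm_ess_sup (x : W) :
  linfnorm x = ess_sup mu ((fun s => `|deriv_in J x s|%:E) \_ J).
Proof.
have mT : (0 < mu [set: R])%E by rewrite -set_itvNyy lebesgue_measure_itv/= ltry.
rewrite /linfnorm unlock ifT; last exact: mT.
congr (ess_sup _ _); apply/funext => s /=; rewrite gee0_abs// /patch.
by case: ifP => // _; rewrite lee_fin.
Qed.

Lemma wnorm_le (x : W) (M : R) : 0 <= M -> `|wfun x| <= M ->
  {ae mu, forall s, J s -> `|deriv_in J x s| <= M} -> `|x| <= M.
Proof.
move=> M0 xM xd; have aef := ae_filter_ringOfSetsType mu.
have H : (linfnorm x <= M%:E)%E.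
  rewrite linfnorm_ess_sup; apply/ess_supP; apply: filterS xd => s sM.
  by rewrite /patch; case: ifPn => [/[!inE] /sM|_]; rewrite lee_fin.
rewrite [leLHS]/Num.Def.normr/= /wnorm ge_max xM/=.
rewrite -lee_fin fineK// ge0_fin_numE ?Lnorm_ge0//.
exact: le_lt_trans H (ltry _).
Qed.

Lemma quotient_le (x : W) (M s : R) : - r%:num <= s <= 0 -> 0 <= M ->
  (\forall h \near 0^', J (s + h) -> `|x (s + h) - x s| <= M * `|h|) ->
  `|deriv_in J x s| <= M.
Proof.
move=> sJ M0 H; have PJ := J_proper sJ.
apply: norm_lim_le => //; rewrite /within /=.
move: H; apply: filterS2 (nbhs_dnbhs_neq (0 : R)) => h h0 H Jsh.
by rewrite normrZ normfV ler_pdivrMl ?normr_gt0// mulrC; exact: H.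
Qed.

Lemma wnorm_deriv_ae (x : W) : {ae mu, forall s, J s -> `|deriv_in J x s| <= `|x|}.
Proof.
have aef := ae_filter_ringOfSetsType mu.
have [M M0 xM] := WSpace_lip x.
have fin : linfnorm x = (fine (linfnorm x))%:E.
  rewrite fineK// ge0_fin_numE ?Lnorm_ge0//; apply: (@le_lt_trans _ _ M%:E); last exact: ltry.
  rewrite linfnorm_ess_sup; apply/ess_supP; apply: nearW => s; rewrite /patch.
  case: ifPn => [/[!inE] sJ|_]; rewrite lee_fin//.
  apply: (@quotient_le x M s) => //.
  apply: nearW => h _; apply: (le_trans (xM _ _)).
  by rewrite (addrC s) addrK.
have := ess_sup_ge mu ((fun s => `|deriv_in J x s|%:E) \_ J).
rewrite -linfnorm_ess_sup fin; apply: filterS => s + sJ.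
rewrite patchT ?inE// lee_fin => /le_trans; apply.
by rewrite [leRHS]/Num.Def.normr/= /wnorm le_max lexx orbT.
Qed.

Lemma J_interior (s : R) : - r%:num < s -> s < 0 ->
  within [set h | J (s + h)] 0^' = 0^' :> set_system R.
Proof.
move=> rs s0; apply/seteqP; split=> A; last by apply: filterS => h.
rewrite /within/=; move=> [e /= e0 eA].
exists (Num.min e (Num.min (s + r%:num) (- s))) => /=.
  by rewrite !lt_min e0 oppr_gt0 s0 andbT/= -ltrBlDr sub0r.
move=> h /=; rewrite sub0r normrN !lt_min => /andP[he /andP[h1 h2]] h0.
apply: eA => //=; first by rewrite sub0r normrN.
move: h1 h2; rewrite !ltr_norml in_itv/= => /andP[h1 _] /andP[_ h2].
by apply/andP; split; lra.
Qed.

Lemma fmap_near_eq {T U : Type} (F : set_system T) {FF : Filter F} (g1 g2 : T -> U) :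
  (\forall x \near F, g1 x = g2 x) -> g1 @ F = g2 @ F.
Proof.
by move=> g12; apply/seteqP; split=> A; rewrite /fmap/= => FA;
  apply: filterS2 g12 FA => x /= ->.
Qed.

(** Where [t + s > 0] the derivative of the segment at [s] is bounded by the slopes of [h]; where
    [t + s < 0], possible only if [t < r], it is the translated derivative of [x0], bounded almost
    everywhere by the W norm of [x0]. *)
Lemma wnorm_seg_le (x x0 : W) (h : R -> V) (t M : R) : continuous h -> 0 <= t -> 0 <= M ->
  wfun x = segC r h t -> wfun x0 = segC r h 0 ->
  (forall s, t - r%:num <= s <= t -> `|h s| <= M) ->
  (t < r%:num -> `|x0| <= M) ->
  (forall u v, t - r%:num <= u -> 0 <= u -> u <= v -> v <= t -> `|h v - h u| <= M * (v - u)) ->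
  `|x| <= M.
Proof.
move=> ch t0 M0 xE x0E hM x0M hlip.
have aef := ae_filter_ringOfSetsType mu.
apply: wnorm_le => //; first by rewrite xE; exact: segC_norm_le.
have := ae_translate t (wnorm_deriv_ae x0).
(* Discarded points: at the ends of the interval [deriv_in] is one-sided, and at [- t] the two
   regimes meet. *)
have ends : {ae mu, forall s : R, [/\ s != - r%:num, s != 0 & s != - t]}.
  exists [set - r%:num; 0; - t]; split.
  - by do 2?[apply: measurableU => //].
  - by apply: countable_lebesgue_measure0; exact: finite_set_countable.
  - move=> s /= /not_and3P H; case: H => /negP; rewrite negbK => /eqP ->; [left; left|left; right|right] => //.
apply: filterS2 ends => s [sr s00 st] dx0 sJ'.
have sJ : - r%:num <= s <= 0 by move: sJ'; rewrite /= in_itv.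
have [rs s0] := andP sJ.
have {}rs : - r%:num < s by rewrite lt_neqAle eq_sym sr.
have {}s0 : s < 0 by rewrite lt_neqAle s00.
have xh u : - r%:num <= u <= 0 -> x u = h (t + u) by move=> uJ; rewrite xE segC_val.
have [ts|ts] := ltP 0 (t + s).
  apply: quotient_le => //; exists (t + s) => // k /=; rewrite sub0r normrN => ks _.
  rewrite /= in_itv/= => kJ; rewrite !xh//.
  move: ks; rewrite ltr_norml => /andP[k1 k2]; have [q1 q2] := andP kJ.
  rewrite addrA; have [k0|k0] := leP 0 k.
    by rewrite ger0_norm//; apply: (le_trans (hlip _ _ _ _ _ _)); lra.
  by rewrite ltr0_norm// distrC; apply: (le_trans (hlip _ _ _ _ _ _)); lra.
have {}ts : t + s < 0.
  by rewrite lt_neqAle ts andbT addrC addr_eq0.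
have tr : t < r%:num by lra.
apply: le_trans (x0M tr).
have tsr : - r%:num < t + s by lra.
have -> : deriv_in J x s = deriv_in J x0 (t + s).
  rewrite /deriv_in !J_interior//; congr (lim _); apply: fmap_near_eq.
  exists (Num.min (- (t + s)) (s + r%:num)) => /=.
    by rewrite lt_min oppr_gt0 ts -ltrBlDr sub0r.
  move=> k /=; rewrite sub0r normrN lt_min !ltr_norml => /andP[/andP[_ k1] /andP[k2 _]] k0.
  congr (_ *: (_ - _)).
    by rewrite xh ?x0E ?segC_val ?add0r ?addrA//; apply/andP; split; lra.
  by rewrite xh ?x0E ?segC_val ?add0r//; apply/andP; split; lra.
by apply: dx0; rewrite /= in_itv/=; apply/andP; split; lra.
Qed.

End wnorm.

(** * The upper Lyapunov exponent *)

Section exponent.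
Context {R : realType}.
Variable g : R -> R.

Lemma exponent_lt (b : R) :
  (limf_esup (fun t : R => (t^-1)%:E * lne (g t)%:E)%E +oo%R < (- b)%:E)%E ->
  \forall t \near +oo, g t < expR (- b * t).
Proof.
rewrite limf_esupE => /ereal_inf_lt[_ [V nV <-]] Vb.
near=> t; have t0 : 0 < t by near: t; exact: nbhs_pinfty_gt.
have Vt : V t by near: t.
have : ((t^-1)%:E * lne (g t)%:E < (- b)%:E)%E.
  by apply: le_lt_trans Vb; apply: ereal_sup_ubound; exists t.
have [gt0|gt0] := leP (g t) 0; first by rewrite (le_lt_trans gt0)// expR_gt0.
rewrite /lne leNgt gt0/= -EFinM lte_fin ltr_pdivrMl// => H.
by rewrite -[ltLHS]lnK ?posrE// ltr_expR mulrC.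
Unshelve. all: by end_near. Qed.

(** Giving up half of the rate absorbs [k] as soon as [t >= 2 ln k / b]; negativity of the exponent
    is all that is wanted from it. *)
Lemma exponent_le (k b : R) : 0 < k -> 0 < b ->
  (\forall t \near +oo, g t <= k * expR (- b * t)) ->
  (limf_esup (fun t : R => (t^-1)%:E * lne (g t)%:E)%E +oo%R <= (- (b / 2))%:E)%E.
Proof.
move=> k0 b0 gk; rewrite limf_esupE.
pose P := [set t : R | ((t^-1)%:E * lne (g t)%:E <= (- (b / 2))%:E)%E].
apply: (@le_trans _ _ (ereal_sup ((fun t : R => ((t^-1)%:E * lne (g t)%:E)%E) @` P))).
  apply: ereal_inf_lbound; exists P => //; rewrite /P/=; near=> t.
  have t0 : 0 < t by near: t; exact: nbhs_pinfty_gt.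
  rewrite /=; have [gt0|gt0] := leP (g t) 0.
    by rewrite gt0_muleNy ?leNye// lte_fin invr_gt0.
  rewrite -EFinM lee_fin ler_pdivrMl//.
  have kt : ln k <= b / 2 * t.
    by rewrite mulrC -ler_pdivrMr ?divr_gt0//; near: t; exact: nbhs_pinfty_ge.
  have : g t <= k * expR (- b * t) by near: t.
  rewrite -ler_ln ?posrE// ?mulr_gt0 ?expR_gt0//.
  by rewrite lnM ?posrE ?expR_gt0// expRK; move: kt; lra.
by apply: ge_ereal_sup => _ [t Pt <-].
Unshelve. all: by end_near. Qed.

End exponent.

(** * From the exponent to stability and back *)

Section lyapunov_stability.
Context {R : realType} {Om : metricType R} {r : {posnum R}} {n : nat}.
Local Notation V := 'rV[R]_n.
Local Notation C := (CSpace r n).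
Local Notation W := (WSpace r n).
Variables (sigma : R -> Om -> Om) (F : Om -> V -> V -> V) (tau : Om -> C -> R).
Hypothesis Om_compact : compact [set: Om].
Hypotheses (hsigma : is_flow sigma) (htau : forall om x, 0 <= tau om x <= r%:num).
Hypotheses (hF : H1 F) (hT : H2star tau).
Variable K : set (Om * W).
Hypotheses (K_inv : positively_invariant sigma F tau K) (K_compact : compact K).
Hypothesis K_back : forall p, K p -> admits_backward_extension sigma F tau K p.
Local Notation f := (vfield F tau).
Local Notation Pi := (skew_product sigma F tau).
Local Notation orb := (@orb R Om r n sigma F tau).
Local Notation L := (linearization F tau).

Let orbP p : K p -> gsol sigma F tau p.1 (orb p) /\ segC r (orb p) 0 = wfun p.2.
Proof. exact: (orbP htau K_inv). Qed.
Let orb_continuous p : K p -> continuous (orb p).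
Proof. exact: (orb_continuous htau K_inv). Qed.

Local Notation lsol := (@lsol R Om r n sigma F tau).
Local Notation lambdaK := (upper_lyapunov_exponent sigma F tau K).

(** Elements of [lip_ball c] are in W, so the exponent applies to them, and the W norm dominates the
    C norm. The gap between [b] and [b'] beats any prescribed factor [e]. *)
Lemma decay_of_exponent (b b' c : R) p v z e : b < b' -> (lambdaK < (- b')%:E)%E ->
  1 <= c -> (forall p phi, K p -> `|L p phi| <= c * `|phi|) ->
  K p -> lip_ball c v -> lsol p v z -> 0 < e ->
  exists2 T, 0 <= T & `|segC r z T| < e * expR (- b * T).
Proof.
move=> bb' lamb c1 cL Kp [_ vlip] lz e0.
have vW : v \in @wseg R r n by apply/wsegP; exists c.
(* The supremum in the exponent excludes the zero vector, for which the time 0 already serves. *)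
pose w : W := MkW vW; have [w0|w0] := eqVneq w 0.
  exists 0 => //; have [_ -> _] := lz; have -> : v = wfun w by [].
  by rewrite w0 normr0 mulr_gt0// expR_gt0.
have lzw : lsol p (wfun w) z by [].
have /exponent_lt H : (limf_esup (fun t : R => (t^-1)%:E * lne (`|linear_seg sigma F tau t p w|)%:E)%E +oo%R < (- b')%:E)%E.
  apply: le_lt_trans lamb.
  apply: (@le_trans _ _ (ereal_sup [set limf_esup (fun t : R => (t^-1)%:E *
    lne (`|linear_seg sigma F tau t p v|)%:E)%E +oo%R | v in [set v : W | v != 0]])).
    by apply: ereal_sup_ubound; exists w.
  by apply: ereal_sup_ubound; exists p.
near (pinfty_nbhs R) => t.
have t0 : 0 <= t by near: t; exact: nbhs_pinfty_ge.
exists t => //; rewrite -(linear_seg_lsol hF hT K_inv c1 cL Kp lzw t0).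
apply: (le_lt_trans (WSpace_le_norm _)).
apply: (@lt_le_trans _ _ (expR (- b' * t))); first by near: t.
rewrite -[e in leRHS]lnK ?posrE// -expRD ler_expR.
have : - ln e / (b' - b) <= t by near: t; apply: nbhs_pinfty_ge; exact: num_real.
by rewrite ler_pdivrMr ?subr_gt0//; lra.
Unshelve. all: by end_near. Qed.

Lemma exponent_gap (b : R) : (lambdaK < (- b)%:E)%E -> exists2 b', b < b' & (lambdaK < (- b')%:E)%E.
Proof.
case: lambdaK => [x||]//.
  rewrite lte_fin => xb; exists ((b - x) / 2); first by lra.
  by rewrite lte_fin; lra.
by move=> _; exists (b + 1); rewrite ?ltrDl ?ltNye.
Qed.

(** Two gaps are needed: [b2 > b'] makes the decay factor as small as the iteration of linear
    solutions demands, and [b' > b] leaves room for the nonlinear remainder. *)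
Lemma stable_C_of_exponent (b : R) : 0 < b -> (lambdaK < (- b)%:E)%E -> stable_C sigma F tau K b.
Proof.
move=> b0 /exponent_gap[b' bb' /exponent_gap[b2 bb2 lamb]].
have b'0 : 0 < b' by exact: lt_trans bb'.
have [M M0 KM] := K_bounded K_compact.
have [N N0 KN] := K_vfield_bounded tau Om_compact hF K_compact.
have [c c1 cL] := lin_bounded Om_compact hsigma htau hF hT K_inv K_compact K_back.
have [cf cf1 fL] := vfield_lipschitz Om_compact hF hT (M + 1) N0.
have [k k1 kP] := uniform_decay Om_compact hsigma htau hF hT K_inv K_compact K_back c1 cL b'0
  (fun p v z Kp vl lz e e0 => decay_of_exponent bb2 lamb c1 cL Kp vl lz e0).
exact: (stable_C_of_decay Om_compact hsigma htau hF hT K_inv K_compact K_back c1 cL M0 KM KN cf1 fL k1 b0 bb' kP).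
Qed.

(** The slope of the difference is at most [cf] times its sup over the preceding [r]; over a segment
    this looks back [2 r], whence [exp(2 b r)]. For [t < r] part of the segment is still the initial
    difference, whose W norm is already in the bound. *)
Lemma stable_W_of_C (b : R) : 0 < b -> stable_C sigma F tau K b -> stable_W sigma F tau K b.
Proof.
move=> b0 [k [d [k1 d0 H]]].
have [M M0 KM] := K_bounded K_compact.
have [N N0 KN] := K_vfield_bounded tau Om_compact hF K_compact.
have [cf cf1 fL] := vfield_lipschitz Om_compact hF hT (M + 1) N0.
have k0 : 0 < k by exact: lt_le_trans k1.
have r0 : 0 < r%:num by [].
have e0 x : 0 < expR x :> R by exact: expR_gt0.
have E1 : 1 <= expR (2 * b * r%:num) by rewrite -expR0 ler_expR !mulr_ge0// ltW.
(* The second entry of the radius keeps the distance to the orbit at most 1 from time -r on, hence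
   the solution in the ball where [cf] is valid. *)
exists (cf * (k * expR (2 * b * r%:num))), (Num.min d (k * expR (b * r%:num))^-1); split.
- rewrite -[leLHS](mulr1 1); apply: ler_pM => //.
  by rewrite -[leLHS](mulr1 1); apply: ler_pM.
- by rewrite lt_min d0/= invr_gt0 mulr_gt0.
move=> om xb x Kp; set B := `|x - xb|; rewrite lt_min => /andP[Bd B1].
have B0 : 0 <= B by exact: normr_ge0.
have AB : `|wfun x - wfun xb| <= B by exact: (WSpace_le_norm (x - xb)).
have [lt Hs _] := H om xb x Kp (le_trans AB (ltW Bd)); split => // t t0.
pose p := (om, xb); have [[co do_] o0] := orbP (Kp : K p).
have [y [[cy dy] y0 yE]] := lifetime_gsol htau lt.
have hB s : - r%:num <= s -> `|y s - orb p s| <= k * expR (- b * s) * B.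
  move=> rs; rewrite -(yE s rs) -(solution_orb Om_compact hsigma htau hF hT K_inv (Kp : K p) rs).
  apply: (le_trans (Hs s rs)); apply: ler_wpM2l => //.
  by rewrite mulr_ge0// ltW.
have hM s : - r%:num <= s -> `|y s| <= M + 1.
  move=> rs; rewrite -[y s](subrK (orb p s)) (le_trans (ler_normD _ _))// addrC lerD//.
    exact: (orb_le Om_compact hsigma htau hF hT K_inv KM).
  apply: (le_trans (hB s rs)); apply: (@le_trans _ _ (k * expR (b * r%:num) * B)).
    apply: ler_wpM2r => //; apply: ler_wpM2l; first exact: ltW.
    rewrite ler_expR; have : b * - s <= b * r%:num by apply: ler_wpM2l; [exact: ltW|lra].
    lra.
  by rewrite mulrC -ler_pdivlMr ?mulr_gt0// div1r ltW.
pose m := k * expR (2 * b * r%:num) * expR (- b * t) * B.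
have hm s : - r%:num <= s -> t - 2 * r%:num <= s -> `|y s - orb p s| <= m.
  move=> rs ts; apply: (le_trans (hB s rs)); apply: ler_wpM2r => //.
  rewrite -[leRHS]mulrA -expRD; apply: ler_wpM2l; first exact: ltW.
  rewrite ler_expR; have : b * (t - 2 * r%:num) <= b * s by apply: ler_wpM2l => //; exact: ltW.
  lra.
have m0 : 0 <= m by rewrite !mulr_ge0// ltW.
have -> : cf * (k * expR (2 * b * r%:num)) * expR (- b * t) * B = cf * m by rewrite /m; ring.
have cfm : m <= cf * m by rewrite ler_peMl.
have ch := sub_orb_continuous htau K_inv (Kp : K p) cy.
apply: (@wnorm_seg_le _ _ _ _ (x - xb) (fun s => y s - orb p s) t) => //.
- by rewrite mulr_ge0// (le_trans _ cf1).
- change (wfun (solution_seg sigma F tau t om x) - wfun (solution_seg sigma F tau t om xb) =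
    segC r (fun s => y s - orb p s) t).
  rewrite segCB// (solution_segE Om_compact hsigma htau hF hT (conj cy dy) y0 t0).
  by rewrite (wfun_Pi Om_compact hsigma htau hF hT K_inv (Kp : K p) t0 : wfun (solution_seg _ _ _ _ _ xb) = _).
- by rewrite segCB// y0 o0.
- by move=> s /andP[s1 _]; apply: (le_trans (hm s _ _) cfm); move: s1; lra.
- move=> tr; apply: le_trans cfm; rewrite -/B /m ler_peMl// -mulrA -expRD.
  rewrite -[leLHS](mulr1 1); apply: ler_pM => //.
  rewrite -[leLHS]expR0 ler_expR; have : b * t <= b * r%:num by apply: ler_wpM2l; apply: ltW.
  by have : 0 <= b * r%:num by [rewrite mulr_ge0// ltW]; lra.
move=> u v tu u0 uv vt.
apply: (@deriv_bounded_lip _ _ (fun s => y s - orb p s) u t) => // s /andP[us st].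
have s0 := le_trans u0 us.
exists (f (sigma s om, segC r y s) - f (sigma s om, segC r (orb p) s)).
  by apply: rderB; apply: deriv_half_rder => //; [exact: dy|exact: do_].
have := vfield_orb_diff Om_compact hsigma htau hF hT K_inv K_back KM KN cf1 fL (Kp : K p) s0 cy.
move=> /(_ m).

apply.
- by move=> w /andP[w1 _]; apply: hM; move: w1; lra.
- by move=> w /andP[w1 _]; apply: hm; move: w1; lra.
Qed.

(** From [t = 2 r] on, a segment and its slopes depend only on the solution at nonnegative times, so
    the sup bound gives a W bound with the extra factor [c * exp(2 b r)]. *)
Lemma exponent_of_linear_bound (k b : R) : 1 <= k -> 0 < b ->
  (forall p v z, K p -> lsol p (wfun v) z -> forall t, 0 <= t -> `|z t| <= k * expR (- b * t) * `|v|) ->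
  (lambdaK <= (- (b / 2))%:E)%E.
Proof.
move=> k1 b0 H.
have [c c1 cL] := lin_bounded Om_compact hsigma htau hF hT K_inv K_compact K_back.
have c0 : 0 < c by exact: lt_le_trans c1.
have k0 : 0 < k by exact: lt_le_trans k1.
have e0 x : 0 < expR x :> R by exact: expR_gt0.
apply: ge_ereal_sup => _ [p Kp <-]; apply: ge_ereal_sup => _ [v /= v0 <-].
apply: (@exponent_le _ _ (c * (k * expR (2 * b * r%:num) * `|v|))) => //.
  by rewrite !mulr_gt0// normr_gt0.
have [z lz] := lsol_exists Om_compact hsigma htau hF hT K_inv K_compact K_back c1 cL (wfun v) Kp.
near=> t; have t2r : 2 * r%:num <= t by near: t; exact: nbhs_pinfty_ge.
have r0 : 0 < r%:num by [].
have t0 : 0 <= t by lra.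
have [cz z0 _] := lz.
pose m := k * expR (2 * b * r%:num) * expR (- b * t) * `|v|.
have m0 : 0 <= m by rewrite !mulr_ge0// ltW.
have zm s : t - 2 * r%:num <= s -> `|z s| <= m.
  move=> ts; apply: (le_trans (H p v z Kp lz s _)); first by lra.
  apply: ler_wpM2r => //.
  rewrite -[leRHS]mulrA -expRD; apply: ler_wpM2l; first exact: ltW.
  rewrite ler_expR; have : b * (t - 2 * r%:num) <= b * s by apply: ler_wpM2l => //; exact: ltW.
  lra.
have -> : c * (k * expR (2 * b * r%:num) * `|v|) * expR (- b * t) = c * m by rewrite /m; ring.
apply: (@wnorm_seg_le _ _ _ _ v z t) => //.
- by rewrite mulr_ge0// ltW.
- exact: (linear_seg_lsol hF hT K_inv c1 cL Kp lz t0).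
- move=> s /andP[s1 _]; apply: (@le_trans _ _ m); last by rewrite ler_peMl.
  by apply: zm; lra.
- by move=> tr; exfalso; lra.
move=> u w tu u0 uw wt.
apply: (lsol_lip K_inv c1 cL Kp lz u0 _ (lexx u) uw wt) => s /andP[s1 _].
by apply: zm; lra.
Unshelve. all: by end_near. Qed.

(** Since [v] is in W, the increment is Lipschitz of order [eps] already on [[-r, 0]], so the
    remainder estimate holds from time 0, without smoothing. The time [t] is fixed before [eps],
    which is why the bound is first obtained up to [eta]. *)
Lemma linear_bound_of_stability (k b d : R) : 1 <= k -> 0 < b -> 0 < d ->
  (forall om (xb x : W), K (om, xb) -> `|x - xb| < d ->
    lifetime sigma F tau om x = +oo%E /\ forall t, 0 <= t ->
    `|solution sigma F tau t om x - solution sigma F tau t om xb| <= k * expR (- b * t) * `|x - xb|) ->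
  forall p (v : W) z, K p -> lsol p (wfun v) z ->
    forall t, 0 <= t -> `|z t| <= k * expR (- b * t) * `|v|.
Proof.
move=> k1 b0 d0 H p v z Kp lz t t0; apply/ler_addgt0Pr => eta eta0.
have [M M0 KM] := K_bounded K_compact.
have [N N0 KN] := K_vfield_bounded tau Om_compact hF K_compact.
have [c c1 cL] := lin_bounded Om_compact hsigma htau hF hT K_inv K_compact K_back.
have [cf cf1 fL] := vfield_lipschitz Om_compact hF hT (M + 1) N0.
have [Nv Nv0 vL] := WSpace_lip v.
have k0 : 0 < k by exact: lt_le_trans k1.
have cf0 : 0 <= cf by exact: le_trans cf1.
(* With this choice [m = eps * m1] dominates the increment on [[-r, 0]] and later; the summand 1
   gives [m1 >= 1], so [m] also controls the initial slope [eps * Nv]. *)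
pose m1 := k * (`|v| + 1).
have m11 : 1 <= m1 by rewrite -[leLHS](mulr1 1); apply: ler_pM => //; rewrite lerDr.
have m10 : 0 < m1 by exact: lt_le_trans m11.
have vm1 : k * `|v| <= m1 by rewrite ler_wpM2l ?lerDl// ltW.
have vm2 : `|v| <= m1 by apply: le_trans vm1; rewrite ler_peMl.
(* Makes [e * m * exp(c t)] equal to [eps * eta]; dividing by [eps] leaves [eta]. *)
pose e := eta / (m1 * expR (c * t)).
have e0 : 0 < e by rewrite divr_gt0// mulr_gt0// expR_gt0.
have l0 : 0 <= cf + Nv by exact: addr_ge0.
have [q q0 Hq] := along_remainder Om_compact hsigma htau hF hT K_inv K_compact K_back l0 e0.
(* The three entries keep the path in the ball of radius [M + 1], in the range of the remainder
   estimate, and within the stability radius [d]. *)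
pose m := Num.min 1 (Num.min q (d / 2)); pose eps := m / m1.
have m0 : 0 < m by rewrite !lt_min q0 ltr01 divr_gt0.
have eps0 : 0 < eps by rewrite divr_gt0.
have mE : m = eps * m1 by rewrite /eps divfK// gt_eqF.
have mle : m <= 1 /\ m <= q /\ m <= d / 2 by rewrite /m !ge_min !lexx !orbT.
have [m_1 [mq md]] := mle.
pose x : W := p.2 + eps *: v.
have xE : x - p.2 = eps *: v by rewrite /x addrC addKr.
have xN : `|x - p.2| = eps * `|v| by rewrite xE normrZ gtr0_norm.
have [] := H p.1 p.2 x _ _.
- by case: (p) Kp.
- rewrite xN; apply: (@le_lt_trans _ _ m); last by move: md; lra.
  by rewrite mE; apply: ler_wpM2l => //; exact: ltW.
rewrite xN => lt Hs; have [[co do_] o0] := orbP Kp.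
have [y [[cy dy] y0 yE]] := lifetime_gsol htau lt.
pose h s := y s - orb p s.
have ch : continuous h := sub_orb_continuous htau K_inv Kp cy.
have r0 : 0 < r%:num by [].
have h0 : segC r h 0 = eps *: wfun v.
  by rewrite segCB// y0 o0; have := congr1 (@wfun R r n) xE.
have hs s : 0 <= s -> `|h s| <= k * expR (- b * s) * (eps * `|v|).
  move=> s0; have rs : - r%:num <= s by lra.
  rewrite /h -(yE s rs) -(solution_orb Om_compact hsigma htau hF hT K_inv Kp rs).
  exact: Hs.
have hm s : - r%:num <= s -> `|h s| <= m.
  move=> rs; rewrite mE; have [s0|/ltW s0] := leP s 0.
    rewrite (segC_segC ch h0) ?rs//.
    change (`|eps *: (wfun v : R -> V) s| <= eps * m1).
    rewrite normrZ gtr0_norm// ler_wpM2l//; first exact: ltW.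
    exact: le_trans (CSpace_le_norm _ _) (le_trans (WSpace_le_norm _) vm2).
  apply: (le_trans (hs s s0)); rewrite mulrCA ler_wpM2l//; first exact: ltW.
  apply: le_trans vm1; rewrite ler_wpM2r// ler_piMr//; first exact: ltW.
  by rewrite -expR0 ler_expR mulNr oppr_le0 mulr_ge0// ltW.
have dy' s : 0 <= s < t -> rder y s (f (sigma s p.1, segC r y s)).
  by move=> /andP[s0 _]; apply: deriv_half_rder => //; exact: dy.
have hlip u w : - r%:num <= u -> u <= w -> w <= t -> `|h w - h u| <= (cf + Nv) * m * (w - u).
  apply: (@lip_glue _ _ h (- r%:num) 0 t) => // u' w' u1 uw w1.
    apply: (@le_trans _ _ (eps * Nv * (w' - u'))).
      apply: (seg0_lip (r := r) (N := eps * Nv) ch) => // s1 s2; rewrite h0.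
      change (`|eps *: (wfun v : R -> V) s1 - eps *: (wfun v : R -> V) s2| <= eps * Nv * `|s1 - s2|).
      rewrite -scalerBr normrZ gtr0_norm// -mulrA ler_wpM2l//; exact: ltW.
    rewrite ler_wpM2r ?subr_ge0// mE mulrCA ler_wpM2l//; first exact: ltW.
    rewrite -[leLHS]mulr1; apply: ler_pM => //; by rewrite lerDr.
  apply: (@le_trans _ _ (cf * m * (w' - u'))).
    apply: (vfield_diff_lip Om_compact hsigma htau hF hT K_inv K_back KM KN cf1 fL Kp cy dy' _ m_1 u1 uw w1).
    by move=> s /andP[rs _]; exact: hm.
  by rewrite ler_wpM2r ?subr_ge0// ler_wpM2r ?(ltW m0)// lerDl.
have rem s : 0 <= s < t ->
    `|f (sigma s p.1, segC r y s) - f (sigma s p.1, segC r (orb p) s)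
     - L (Pi s p) (segC r h s)| <= e * m.
  move=> /andP[s0 st]; apply: Hq => //.
  - by move=> u /andP[u1 _]; apply: hm; lra.
  - by move=> u w u1 uw ws; apply: hlip => //; lra.
have P0 : Pi 0 p = p := Pi0 Om_compact hsigma htau hF hT K_inv Kp.
have lez : lsol (Pi 0 p) (segC r h 0) (fun s => eps *: z s).
  by rewrite P0 h0; exact: (lsol_scale hF hT eps lz).
have tt : 0 <= t <= t by rewrite t0 lexx.
have := linear_approximation Om_compact hsigma htau hF hT K_inv c1 cL Kp cy (lexx 0) (ltW e0) dy' (ltW m0) rem lez tt.
rewrite subr0 -/(h t) => Hd.
rewrite -(ler_pM2l eps0) -[eps in leLHS]gtr0_norm// -normrZ.
have -> : eps *: z t = h t - (h t - eps *: z t) by rewrite opprB addrC subrK.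
apply: (le_trans (ler_normB _ _)); rewrite mulrDr; apply: lerD.
  by rewrite mulrCA; exact: hs.
apply: (le_trans Hd); rewrite mE /e le_eqVlt; apply/orP; left; apply/eqP.
by field; rewrite !gt_eqF// expR_gt0.
Qed.

Lemma exponent_of_stable_C (b : R) : 0 < b -> stable_C sigma F tau K b -> (lambdaK < 0)%E.
Proof.
move=> b0 [k [d [k1 d0 H]]].
apply: (@le_lt_trans _ _ (- (b / 2))%:E); last by rewrite lte_fin oppr_lt0 divr_gt0.
apply: (exponent_of_linear_bound k1 b0); apply: (linear_bound_of_stability k1 b0 d0).
move=> om xb x Kp xd; have AB := WSpace_le_norm (x - xb).
have [lt Hs _] := H om xb x Kp (le_trans AB (ltW xd)); split=> // t t0.
apply: (le_trans (Hs t _)); first by apply: le_trans t0; rewrite oppr_le0.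
by rewrite ler_wpM2l// mulr_ge0 ?expR_ge0// (le_trans _ k1).
Qed.

(** The W norm of a segment dominates its value at 0, which is the solution at time [t]; this gives
    the pointwise estimate that [linear_bound_of_stability] takes. *)
Lemma exponent_of_stable_W (b : R) : 0 < b -> stable_W sigma F tau K b -> (lambdaK < 0)%E.
Proof.
move=> b0 [k [d [k1 d0 H]]].
apply: (@le_lt_trans _ _ (- (b / 2))%:E); last by rewrite lte_fin oppr_lt0 divr_gt0.
apply: (exponent_of_linear_bound k1 b0); apply: (linear_bound_of_stability k1 b0 d0).
move=> om xb x Kp xd; have [lt Hs] := H om xb x Kp xd; split=> // t t0.
have [y [gy y0 yE]] := lifetime_gsol htau lt; have [cy _] := gy.
have rt : - r%:num <= t by apply: le_trans t0; rewrite oppr_le0.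
have [_ o0] := orbP Kp; have co := orb_continuous Kp.
have z0 : - r%:num <= (0 : R) <= 0 by rewrite oppr_le0 ge0 lexx.
have := le_trans (WSpace_le_norm _) (Hs t t0); apply: le_trans.
apply: le_trans (CSpace_le_norm _ 0).
change (`|solution sigma F tau t om x - solution sigma F tau t om xb| <=
  `|wfun (solution_seg sigma F tau t om x) 0 - wfun (solution_seg sigma F tau t om xb) 0|).
rewrite (solution_segE Om_compact hsigma htau hF hT gy y0 t0).
rewrite (wfun_Pi Om_compact hsigma htau hF hT K_inv Kp t0 : wfun (solution_seg _ _ _ _ _ xb) = _).
rewrite !segC_val// addr0 yE//.
by rewrite (solution_orb Om_compact hsigma htau hF hT K_inv Kp rt : solution _ _ _ _ _ xb = _).
Qed.

End lyapunov_stability.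

Theorem theorem4p2 (R : realType) (r : {posnum R}) (n : nat) (hn : (1 <= n)%N)
    (Om : metricType R) (Om_compact : compact [set: Om])
    (sigma : R -> Om -> Om) (hsigma : is_flow sigma)
    (F : Om -> 'rV[R]_n -> 'rV[R]_n -> 'rV[R]_n)
    (tau : Om -> CSpace r n -> R)
    (htau : forall om x, 0 <= tau om x <= r%:num)
    (hF : H1 F) (htau_star : H2star tau)
    (K : set (Om * WSpace r n))
    (K_inv : positively_invariant sigma F tau K)
    (K_compact : compact K)
    (K_base : projects_over_base K)
    (K_back : forall p, K p -> admits_backward_extension sigma F tau K p) :
  let lambdaK := upper_lyapunov_exponent sigma F tau K in
  [/\ (lambdaK < 0)%E <-> exists2 b : R, 0 < b & stable_C sigma F tau K b,
      (lambdaK < 0)%E <-> exists2 b : R, 0 < b & stable_W sigma F tau K b &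
      (lambdaK < 0)%E -> forall b : R, 0 < b -> (b%:E < - lambdaK)%E ->
        stable_C sigma F tau K b /\ stable_W sigma F tau K b].
Proof.
move=> lambdaK.
have toC := @stable_C_of_exponent R Om r n sigma F tau Om_compact hsigma htau hF htau_star K K_inv K_compact K_back.
have toW := @stable_W_of_C R Om r n sigma F tau Om_compact hsigma htau hF htau_star K K_inv K_compact K_back.
have neg : (lambdaK < 0)%E -> exists2 b, 0 < b & (lambdaK < (- b)%:E)%E.
  by move=> l0; apply: exponent_gap; rewrite oppr0.
split.
- split=> [/neg[b b0 /(toC b b0)]|[b b0]]; first by exists b.
  exact: exponent_of_stable_C.
- split=> [/neg[b b0 /(toC b b0)/(toW b b0)]|[b b0]]; first by exists b.
  exact: exponent_of_stable_W.
move=> _ b b0; rewrite lteNr -EFinN => /(toC b b0) Cb.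
by split=> //; exact: toW.
Qed.
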